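(* Let $\mathcal{A}$ be a free, hence supersolvable, $TF_2$ arrangement of rank $r\ge3$, and let $\mathbf{m}$ be a multiplicity on $\mathcal{A}$. Then the reduced codimension two incidence graph $\overline{G}=\overline{G}(\mathcal{A})$ is a tree, and $\mathbf{m}$ is a free multiplicity on $\mathcal{A}$ if and only if there is an orientation of $\overline{G}$ satisfying: (1) every vertex of $\overline{G}$ has at most one incoming edge; (2) the root vertex (no incoming edges) is some $X\in L_2^{\mathrm{trip}}$; (3) given a directed edge $H\to X$ (with $H\in\mathcal{A}$, $X\in L_2^{\mathrm{trip}}$), $\mathbf{m}(H)$ is an exponent of $D(\mathcal{A}_X,\mathbf{m}_X)$. Equivalently, $\mathbf{m}$ is a free multiplicity if and only if there is an ordering $X_1,\dots,X_{r-1}$ of $L_2^{\mathrm{trip}}$ and a supersolvable filtration $\mathcal{A}_1\subset\cdots\subset\mathcal{A}_r$ of $\mathcal{A}$ satisfying: (1') $\mathcal{A}_2=\mathcal{A}_{X_1}$ and $\mathcal{A}_i=\mathcal{A}_{i-1}\cup\mathcal{A}_{X_{i-1}}$; (2') $\mathcal{A}_{X_i}\cap\mathcal{A}_i=\{H_i\}$ for some $H_i\in\mathcal{A}$ ($H_1,\dots,H_{r-1}$ not necessarily distinct); (3') $\mathbf{m}(H_i)$ is an exponent of $D(\mathcal{A}_{X_i},\mathbf{m}_{X_i})$.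
   Context: Let $\mathbb{K}$ be a field, $V$ a finite-dimensional $\mathbb{K}$-vector space, $S=\mathrm{Sym}(V^* )$. An arrangement $\mathcal{A}$ in $V$ is a finite set of linear hyperplanes $H=\ker\alpha_H$. $L=L(\mathcal{A})$ is the intersection lattice (including $V$), ordered by reverse inclusion and ranked by codimension; $L_k$: rank $k$ flats; $r(\mathcal{A})$: codimension of $T(\mathcal{A})=\bigcap_HH$; $\mathcal{A}_X=\{H:X\subseteq H\}$ for $X\in L$; $L_2^{\mathrm{trip}}$: the $X\in L_2$ with $|\mathcal{A}_X|\ge3$. A multiplicity is $\mathbf{m}:\mathcal{A}\to\mathbb{Z}_{>0}$, $\mathbf{m}_X=\mathbf{m}|_{\mathcal{A}_X}$, and $D(\mathcal{A},\mathbf{m})=\{\theta\in\mathrm{Der}_{\mathbb{K}}(S):\theta(\alpha_H)\in\langle\alpha_H^{\mathbf{m}(H)}\rangle\ \forall H\}$. $\mathbf{m}$ is a free multiplicity if $D(\mathcal{A},\mathbf{m})$ is a free $S$-module; $\mathcal{A}$ is free if $\mathbf{m}\equiv1$ is. When $D(\mathcal{A},\mathbf{m})$ is free, its exponents are the degrees of a homogeneous basis ($\theta$ has degree $d$ if $\theta(V^* )\subseteq S_d$); for flats $X$ of rank two $D(\mathcal{A}_X,\mathbf{m}_X)$ is always free. Supersolvable filtration of $\mathcal{A}$ (with $r=r(\mathcal{A})$): $\mathcal{A}_1\subset\cdots\subset\mathcal{A}_r=\mathcal{A}$ with $r(\mathcal{A}_i)=i$ and such that for $i\ge2$ and distinct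 $H,H'\in\mathcal{A}_i$ there is $H''\in\mathcal{A}_{i-1}$ with $H\cap H'\subset H''$; $\mathcal{A}$ is supersolvable if one exists. Codimension two incidence graph $G(\mathcal{A})$: the bipartite graph with vertex set $L_2^{\mathrm{trip}}\cup\mathcal{A}$ and an edge $[X,H]$ between $X\in L_2^{\mathrm{trip}}$ and $H\in\mathcal{A}$ iff $X\subseteq H$. The reduced graph $\overline{G}(\mathcal{A})$ is obtained by removing the vertices $H\in\mathcal{A}$ of valence one. $TF_2$: let $R_0(\mathcal{A})=T(\mathcal{A})^*$ and, for $1\le k\le r$, $R_k(\mathcal{A})=\ker(\pi_{k-1}:\bigoplus_{X\in L_{k-1}}R_{k-1}(\mathcal{A}_X)\to R_{k-1}(\mathcal{A}))$, $\pi_k$ being the sum of the natural maps $R_k(\mathcal{A}_X)\to R_k(\mathcal{A})$ (restriction of functionals for $k=0$, inclusions induced on kernels by inclusion of summands for $k\ge1$). $\mathcal{A}$ is $2$-formal if $\pi_2$ is surjective, and $k$-formal ($k\ge3$) if $(k-1)$-formal and $\pi_k:\bigoplus_{X\in L_k}R_k(\mathcal{A}_X)\to R_k(\mathcal{A})$ is surjective (automatic for $k=r$); totally formal if $\mathcal{A}_X$ is $k$-formal for all $2\le k\le r(X)$, $X\in L$. $\mathcal{A}$ is $TF_2$ if it is totally formal and $R_i(\mathcal{A}_X)=0$ for all $X\in L_i$ and all $i>2$.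
   Formalization: Added: A is irreducible (for a product, e.g. the rank 3 Boolean arrangement, the reduced graph is disconnected, not a tree). (3') is required only for 2≤i≤r−1: including i=1 makes the equivalence false, e.g. {x,y,x−y,z,x−z}, m=(3,3,3,1,2), char 0. *)

(* Defs.v *)
From HB Require Import structures.
From mathcomp Require Export all_boot all_order all_algebra.
From mathcomp Require Export finmap.
From mathcomp.multinomials Require Export mpoly.

Set Implicit Arguments.
Unset Strict Implicit.
Unset Printing Implicit Defensive.

Import GRing.Theory.
Local Open Scope fset_scope.
Local Open Scope ring_scope.

Section Arrangements.
Variables (K : fieldType) (V : vectType K).
Implicit Types (A B : {fset {vspace V}}) (X H U : {vspace V}).

Definition linform := 'Hom(V, K^o).

Definition arrangement A : Prop :=
  forall H, H \in A -> exists2 alpha : linform, alpha != 0 & H = lker alpha.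

Definition acenter A : {vspace V} := (\bigcap_(H <- A) H)%VS.

Definition codim U : nat := (\dim (fullv : {vspace V}) - \dim U)%N.

Definition rank A : nat := codim (acenter A).

(* The intersection lattice; the empty subarrangement contributes V itself. *)
Definition lattice A : {fset {vspace V}} := [fset acenter B | B in fpowerset A].

Definition flats A (k : nat) : {fset {vspace V}} :=
  [fset X in lattice A | codim X == k].

Definition localization A X : {fset {vspace V}} := [fset H in A | (X <= H)%VS].

Definition L2trip A : {fset {vspace V}} :=
  [fset X in flats A 2 | (3 <= #|` localization A X|)%N].

(* A is a product A1 x A2 = {H1 (+) V2} u {V1 (+) H2} of two nonempty
   arrangements A1 in V1 and A2 in V2, where V = V1 (+) V2. *)
Definition reducible A : Prop :=
  exists V1 V2 : {vspace V},
    [/\ (V1 + V2)%VS = fullv /\ (V1 :&: V2)%VS = 0%VS,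
        forall H, H \in A -> (V1 <= H)%VS \/ (V2 <= H)%VS,
        exists2 H, H \in A & (V1 <= H)%VS
      & exists2 H, H \in A & (V2 <= H)%VS].

Definition irreducible_arrangement A : Prop := ~ reducible A.

(* F i is the i-th step, for 1 <= i <= rank A; other values are irrelevant. *)
Definition supersolvable_filtration A (F : nat -> {fset {vspace V}}) : Prop :=
  [/\ F (rank A) = A,
      forall i, (1 <= i < rank A)%N -> F i `<=` F i.+1,
      forall i, (1 <= i <= rank A)%N -> rank (F i) = i
    & forall i, (2 <= i <= rank A)%N ->
      forall H H', H \in F i -> H' \in F i -> H != H' ->
      exists2 H'', H'' \in F i.-1 & (H :&: H' <= H'')%VS].

Definition supersolvable A : Prop := exists F, supersolvable_filtration A F.

(* Sym(V^* ) is the polynomial ring whose variables are the coordinate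
   functions of V in the basis vbasis fullv. *)
Definition symV := {mpoly K[\dim (fullv : {vspace V})]}.

Definition sym_of_linform (alpha : linform) : symV :=
  \sum_i (alpha (tnth (vbasis fullv) i) : K) *: 'X_i.

Definition derivation (theta : symV -> symV) : Prop :=
  [/\ forall f g, theta (f + g) = theta f + theta g,
      forall (c : K) f, theta (c *: f) = c *: theta f
    & forall f g, theta (f * g) = f * theta g + theta f * g].

Definition multiplicity A (m : {vspace V} -> nat) : Prop :=
  forall H, H \in A -> (0 < m H)%N.

(* The linear form defining H is unique up to a nonzero scalar, so that
   quantifying over all of them amounts to fixing one.  Only the values of m
   on A matter; in particular the restriction of m to a localization of A is
   m itself. *)
Definition logder A (m : {vspace V} -> nat) (theta : symV -> symV) : Prop :=
  derivation theta /\
  forall H (alpha : linform), H \in A -> lker alpha = H ->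
    exists q, theta (sym_of_linform alpha) = q * sym_of_linform alpha ^+ m H.

Definition module_basis (D : (symV -> symV) -> Prop)
    (n : nat) (theta : 'I_n -> symV -> symV) : Prop :=
  [/\ forall i, D (theta i),
      forall eta, D eta ->
        exists p : 'I_n -> symV, forall f, eta f = \sum_i p i * theta i f
    & forall p : 'I_n -> symV,
        (forall f, \sum_i p i * theta i f = 0) -> forall i, p i = 0].

(* D(A, m) is a submodule of the free module Der(Sym(V^* )) of finite rank, so
   any basis of it is finite. *)
Definition free_multiplicity A (m : {vspace V} -> nat) : Prop :=
  exists n (theta : 'I_n -> symV -> symV), module_basis (logder A m) theta.

Definition free_arrangement A : Prop := free_multiplicity A (fun=> 1%N).

Definition derivation_degree (theta : symV -> symV) (d : nat) : Prop :=
  forall alpha : linform, theta (sym_of_linform alpha) \is d.-homog.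

Definition is_exponent A (m : {vspace V} -> nat) (d : nat) : Prop :=
  exists n (theta : 'I_n -> symV -> symV) (deg : 'I_n -> nat),
    [/\ module_basis (logder A m) theta,
        forall i, derivation_degree (theta i) (deg i)
      & exists i, deg i = d].

(* The spaces R_k(B), for B a localization of A, are all realised inside one
   ambient space depending only on A and k: dual vectors for k = 0, families
   indexed by the lattice of A for k > 0.  The direct sum of the
   R_k(B_X), X in L_k(B), is the set of families supported on L_k(B) with X-th
   member in R_k(B_X). *)
Fixpoint ambientR A (k : nat) : vectType K :=
  match k with
  | 0 => linform
  | k'.+1 => {ffun lattice A -> ambientR A k'}
  end.

(* A functional on T(B) is represented by its extension by zero along the
   complement (T(B))^C, so that restriction to T(B) is precomposition with the
   projection onto T(B) along that complement.  For k > 0 the natural map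
   R_k(B_X) -> R_k(B) is extension of families by zero, i.e. the identity of
   the ambient space. *)
Definition natural_map A (k : nat) B : ambientR A k -> ambientR A k :=
  match k with
  | 0 => fun f : linform => (f \o projv (acenter B))%VF
  | _.+1 => id
  end.

Definition piR A k B (c : {ffun lattice A -> ambientR A k}) : ambientR A k :=
  \sum_X natural_map B (c X).

Definition direct_sumR A k B (R : {vspace V} -> ambientR A k -> Prop)
    (c : {ffun lattice A -> ambientR A k}) : Prop :=
  forall X : lattice A,
    if val X \in flats B k then R (val X) (c X) else c X = 0.

Fixpoint inR A (k : nat) B : ambientR A k -> Prop :=
  match k with
  | 0 => fun f : linform => ((acenter B)^C <= lker f)%VS
  | k'.+1 => fun c : {ffun lattice A -> ambientR A k'} =>
      direct_sumR B (fun X => @inR A k' (localization B X)) c /\ piR B c = 0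
  end.

Definition piR_surjective A (k : nat) : Prop :=
  forall v : ambientR A k, inR A v ->
  exists2 c, direct_sumR A (fun X => @inR A k (localization A X)) c
           & piR A c = v.

Definition formal A (k : nat) : Prop :=
  forall j, (2 <= j <= k)%N -> piR_surjective A j.

Definition totally_formal A : Prop :=
  forall X, X \in lattice A ->
  forall k, (2 <= k <= codim X)%N -> formal (localization A X) k.

Definition trivialR A (k : nat) : Prop :=
  forall v : ambientR A k, inR A v -> v = 0.

Definition TF2 A : Prop :=
  totally_formal A /\
  forall i, (2 < i)%N -> forall X, X \in flats A i ->
    trivialR (localization A X) i.

Definition incidence_vertex A : finType := (L2trip A + A)%type.

Definition incidence_edge A : rel (incidence_vertex A) := fun u v =>
  match u, v with
  | inl X, inr H | inr H, inl X => (val X <= val H)%VS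
  | _, _ => false
  end.

Definition reduced_vertex_pred A : pred (incidence_vertex A) := fun v =>
  if v is inr _ then #|[set u | incidence_edge u v]| != 1%N else true.

Definition reduced_vertex A : finType :=
  {v : incidence_vertex A | reduced_vertex_pred v}.

Definition reduced_edge A : rel (reduced_vertex A) := fun u v =>
  incidence_edge (val u) (val v).

End Arrangements.

Definition is_tree (T : finType) (e : rel T) : Prop :=
  [/\ (0 < #|T|)%N,
      forall x y, connect e x y
    & forall c : seq T, (2 < size c)%N -> ~ ucycle e c].

(* o u v means that the edge between u and v is directed from u to v. *)
Definition orientation (T : finType) (e o : rel T) : Prop :=
  forall u v, e u v = (o u v || o v u) /\ ~~ (o u v && o v u).

Definition no_incoming (T : finType) (o : rel T) (v : T) : Prop :=
  forall u, ~~ o u v.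

(* Main.v *)
Require Import Defs.
From mathcomp Require Import ring zify.
From Stdlib Require Import Classical ClassicalEpsilon.

(** Write S for the symmetric algebra and alpha_H for a linear form with kernel
    H.  A derivation of S is a polynomial vector field v, determined by the
    values ev alpha v on linear forms, and membership in D(A, m) says that
    ev alpha_H v = q alpha_H^(m H) for some cofactor q, for each H.  The proof
    rests on three ideas.

    First, 2-formality and the vanishing of R_3 dualize to two statements about
    functions on A: a function that near each rank two flat is the restriction
    of a vector of V is globally such a restriction (TF2_glue), and for each flag
    (X, H) some function is such a restriction near every flat other than X, and
    near X once the indicator of H is subtracted (TF2_bridge).

    Second, if D(A, m) is free, then the problem of finding a vector field v
    with ev alpha_H v = s_H modulo alpha_H^(m H) is solvable as soon as it is
    solvable near each rank two flat (solvable_local).  Freeness makes Der/D(A, m)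
    of projective dimension one, so the obstruction, being supported in
    codimension three, is killed by the Koszul complex of three independent
    forms.  Applied to the cochain of TF2_bridge, multiplied by alpha_H^(m H),
    this produces for each flag (X, H) one family of cofactors f_G, G in A,
    realised by a logarithmic field near every flat Y other than X, and near X
    after subtracting one at H (free_flag_cofactors).  Only the constant terms of
    the f_G matter.  For m = 1 they are constant on each Y other than X and jump
    at (X, H), so every edge of the incidence graph is a bridge (bridge_side);
    irreducibility and 2-formality give connectedness, hence a tree.  For general
    m, the hyperplanes with nonzero constant term spread from H along the flags
    (Y, G) at which m G is an exponent, and only along those
    (unit_value_propagate).  Consequently two flags that are not exponent flags
    never face each other in the tree, and a root can be chosen from which all
    edges H -> X are exponent flags (exists_root).

    Third, an orientation unrolls into an ordering of the rank two flats in which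
    each one meets the union of its predecessors in a single hyperplane
    (grown_full); the rank grows by one at each step (cut_vector).  Conversely
    along such an ordering a basis of D(F_i, m) extends to one of D(F_(i+1), m):
    if m H is an exponent of D(A_X, m_X), some field there takes the value
    alpha_H^(m H) at H, and a field on F_i can be prolonged by multiples of it
    (free_mod_center_add_flat).  The starting point is that multiarrangements of
    rank two are free with a homogeneous basis whose degrees add up to at most
    the total multiplicity (rank2_basis). *)

Set Implicit Arguments.
Unset Strict Implicit.
Unset Printing Implicit Defensive.

Import GRing.Theory.
Local Open Scope fset_scope.
Local Open Scope ring_scope.

(** * Linear systems over a field *)

Section Fredholm.
Variables (K : fieldType) (W : vectType K) (I : finType).

Lemma functional_sum (g : W -> K) (n : nat) (a : 'I_n -> K) (w : 'I_n -> W) :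
    (forall b u v, g (b *: u + v) = b * g u + g v) ->
  g (\sum_i a i *: w i) = \sum_i a i * g (w i).
Proof.
move=> glin; have g0 : g 0 = 0.
  by have := glin (-1) 0 0; rewrite scaler0 addr0 mulN1r addNr.
by elim/big_rec2: _ => // i u v _ <-; rewrite glin.
Qed.

(** If c were not in the image of the system, a column of the cokernel of its
    matrix would give a relation t among the equations that c violates. *)
Lemma fredholm (f : I -> W -> K) (c : I -> K) :
    (forall i a u v, f i (a *: u + v) = a * f i u + f i v) ->
    (forall t : I -> K, (forall w, \sum_i t i * f i w = 0) ->
       \sum_i t i * c i = 0) ->
  exists w, forall i, f i w = c i.
Proof.
move=> flin relc.
pose e := vbasis (fullv : {vspace W}).
pose M : 'M[K]_(\dim (fullv : {vspace W}), #|I|) :=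
  \matrix_(k, j) f (enum_val j) (tnth e k).
pose c' : 'rV[K]_#|I| := \row_j c (enum_val j).
have /submxP[D cE]: (c' <= M)%MS.
  rewrite submxE; apply/eqP/rowP => j; rewrite !mxE.
  pose t i := cokermx M (enum_rank i) j.
  transitivity (\sum_i t i * c i).
    rewrite [RHS](reindex (@enum_val I I)) /=; last exact/onW_bij/enum_val_bij.
    by apply: eq_bigr => k _; rewrite mxE /t enum_valK mulrC.
  apply: relc => w; rewrite (coord_vbasis (memvf w)).
  rewrite (eq_bigr (fun i => \sum_k t i * (coord e k w * f i e`_k))); last first.
    by move=> i _; rewrite (functional_sum _ _ (flin i)) mulr_sumr.
  rewrite exchange_big big1 //= => k _.
  have: (M *m cokermx M) k j = 0 by rewrite mulmx_coker mxE.
  rewrite mxE (reindex (@enum_rank I)) /=; last exact/onW_bij/enum_rank_bij.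
  move=> E; rewrite -[RHS](mulr0 (coord e k w)) -[in RHS]E mulr_sumr.
  apply: eq_bigr => i _; rewrite [M _ _]mxE enum_rankK (tnth_nth 0) /t.
  by rewrite mulrCA; congr (_ * _); rewrite mulrC.
exists (\sum_k D 0 k *: tnth e k) => i.
have /rowP/(_ (enum_rank i)) := cE; rewrite !mxE enum_rankK => ->.
rewrite (functional_sum _ _ (flin i)); apply: eq_bigr => k _.
by rewrite mxE enum_rankK.
Qed.
End Fredholm.

(** The annihilator of an intersection of kernels is spanned by the forms: the
    unknowns are now the coefficients t, the equations are indexed by a basis. *)
Lemma lker_bigcap_span (K : fieldType) (W : vectType K) (I : finType)
    (f : I -> 'Hom(W, K^o)) (g : 'Hom(W, K^o)) :
    (forall w, (forall i, f i w = 0) -> g w = 0) ->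
  exists t : I -> K, forall w, g w = \sum_i t i * f i w.
Proof.
move=> fg; pose e := vbasis (fullv : {vspace W}).
have glin (h : 'Hom(W, K^o)) b u v : h (b *: u + v) = b * h u + h v.
  by rewrite linearP.
pose ev k (t : {ffun I -> K^o}) : K := \sum_i t i * f i (tnth e k).
have evlin k a u v : ev k (a *: u + v) = a * ev k u + ev k v.
  rewrite /ev mulr_sumr -big_split; apply: eq_bigr => i _ /=.
  by rewrite !ffunE mulrDl mulrA.
have [||t tE] := fredholm (f := ev) (c := fun k => g (tnth e k)) => //.
  move=> s sE; rewrite -(functional_sum _ _ (glin g)); apply: fg => i.
  rewrite (functional_sum _ _ (glin (f i))).
  apply: etrans (sE [ffun j => (j == i)%:R]).
  apply: eq_bigr => k _; congr (_ * _).
  rewrite /ev (bigD1 i) //= ffunE eqxx mul1r big1 ?addr0 // => j /negPf ji.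
  by rewrite ffunE ji mul0r.
exists t => w; rewrite (coord_vbasis (memvf w)).
rewrite (functional_sum _ _ (glin g)).
under eq_bigr do rewrite -tnth_nth -tE /ev mulr_sumr.
rewrite exchange_big; apply: eq_bigr => i _ /=.
rewrite (functional_sum _ _ (glin (f i))) mulr_sumr; apply: eq_bigr => k _.
by rewrite mulrCA (tnth_nth 0).
Qed.

(** * Hyperplanes and flats of rank two *)

Section Hyperplanes.
Variables (K : fieldType) (V : vectType K).
Implicit Types (A B : {fset {vspace V}}) (X H : {vspace V}) (a b : linform V).

(** A form with kernel H, when H is a hyperplane; the choice among its nonzero
    multiples is immaterial for divisibility. *)
Definition form_of H : linform V :=
  epsilon (inhabits 0) (fun a => a != 0 /\ H = lker a).

Lemma lker_scale a b : (lker a <= lker b)%VS -> exists k : K, b = k *: a.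
Proof.
move=> ab; have [w w0|t tE] := lker_bigcap_span (f := fun _ : unit => a) (g := b).
  by apply/eqP; rewrite -memv_ker (subvP ab) // memv_ker w0.
exists (t tt); apply/lfunP => w; rewrite tE scale_lfunE.
by rewrite (big_pred1 tt) //; case.
Qed.

Lemma exists_dual a : a != 0 -> exists v, a v = 1.
Proof.
move=> a0; have [v av0]: exists v, a v != 0.
  apply: NNPP => nv; case/negP: a0; apply/eqP/lfunP => v; rewrite zero_lfunE.
  by apply/eqP/negPn/negP => av; apply: nv; exists v.
by exists ((a v)^-1 *: v); rewrite linearZ /= /GRing.scale /= mulVf.
Qed.

Lemma codim_lker a : a != 0 -> codim (lker a) = 1%N.
Proof.
move=> a0; rewrite /codim.
have := limg_ker_dim a fullv; rewrite capfv => <-; rewrite addKn.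
suff -> : limg a = fullv by rewrite dimvf.
have [v av1] := exists_dual a0.
apply/eqP; rewrite eqEsubv subvf; apply/subvP => k _.
rewrite -[k]mulr1 -{1}av1; rewrite (_ : k * a v = a (k *: v)) ?memv_img ?memvf //.
by rewrite linearZ.
Qed.

Lemma sub_acenterP A (U : {vspace V}) :
  reflect (forall H, H \in A -> (U <= H)%VS) (U <= acenter A)%VS.
Proof.
rewrite /acenter; apply: (iffP idP) => [UA H HA|UA].
  by apply: subv_trans UA _; rewrite (big_rem H) //= capvSl.
rewrite big_seq; elim/big_ind: _ => [|W W' UW UW'|H /UA //]; first exact: subvf.
by rewrite subv_cap UW.
Qed.

Lemma mem_acenterP A (v : V) :
  reflect (forall H, H \in A -> v \in H) (v \in acenter A).
Proof. by rewrite memvE; apply: (iffP (sub_acenterP _ _)) => h H /h; rewrite memvE. Qed.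

Lemma acenter_sub A H : H \in A -> (acenter A <= H)%VS.
Proof. by move: H; apply/sub_acenterP. Qed.

Lemma acenterS A B : A `<=` B -> (acenter B <= acenter A)%VS.
Proof. by move=> /fsubsetP AB; apply/sub_acenterP => H /AB; apply: acenter_sub. Qed.

Lemma latticeP A X :
  reflect (exists2 B, B `<=` A & X = acenter B) (X \in lattice A).
Proof.
apply: (iffP (imfsetP _ _ _ _)) => -[B /= BA ->]; exists B => //.
  by move: BA; rewrite fpowersetE.
by rewrite fpowersetE.
Qed.

Lemma in_flats A k X : (X \in flats A k) = (X \in lattice A) && (codim X == k).
Proof. by rewrite !inE. Qed.

Lemma in_loc A X H : (H \in localization A X) = (H \in A) && (X <= H)%VS.
Proof. by rewrite !inE. Qed.

Lemma loc_sub A X : localization A X `<=` A.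
Proof. by apply/fsubsetP => H; rewrite in_loc => /andP[]. Qed.

Lemma codimS (U W : {vspace V}) : (U <= W)%VS -> (codim W <= codim U)%N.
Proof. by move=> /dimvS UW; rewrite /codim leq_sub2l. Qed.

Lemma codim_eq (U W : {vspace V}) : (U <= W)%VS -> codim U = codim W -> U = W.
Proof.
move=> UW cE; apply/eqP; rewrite eqEdim UW /=.
by move: cE (dimvS (subvf U)) (dimvS (subvf W)); rewrite /codim; lia.
Qed.

Lemma codim_full : codim (fullv : {vspace V}) = 0%N.
Proof. by rewrite /codim subnn. Qed.

Lemma codim_capS (U : {vspace V}) a : (codim (U :&: lker a) <= (codim U).+1)%N.
Proof.
have := limg_ker_dim a U; rewrite /codim.
have: (\dim (a @: U) <= 1)%N.
  by apply: leq_trans (dimvS (subvf (a @: U)%VS)) _; rewrite dimvf.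
by have := dimvS (subvf U); lia.
Qed.

Section Arr.
Variable A : {fset {vspace V}}.
Hypothesis A_arr : arrangement A.

Lemma form_of_spec H : H \in A -> form_of H != 0 /\ H = lker (form_of H).
Proof. move=> /A_arr[a a0 HE].
exact: (@epsilon_spec _ _ (fun a => a != 0 /\ H = lker a) (ex_intro _ a (conj a0 HE))). Qed.

Lemma form_of_neq0 H : H \in A -> form_of H != 0.
Proof. by case/form_of_spec. Qed.

Lemma form_ofK H : H \in A -> lker (form_of H) = H.
Proof. by case/form_of_spec. Qed.

Lemma mem_hyp H v : H \in A -> (v \in H) = (form_of H v == 0).
Proof. by move=> HA; rewrite -memv_ker form_ofK. Qed.

Lemma codim_hyp H : H \in A -> codim H = 1%N.
Proof. by case/form_of_spec => /codim_lker E HE; rewrite [H in codim H]HE. Qed.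

Lemma hyp_sub_eq H H' : H \in A -> H' \in A -> (H <= H')%VS -> H = H'.
Proof. by move=> HA H'A HH'; apply: codim_eq HH' _; rewrite !codim_hyp. Qed.

Lemma codim_cap2 H H' : H \in A -> H' \in A -> H != H' -> codim (H :&: H') = 2%N.
Proof.
move=> HA H'A neq.
have := codim_capS H (form_of H'); rewrite form_ofK // (codim_hyp HA).
have := codimS (capvSl H H'); rewrite (codim_hyp HA).
suff: codim (H :&: H') != 1%N by lia.
apply/eqP => c1; case/eqP: neq; apply: hyp_sub_eq => //.
by rewrite -(codim_eq (capvSl H H')) ?capvSr // c1 codim_hyp.
Qed.

Lemma lattice_cap H H' : H \in A -> H' \in A -> (H :&: H')%VS \in lattice A.
Proof.
move=> HA H'A; apply/latticeP; exists [fset H; H'].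
  by apply/fsubsetP => G; rewrite in_fset2 => /orP[]/eqP->.
apply/eqP; rewrite eqEsubv; apply/andP; split.
  by apply/sub_acenterP => G; rewrite in_fset2 => /orP[]/eqP->; rewrite ?capvSl ?capvSr.
by rewrite subv_cap !acenter_sub // in_fset2 eqxx ?orbT.
Qed.

Lemma flat2I H H' : H \in A -> H' \in A -> H != H' -> (H :&: H')%VS \in flats A 2.
Proof. by move=> HA H'A neq; rewrite in_flats lattice_cap //= codim_cap2. Qed.

Lemma flat2_eq X H H' : X \in flats A 2 -> H \in localization A X ->
  H' \in localization A X -> H != H' -> X = (H :&: H')%VS.
Proof.
rewrite in_flats !in_loc => /andP[_ /eqP cX] /andP[HA XH] /andP[H'A XH'] neq.
by apply: codim_eq; rewrite ?subv_cap ?XH // cX codim_cap2.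
Qed.

Lemma flat2P X : X \in flats A 2 -> exists H H',
  [/\ H \in localization A X, H' \in localization A X, H != H' & X = (H :&: H')%VS].
Proof.
move=> Xf; suff: exists H H',
    [/\ H \in localization A X, H' \in localization A X & H != H'].
  by case=> H [H' [HX H'X neq]]; exists H, H'; split=> //; apply: flat2_eq.
move: (Xf); rewrite in_flats => /andP[/latticeP[B /fsubsetP BA XE] /eqP cX].
have BX H : H \in B -> H \in localization A X.
  by move=> HB; rewrite in_loc BA //= XE acenter_sub.
have [B0|[H HB]] := fset_0Vmem B.
  have: (fullv <= X)%VS by rewrite XE; apply/sub_acenterP => H; rewrite B0 inE.
  by move/codimS; rewrite cX codim_full.
case: (classic (exists2 H', H' \in B & H' <> H)) => [[H' H'B /eqP neq]|nH'].
  by exists H', H; split=> //; apply: BX.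
have: (H <= X)%VS.
  rewrite XE; apply/sub_acenterP => H' H'B; suff -> : H' = H by [].
  by apply: NNPP => neq; apply: nH'; exists H'.
by move/codimS; rewrite cX codim_hyp ?BA.
Qed.

Lemma form_comb_apply (f : linform V) (k l : K) u v w :
  f (u - k *: v - l *: w) = f u - k * f v - l * f w :> K.
Proof.
by rewrite !raddfD /= !raddfN /= !linearZ.
Qed.

Lemma dual_forms H H' : H \in A -> H' \in A -> H != H' ->
  exists v, form_of H v = 1 /\ form_of H' v = 0.
Proof.
move=> HA H'A neq.
have [v vH' vH]: exists2 v, v \in H' & v \notin H.
  apply: NNPP => nv; case/eqP: neq; apply/esym/hyp_sub_eq => //.
  by apply/subvP => v vH'; apply/negPn/negP => vH; apply: nv; exists v.
move: vH' vH; rewrite !mem_hyp // => /eqP vH' vH.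
exists ((form_of H v)^-1 *: v).
by rewrite !linearZ /= vH' scaler0 /GRing.scale /= mulVf.
Qed.

Lemma form_comb H H' G : H \in A -> H' \in A -> G \in A -> H != H' ->
    (H :&: H' <= G)%VS ->
  exists p : K * K, [/\ forall v, form_of G v = p.1 * form_of H v + p.2 * form_of H' v,
    form_of G = p.1 *: form_of H + p.2 *: form_of H',
    G != H' -> p.1 != 0 & G != H -> p.2 != 0].
Proof.
move=> HA H'A GA neq sub.
have [v [vH vH']] := dual_forms HA H'A neq.
have [w [wH' wH]]: exists v, form_of H' v = 1 /\ form_of H v = 0.
  by apply: dual_forms; rewrite // eq_sym.
pose p := (form_of G v, form_of G w).
have E u : form_of G u = p.1 * form_of H u + p.2 * form_of H' u.
  have /eqP: form_of G (u - form_of H u *: v - form_of H' u *: w) == 0.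
    rewrite -mem_hyp //; apply: (subvP sub); rewrite memv_cap !mem_hyp //.
    rewrite !form_comb_apply vH wH wH' vH'.
    by rewrite !mulr0 !mulr1 !subr0 !subrr eqxx.
  rewrite form_comb_apply => /eqP.
  by rewrite subr_eq add0r subr_eq => /eqP->; rewrite addrC mulrC [X in _ + X]mulrC.
have EE : form_of G = p.1 *: form_of H + p.2 *: form_of H'.
  by apply/lfunP => u; rewrite add_lfunE !scale_lfunE E.
exists p; split=> //.
  apply: contra_neq => p0; apply/esym/hyp_sub_eq => //.
  by apply/subvP => u; rewrite !mem_hyp // E p0 mul0r add0r => /eqP->; rewrite mulr0.
apply: contra_neq => p0; apply/esym/hyp_sub_eq => //.
by apply/subvP => u; rewrite !mem_hyp // E p0 mul0r addr0 => /eqP->; rewrite mulr0.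
Qed.
End Arr.
End Hyperplanes.

(** * Linear forms in the symmetric algebra *)

Section LinearForms.
Variables (K : fieldType) (V : vectType K).
Local Notation n := (\dim (fullv : {vspace V})).
Local Notation S := {mpoly K[n]}.
Local Notation e := (vbasis (fullv : {vspace V})).
Implicit Types (a b c : linform V) (x y : V) (p q f g : S).

Definition lf a : S := sym_of_linform a.

Lemma linformE a x : a x = \sum_i coord e i x * (a (tnth e i) : K) :> K.
Proof.
rewrite {1}(coord_vbasis (memvf x)) linear_sum; apply: eq_bigr => i _.
by rewrite linearZ -tnth_nth.
Qed.

Lemma lfD a b : lf (a + b) = lf a + lf b.
Proof.
by rewrite /lf /sym_of_linform -big_split; apply: eq_bigr => i _; rewrite add_lfunE scalerDl.
Qed.

Lemma lfZ k a : lf (k *: a) = k *: lf a.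
Proof.
rewrite /lf /sym_of_linform scaler_sumr; apply: eq_bigr => i _.
by rewrite scale_lfunE scalerA.
Qed.

Lemma lfN a : lf (- a) = - lf a.
Proof. by rewrite -scaleN1r lfZ scaleN1r. Qed.

Lemma lfB a b : lf (a - b) = lf a - lf b.
Proof. by rewrite lfD lfN. Qed.

Lemma lf0 : lf 0 = 0.
Proof. by rewrite -(scale0r 0) lfZ scale0r. Qed.

Lemma mcoeff_lf a i : (lf a)@_U_(i) = a (tnth e i).
Proof.
rewrite /lf /sym_of_linform raddf_sum (bigD1 i) //= big1 ?addr0.
  by rewrite mcoeffZ mcoeffX eqxx mulr1.
by move=> j ji; rewrite mcoeffZ mcoeffX eq_mnm1 (negPf ji) mulr0.
Qed.

Lemma lf_eq0 a : (lf a == 0) = (a == 0).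
Proof.
apply/eqP/eqP => [a0|->]; last exact: lf0.
apply/lfunP => x; rewrite linformE zero_lfunE big1 // => i _.
by rewrite -mcoeff_lf a0 mcoeff0 mulr0.
Qed.

Lemma lf_homog a : lf a \is 1.-homog.
Proof.
by rewrite /lf /sym_of_linform; apply: rpred_sum => i _; apply: rpredZ; rewrite dhomogX /= mdeg1.
Qed.

(** The substitution translating the generic point along x and y.  When x and y
    are dual to a and b it is the projection onto the common kernel of a and b,
    and identifies the quotient of S by (a, b) with a subring of S. *)
Definition project a b x y : n.-tuple S :=
  [tuple 'X_i - coord e i x *: lf a - coord e i y *: lf b | i < n].

Lemma project_lf a b x y c :
  lf c \mPo project a b x y = lf c - c x *: lf a - c y *: lf b.
Proof.
rewrite {1 2}/lf /sym_of_linform raddf_sum /= [c x]linformE [c y]linformE.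
rewrite !scaler_suml -!sumrB; apply: eq_bigr => i _.
rewrite comp_mpolyZ comp_mpolyXU -tnth_nth tnth_mktuple !scalerBr !scalerA.
by rewrite ![_ * coord _ _ _]mulrC.
Qed.

(** The elements congruent to their image modulo (a, b) are closed under sums
    and products and contain the variables. *)
Lemma project_mod a b x y f :
  exists q r, f = (f \mPo project a b x y) + q * lf a + r * lf b.
Proof.
pose P g := exists q r, g = (g \mPo project a b x y) + q * lf a + r * lf b.
have PD g h : P g -> P h -> P (g + h).
  move=> [q [r gE]] [q' [r' hE]]; exists (q + q'), (r + r').
  by rewrite {1}gE {1}hE rmorphD /=; ring.
have PM g h : P g -> P h -> P (g * h).
  move=> [q [r gE]] [q' [r' hE]].
  set g' := _ \mPo _ in gE; set h' := _ \mPo _ in hE.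
  exists (g' * q' + q * h), (g' * r' + r * h).
  by rewrite rmorphM /= -/g' -/h' {1}gE {1}hE [in RHS]hE; ring.
have PC k : P k%:MP by exists 0, 0; rewrite comp_mpolyC; ring.
have PX i : P 'X_i.
  exists (coord e i x)%:MP, (coord e i y)%:MP.
  rewrite comp_mpolyXU -tnth_nth tnth_mktuple !mul_mpolyC; ring.
elim/mpolyind: f => [|k m g _ _ Pg]; first by rewrite -mpolyC0; apply: PC.
apply: PD Pg; rewrite -mul_mpolyC; apply: (PM _ _ (PC _)).
rewrite mpolyXE_id; elim/big_ind: _ => [|p q|i _]; first by rewrite -mpolyC1; apply: PC.
  exact: PM.
by elim: (m i) => [|j IH]; rewrite ?expr0 ?exprS -?mpolyC1; [apply: PC|apply: PM].
Qed.

Lemma lf_at0 a : mcoeff 0 (lf a) = 0.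
Proof.
rewrite /lf /sym_of_linform raddf_sum big1 // => i _.
by rewrite /= mcoeffZ mcoeffX mnm1_eq0 mulr0.
Qed.

(** The case b = 0 of the projection: the ideal (a) is the kernel of a ring
    morphism into a domain, so that a nonzero linear form is prime. *)
Lemma lf_reduction a : a != 0 -> exists x (tau : {rmorphism S -> S}),
  [/\ a x = 1, forall f, tau f = 0 <-> exists q, f = q * lf a
    & forall b, tau (lf b) = lf b - b x *: lf a].
Proof.
move=> a0; have [x ax] := exists_dual a0.
exists x, (comp_mpoly (project a 0 x 0)); split=> // [f|b]; last first.
  by rewrite /= project_lf lf0 scaler0 subr0.
have tau_a : lf a \mPo project a 0 x 0 = 0.
  by rewrite project_lf lf0 scaler0 subr0 ax scale1r subrr.
split=> /= [f0|[q ->]]; last by rewrite rmorphM /= tau_a mulr0.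
have [q [r]] := project_mod a 0 x 0 f; rewrite f0 lf0 mulr0 addr0 add0r.
by exists q.
Qed.

Lemma lf_dvd_lf a b : a != 0 -> (exists q, lf b = q * lf a) ->
  exists k : K, b = k *: a.
Proof.
move=> a0; have [x [tau [ax tauP taulf]]] := lf_reduction a0.
move/tauP; rewrite taulf -lfZ -lfB => /eqP; rewrite lf_eq0 subr_eq0 => /eqP ->.
by exists (b x); rewrite {1}/GRing.scale /=.
Qed.

Lemma lf_pow_cancel a k f g : a != 0 -> ~ (exists q, f = q * lf a) ->
  (exists q, f * g = q * lf a ^+ k) -> exists q, g = q * lf a ^+ k.
Proof.
move=> a0; have [x [tau [ax tauP _]]] := lf_reduction a0 => /tauP fa.
elim: k g => [|k IH] g [q]; first by exists g; rewrite expr0 mulr1.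
rewrite exprS mulrCA => E.
have: tau (f * g) = 0 by apply/tauP; exists (q * lf a ^+ k); rewrite E; ring.
move=> /eqP; rewrite rmorphM mulf_eq0 => /orP[/eqP//|/eqP /tauP[h hE]].
have [|q' q'E] := IH h.
  exists q; apply: (@mulfI _ (lf a)); first by rewrite lf_eq0.
  by rewrite -E hE; ring.
by exists q'; rewrite hE q'E; ring.
Qed.

Lemma lf_pow_coprime a b k l g : a != 0 -> ~ (exists q, lf b = q * lf a) ->
  (exists q, lf b ^+ l * g = q * lf a ^+ k) -> exists q, g = q * lf a ^+ k.
Proof.
move=> a0 ab; elim: l g => [|l IH] g; first by rewrite expr0 mul1r.
by rewrite exprS -mulrA => /(lf_pow_cancel a0 ab) /IH.
Qed.

Lemma lf_prod_dvd (I : eqType) (s : seq I) (a : I -> linform V) (k : I -> nat) f :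
    uniq s -> (forall i, i \in s -> a i != 0) ->
    (forall i j, i \in s -> j \in s -> i != j -> ~ exists q, lf (a j) = q * lf (a i)) ->
    (forall i, i \in s -> exists q, f = q * lf (a i) ^+ k i) ->
  exists q, f = q * \prod_(i <- s) lf (a i) ^+ k i.
Proof.
elim: s f => [|i s IH] f /=; first by exists f; rewrite big_nil mulr1.
case/andP=> nis us a0 indep dvd.
have [q fE] := dvd i (mem_head _ _).
have sub j : j \in s -> j \in i :: s by move=> js; rewrite inE js orbT.
have [//|j js|j l js ls|j js|q' qE] := IH q; try by [apply: a0; apply: sub
  | apply: indep; apply: sub].
  apply: (@lf_pow_coprime (a j) (a i) (k j) (k i)); first exact/a0/sub.
    apply: indep; rewrite ?mem_head ?sub //.
    by apply: contraNneq nis => <-.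
  by have [r rE] := dvd j (sub _ js); exists r; rewrite mulrC -fE.
by exists q'; rewrite big_cons fE {1}qE; ring.
Qed.
End LinearForms.

(** * Vector fields and logarithmic derivations *)

Section VectorFields.
Variables (K : fieldType) (V : vectType K).
Local Notation n := (\dim (fullv : {vspace V})).
Local Notation S := {mpoly K[n]}.
Local Notation e := (vbasis (fullv : {vspace V})).
Implicit Types (a b c : linform V) (x y : V) (p q f g : S) (v w : 'rV[S]_n).

(** The value on the linear form a of the derivation with coefficients v. *)
Definition ev a v : S := \sum_i (a (tnth e i) : K) *: v 0 i.

(** The derivation along the constant vector x. *)
Definition cst x : 'rV[S]_n := \row_i (coord e i x)%:MP.

Definition der v : S -> S := fun f => \sum_i v 0 i * f^`M(i).

Lemma free_vbasis (U : {vspace V}) : free (vbasis U).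
Proof. exact/basis_free/vbasisP. Qed.

Lemma evD a v w : ev a (v + w) = ev a v + ev a w.
Proof. by rewrite /ev -big_split; apply: eq_bigr => i _; rewrite mxE scalerDr. Qed.

Lemma evZ a p v : ev a (p *: v) = p * ev a v.
Proof. by rewrite /ev mulr_sumr; apply: eq_bigr => i _; rewrite mxE scalerAr. Qed.

Lemma evN a v : ev a (- v) = - ev a v.
Proof. by rewrite -scaleN1r evZ mulN1r. Qed.

Lemma evB a v w : ev a (v - w) = ev a v - ev a w.
Proof. by rewrite evD evN. Qed.

Lemma ev0 a : ev a 0 = 0.
Proof. by rewrite -(scale0r 0) evZ mul0r. Qed.

Lemma ev_sum a k (p : 'I_k -> S) (v : 'I_k -> 'rV[S]_n) :
  ev a (\sum_j p j *: v j) = \sum_j p j * ev a (v j).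
Proof. by elim/big_rec2: _ => [|j w q _ <-]; rewrite ?ev0 // evD evZ. Qed.

Lemma ev_cst a x : ev a (cst x) = (a x)%:MP.
Proof.
rewrite linformE raddf_sum; apply: eq_bigr => i _ /=.
by rewrite mxE -mul_mpolyC -mpolyCM mulrC.
Qed.

Lemma ev_comb (k l : K) a b v : ev (k *: a + l *: b) v = k *: ev a v + l *: ev b v.
Proof.
rewrite /ev !scaler_sumr -big_split; apply: eq_bigr => i _ /=.
by rewrite add_lfunE !scale_lfunE scalerDl !scalerA.
Qed.

Lemma ev_scale (k : K) a v : ev (k *: a) v = k *: ev a v.
Proof. by have := ev_comb k 0 a 0 v; rewrite !scale0r !addr0. Qed.

Lemma ev_span (I : finType) (f : I -> linform V) (t : I -> K) (g : linform V) v :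
    (forall x, g x = \sum_i t i * f i x) ->
  ev g v = \sum_i t i *: ev (f i) v.
Proof.
move=> gE; rewrite /ev; under [RHS]eq_bigr do rewrite scaler_sumr.
rewrite exchange_big; apply: eq_bigr => j _ /=.
by rewrite gE scaler_suml; apply: eq_bigr => i _; rewrite scalerA.
Qed.

Lemma submm (m : 'X_{1..n}) : (m - m = 0)%MM.
Proof. by apply/mnmP => j; rewrite mnmBE subnn mnm0E. Qed.

Lemma der_lf v a : der v (lf a) = ev a v.
Proof.
apply: eq_bigr => i _; rewrite /lf /sym_of_linform raddf_sum (bigD1 i) //= big1.
  rewrite addr0 mderivZ mderivX mnm1E eqxx scale1r submm mpolyX0.
  by rewrite -scalerAr mulr1.
by move=> j ji; rewrite mderivZ mderivX mnm1E (negPf ji) scale0r scaler0.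
Qed.

Lemma derX v i : der v 'X_i = v 0 i.
Proof.
rewrite /der (bigD1 i) //= big1 ?addr0.
  by rewrite mderivX mnm1E eqxx scale1r submm mpolyX0 mulr1.
by move=> j ji; rewrite mderivX mnm1E eq_sym (negPf ji) scale0r mulr0.
Qed.

Lemma derivation_der v : derivation (der v).
Proof.
split=> [f g|c f|f g]; rewrite /der.
- by rewrite -big_split; apply: eq_bigr => i _; rewrite mderivD mulrDr.
- by rewrite scaler_sumr; apply: eq_bigr => i _; rewrite mderivZ scalerAr.
rewrite mulr_sumr mulr_suml -big_split; apply: eq_bigr => i _ /=.
by rewrite mderivM; ring.
Qed.

(** A derivation is determined by its values on the variables, by Leibniz on
    monomials. *)
Lemma derivationE (theta : S -> S) : derivation theta ->
  forall f, theta f = der (\row_i theta 'X_i) f.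
Proof.
move=> [thD thZ thM]; set v := \row_i _.
have [dD dZ dM] := derivation_der v.
have th1 : theta 1 = 0.
  have := thM 1 1; rewrite !mulr1 !mul1r => /eqP.
  by rewrite -subr_eq0 opprD addNKr oppr_eq0 => /eqP.
have th0 : theta 0 = 0 by have := thZ 0 0; rewrite !scale0r.
have d1 : der v 1 = 0.
  by rewrite /der big1 // => i _; rewrite -mpolyC1 mderivC mulr0.
have d0 : der v 0 = 0 by have := dZ 0 0; rewrite !scale0r.
elim/mpolyind => [|k m g _ _ IH]; first by rewrite th0 d0.
rewrite thD dD IH thZ dZ; congr (_ *: _ + _).
rewrite mpolyXE_id; elim/big_ind: _ => [|p q pE qE|i _]; first by rewrite th1 d1.
  by rewrite thM dM pE qE.
elim: (m i) => [|j IHj]; first by rewrite expr0 th1 d1.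
by rewrite exprS thM dM IHj derX mxE.
Qed.

Lemma der_sum k (p : 'I_k -> S) (v : 'I_k -> 'rV[S]_n) f :
  \sum_j p j * der (v j) f = der (\sum_j p j *: v j) f.
Proof.
rewrite /der; under eq_bigr do rewrite mulr_sumr.
rewrite exchange_big; apply: eq_bigr => i _ /=.
by rewrite summxE mulr_suml; apply: eq_bigr => j _; rewrite mxE mulrA.
Qed.

Lemma der_eq0 v : (forall f, der v f = 0) -> v = 0.
Proof. by move=> v0; apply/rowP => i; rewrite mxE -derX v0. Qed.

Definition log_field (A : {fset {vspace V}}) (m : {vspace V} -> nat) v : Prop :=
  forall H, H \in A ->
    exists q, ev (form_of H) v = q * lf (form_of H) ^+ m H.

Lemma log_fieldS (A B : {fset {vspace V}}) m v : B `<=` A -> log_field A m v -> log_field B m v.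
Proof. by move=> /fsubsetP BA vA H /BA; apply: vA. Qed.

Lemma log_fieldD A m v w : log_field A m v -> log_field A m w -> log_field A m (v + w).
Proof.
move=> vA wA H HA; have [q qE] := vA H HA; have [r rE] := wA H HA.
by exists (q + r); rewrite evD qE rE mulrDl.
Qed.

Lemma log_fieldZ A m p v : log_field A m v -> log_field A m (p *: v).
Proof.
by move=> vA H HA; have [q qE] := vA H HA; exists (p * q); rewrite evZ qE mulrA.
Qed.

Lemma log_field0 A m : log_field A m 0.
Proof. by move=> H _; exists 0; rewrite ev0 mul0r. Qed.

Lemma log_field_sum A m k (p : 'I_k -> S) (v : 'I_k -> 'rV[S]_n) :
  (forall j, log_field A m (v j)) -> log_field A m (\sum_j p j *: v j).
Proof.
move=> vA; elim/big_ind: _ => [|w w'|j _]; [exact: log_field0|exact: log_fieldD|].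
exact: log_fieldZ.
Qed.

(** Two forms with kernel H differ by a nonzero scalar, so the condition may be
    tested on the chosen one. *)
Lemma logder_der A m v : arrangement A -> logder A m (der v) <-> log_field A m v.
Proof.
move=> Aarr; split=> [[_ vA] H HA|vA].
  by have [q] := vA H (form_of H) HA (form_ofK Aarr HA); rewrite der_lf; exists q.
split=> [|H a HA aH]; first exact: derivation_der.
have [k kE] : exists k : K, a = k *: form_of H.
  by apply: lker_scale; rewrite aH (form_ofK Aarr HA) subvv.
have a0 : a != 0.
  apply: contra_eq_neq (codim_hyp Aarr HA) => a0; rewrite -aH a0.
  suff -> : lker (0 : linform V) = fullv by rewrite codim_full.
  apply/eqP; rewrite eqEsubv subvf; apply/subvP => x _.
  by rewrite memv_ker zero_lfunE.
have k0 : k != 0 by apply: contraNneq a0 => k0; rewrite kE k0 scale0r.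
have [q qE] := vA H HA; exists ((k / k ^+ m H) *: q).
rewrite -/(lf a) der_lf kE ev_scale qE lfZ exprZn -scalerAl -scalerAr scalerA.
by rewrite divfK ?expf_neq0 // -scalerAl.
Qed.

Lemma logder_exists_field A m theta : arrangement A -> logder A m theta ->
  exists2 v, log_field A m v & forall f, theta f = der v f.
Proof.
move=> Aarr thA; have [thd _] := thA; have thE := derivationE thd.
exists (\row_i theta 'X_i) => //.
apply/logder_der => //; split=> [|H a HA aH]; first exact: derivation_der.
by have [_ /(_ H a HA aH)] := thA; rewrite thE.
Qed.

Definition log_basis A m k (Theta : 'I_k -> 'rV[S]_n) : Prop :=
  [/\ forall j, log_field A m (Theta j),
      forall v, log_field A m v -> exists p : 'I_k -> S, v = \sum_j p j *: Theta j
    & forall p : 'I_k -> S, \sum_j p j *: Theta j = 0 -> forall j, p j = 0].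

Lemma log_basis_module A m k (Theta : 'I_k -> 'rV[S]_n) : arrangement A ->
  log_basis A m Theta -> module_basis (logder A m) (fun j => der (Theta j)).
Proof.
move=> Aarr [ThA gen ind]; split=> [j|eta /(logder_exists_field Aarr)[v vA etaE]|p p0 j].
- exact/logder_der.
- have [p vE] := gen v vA; exists p => f; by rewrite etaE vE der_sum.
by apply: ind; apply: der_eq0 => f; rewrite -der_sum p0.
Qed.

Lemma module_log_basis A m k (theta : 'I_k -> S -> S) : arrangement A ->
  module_basis (logder A m) theta ->
  exists2 Theta : 'I_k -> 'rV[S]_n,
    log_basis A m Theta & forall j f, theta j f = der (Theta j) f.
Proof.
move=> Aarr [thA gen ind].
pose Theta j := \row_i theta j 'X_i.
have thE j f : theta j f = der (Theta j) f.
  by apply: derivationE; have [] := thA j.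
exists Theta => //; split=> [j|v vA|p p0].
- have [w wA wE] := logder_exists_field Aarr (thA j).
  suff -> : Theta j = w by [].
  by apply/rowP => i; rewrite mxE wE derX.
- have [|p pE] := gen (der v); first exact/logder_der.
  exists p; apply/eqP; rewrite -subr_eq0; apply/eqP/der_eq0 => f.
  have [dD dZ dM] := derivation_der (v - \sum_j p j *: Theta j).
  have -> : der (v - \sum_j p j *: Theta j) f = der v f - der (\sum_j p j *: Theta j) f.
    by rewrite /der -sumrB; apply: eq_bigr => i _; rewrite !mxE mulrBl.
  rewrite pE -der_sum -sumrB big1 // => j _.
  by rewrite thE subrr.
apply: ind => f; under eq_bigr do rewrite thE.
by rewrite der_sum p0 /der big1 // => i _; rewrite mxE mul0r.
Qed.

(** A basis of the vector fields modulo those tangent to the centre.  Unlike a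
    basis of the whole module, it restricts well when the arrangement grows: the
    quotient by a direct summand of a free module need not be visibly free. *)
Definition basis_mod_center A m k (Theta : 'I_k -> 'rV[S]_n) : Prop :=
  [/\ forall j, log_field A m (Theta j),
      forall v, log_field A m v -> exists p : 'I_k -> S, forall H, H \in A ->
        ev (form_of H) v = \sum_j p j * ev (form_of H) (Theta j)
    & forall p : 'I_k -> S,
        (forall H, H \in A -> \sum_j p j * ev (form_of H) (Theta j) = 0) ->
        forall j, p j = 0].

(** The elements modulo the centre come first, then a basis of the centre. *)
Definition complete_basis A k (Theta : 'I_k -> 'rV[S]_n)
    (i : 'I_(k + \dim (acenter A))) : 'rV[S]_n :=
  match split i with
  | inl j => Theta j
  | inr l => cst (tnth (vbasis (acenter A)) l)
  end.

Lemma complete_basis_sum A k (Theta : 'I_k -> 'rV[S]_n)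
    (p : 'I_(k + \dim (acenter A)) -> S) :
  \sum_i p i *: @complete_basis A k Theta i =
  \sum_j p (lshift _ j) *: Theta j +
  \sum_l p (rshift _ l) *: cst (tnth (vbasis (acenter A)) l).
Proof.
rewrite big_split_ord /complete_basis; congr (_ + _); apply: eq_bigr => i _.
  by rewrite (unsplitK (inl i)).
by rewrite (unsplitK (inr i)).
Qed.

(** A field killed by all forms of A is a combination of constant fields along
    the centre, since the coordinates of the complementary projection are
    combinations of those forms. *)
Lemma basis_mod_center_complete A m k (Theta : 'I_k -> 'rV[S]_n) : arrangement A ->
  basis_mod_center A m Theta -> log_basis A m (@complete_basis A k Theta).
Proof.
move=> Aarr [ThA gen ind].
set T := acenter A; pose t l := tnth (vbasis T) l.
have tT l : t l \in T by apply: vbasis_mem; apply: mem_tnth.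
have tA l H : H \in A -> ev (form_of H) (cst (t l)) = 0.
  move=> HA; rewrite ev_cst; have /mem_acenterP/(_ H HA) := tT l.
  by rewrite (mem_hyp Aarr) // => /eqP->; rewrite mpolyC0.
split=> [i|v vA|p].
- rewrite /complete_basis; case: split => [j|l]; first exact: ThA.
  by move=> H HA; exists 0; rewrite tA // mul0r.
- have [p pE] := gen v vA.
  pose u := v - \sum_j p j *: Theta j.
  have u0 H : H \in A -> ev (form_of H) u = 0.
    by move=> HA; rewrite evB ev_sum pE // subrr.
  pose r l := \sum_j coord (vbasis T) l (projv T (tnth e j)) *: u 0 j.
  have uE : u = \sum_l r l *: cst (t l).
    apply/rowP => i.
    pose g : linform V := (linfun (coord e i : V -> K^o) \o (\1 - projv T))%VF.
    have gE x : g x = coord e i (x - projv T x).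
      by rewrite comp_lfunE lfunE /= add_lfunE opp_lfunE id_lfunE.
    have [|s sE] := @lker_bigcap_span K V A (fun H => form_of (val H)) g.
      move=> x xA; rewrite gE projv_id ?subrr ?linear0 //.
      apply/mem_acenterP => H HA; rewrite (mem_hyp Aarr) //.
      by apply/eqP; exact: (xA [` HA]).
    have : ev g u = 0.
      by rewrite (ev_span _ sE) big1 // => H _; rewrite u0 ?scaler0 // (valP H).
    rewrite /ev; under eq_bigr do rewrite gE linearB /= scalerBl.
    rewrite sumrB => /eqP; rewrite subr_eq0 => /eqP.
    rewrite (bigD1 i) //= (tnth_nth 0) coord_free ?free_vbasis //.
    rewrite eqxx scale1r big1 ?addr0 => [->|j ji]; last first.
      rewrite (tnth_nth 0) coord_free ?free_vbasis //.
      by rewrite (negPf ji) scale0r.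
    rewrite summxE; under [RHS]eq_bigr do rewrite mxE mulr_suml mxE.
    rewrite exchange_big; apply: eq_bigr => j _ /=.
    rewrite {1}(coord_vbasis (memv_proj T (tnth e j))) linear_sum scaler_suml.
    apply: eq_bigr => l _; rewrite linearZ /= -/T /t (tnth_nth 0).
    by rewrite [RHS]mulrC mul_mpolyC scalerA (tnth_nth 0) mulrC.
  exists (fun i => match split i with inl j => p j | inr l => r l end).
  rewrite complete_basis_sum.
  under eq_bigr => j _ do rewrite (unsplitK (inl j)).
  under [X in _ + X]eq_bigr => l _ do rewrite (unsplitK (inr l)).
  by rewrite -uE addrC subrK.
rewrite complete_basis_sum => s0.
have p0 j : p (lshift _ j) = 0.
  apply: (ind (fun j => p (lshift _ j))) => H HA.
  have := congr1 (ev (form_of H)) s0; rewrite ev0 evD !ev_sum.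
  by rewrite [X in _ + X]big1 ?addr0 // => l _; rewrite tA ?mulr0.
move: s0; rewrite big1 ?add0r => [s0|j _]; last by rewrite p0 scale0r.
have r0 l : p (rshift _ l) = 0.
  pose g : linform V := (linfun (coord (vbasis T) l : V -> K^o) \o projv T)%VF.
  have gE x : g x = coord (vbasis T) l (projv T x) by rewrite comp_lfunE lfunE.
  have := congr1 (ev g) s0; rewrite ev0 ev_sum (bigD1 l) //= big1.
    rewrite addr0 ev_cst gE projv_id // (tnth_nth 0) coord_free ?eqxx ?mulr1 //.
    exact: free_vbasis.
  move=> l' ll; rewrite ev_cst gE projv_id // (tnth_nth 0) coord_free.
    by rewrite eq_sym eq_sym (negPf ll) mpolyC0 mulr0.
  exact: free_vbasis.
by move=> i; rewrite -[i]splitK; case: (split i) => ? /=.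
Qed.
End VectorFields.

(** * Local solvability implies global solvability when D(A, m) is free *)

Section Lifting.
Variables (K : fieldType) (V : vectType K).
Local Notation n := (\dim (fullv : {vspace V})).
Local Notation S := {mpoly K[n]}.
Variables (A : {fset {vspace V}}) (m : {vspace V} -> nat).
Hypothesis A_arr : arrangement A.
Implicit Types (H X Y : {vspace V}) (s : {vspace V} -> S).

Local Notation l H := (lf (form_of H)).

(** The class of s in the sum of the S/(alpha_H^(m H)) comes from a derivation. *)
Definition solvable s : Prop := exists v, forall H, H \in A ->
  exists q, ev (form_of H) v - s H = q * l H ^+ m H.

Lemma solvable_ext s s' : (forall H, H \in A -> s H = s' H) ->
  solvable s -> solvable s'.
Proof. by move=> ss [v vs]; exists v => H HA; rewrite -ss //; apply: vs. Qed.

Lemma solvable_scale f s : solvable s -> solvable (fun H => f * s H).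
Proof.
move=> [v vs]; exists (f *: v) => H HA; have [q qE] := vs H HA.
by exists (f * q); rewrite evZ -mulrBr qE mulrA.
Qed.

Lemma form_indep H H' : H \in A -> H' \in A -> H != H' ->
  ~ exists q, l H' = q * l H.
Proof.
move=> HA H'A neq /(lf_dvd_lf (form_of_neq0 A_arr HA))[k kE].
case/eqP: neq; apply: (hyp_sub_eq A_arr) => //.
apply/subvP => x; rewrite !(mem_hyp A_arr) // kE scale_lfunE => /eqP->.
by rewrite scaler0.
Qed.

(** Exactness of the Koszul complex of three independent forms in the only
    place where it is used: modulo the first two forms the third one is not a
    zero divisor, because the quotient is a domain in which it is nonzero. *)
Lemma regular_forms H1 H2 H3 (w f g : S) :
    H1 \in A -> H2 \in A -> H3 \in A -> H1 != H2 -> ~~ (H1 :&: H2 <= H3)%VS ->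
    l H3 * w + l H1 * f + l H2 * g = 0 ->
  exists q r, w = l H2 * q - l H1 * r.
Proof.
move=> H1A H2A H3A neq nsub wE.
have [x [x1 x2]] := dual_forms A_arr H1A H2A neq.
have [|y [y2 y1]] := dual_forms A_arr H2A H1A; first by rewrite eq_sym.
pose pr := project (form_of H1) (form_of H2) x y.
have pr1 : l H1 \mPo pr = 0.
  by rewrite project_lf x1 y1 scale1r scale0r subr0 subrr.
have pr2 : l H2 \mPo pr = 0.
  by rewrite project_lf x2 y2 scale1r scale0r subr0 subrr.
have pr3 : l H3 \mPo pr != 0.
  rewrite project_lf.
  have -> : l H3 - form_of H3 x *: l H1 - form_of H3 y *: l H2 =
      lf (form_of H3 - form_of H3 x *: form_of H1 - form_of H3 y *: form_of H2).
    by rewrite !lfB !lfZ.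
  rewrite lf_eq0; apply: contra nsub => /eqP E.
  apply/subvP => z; rewrite memv_cap !(mem_hyp A_arr) // => /andP[/eqP z1 /eqP z2].
  have /lfunP/(_ z) := E.
  rewrite !add_lfunE !opp_lfunE !scale_lfunE z1 z2 !scaler0 !subr0 zero_lfunE.
  by move->.
have := congr1 (comp_mpoly pr) wE.
rewrite !rmorphD !rmorphM /= pr1 pr2 !mul0r !addr0 rmorph0 => /eqP.
rewrite mulf_eq0 (negPf pr3) /= => /eqP pw.
have [q [r]] := project_mod (form_of H1) (form_of H2) x y w.
by rewrite -/pr pw add0r => ->; exists r, (- q); ring.
Qed.

Lemma rank_gt0_hyp : (0 < rank A)%N -> exists H, H \in A.
Proof.
have [->|[H HA] _] := fset_0Vmem A; last by exists H.
suff -> : rank (fset0 : {fset {vspace V}}) = 0%N by [].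
rewrite /rank -(codim_full V); congr codim; apply/eqP; rewrite eqEsubv subvf.
by apply/sub_acenterP => H; rewrite inE.
Qed.

Lemma rank_gt1_hyp H : (1 < rank A)%N -> H \in A -> exists2 H', H' \in A & H' != H.
Proof.
move=> rA HA; apply: NNPP => no; have: (H <= acenter A)%VS.
  apply/sub_acenterP => G GA; suff -> : G = H by [].
  by apply: NNPP => /eqP GH; apply: no; exists G.
by move/codimS; rewrite (codim_hyp A_arr HA) leqNgt rA.
Qed.

Section Basis.
Variables (k : nat) (Theta : 'I_k -> 'rV[S]_n).
Hypothesis Th_basis : log_basis A m Theta.

(** This is where freeness enters: solutions u_i of the three multiplied
    problems yield the elements l_j u_i - l_i u_j of D(A, m), and their coordinates
    in the basis form a Koszul cycle.  Writing one of them as a boundary corrects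
    u_1 and u_2 by elements of D(A, m) so that both become multiples of the same
    field eta, which is the solution: at each hyperplane one of the two forms can
    be cancelled. *)
Lemma solvable_regular H1 H2 H3 s :
    H1 \in A -> H2 \in A -> H3 \in A -> H1 != H2 -> ~~ (H1 :&: H2 <= H3)%VS ->
    solvable (fun H => l H1 * s H) -> solvable (fun H => l H2 * s H) ->
    solvable (fun H => l H3 * s H) ->
  solvable s.
Proof.
move=> H1A H2A H3A neq nsub [u1 u1P] [u2 u2P] [u3 u3P].
have [_ gen ind] := Th_basis.
have crossed (G G' : {vspace V}) u u' :
    (forall H, H \in A -> exists q, ev (form_of H) u - l G * s H = q * l H ^+ m H) ->
    (forall H, H \in A -> exists q, ev (form_of H) u' - l G' * s H = q * l H ^+ m H) ->
    exists w : 'I_k -> S, l G' *: u - l G *: u' = \sum_j w j *: Theta j.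
  move=> uP u'P; apply: gen => H HA.
  have [q qE] := uP H HA; have [q' q'E] := u'P H HA.
  exists (l G' * q - l G * q'); rewrite evB !evZ.
  have -> : ev (form_of H) u = q * l H ^+ m H + l G * s H by rewrite -qE subrK.
  have -> : ev (form_of H) u' = q' * l H ^+ m H + l G' * s H by rewrite -q'E subrK.
  by ring.
have [w12 E12] := crossed _ _ _ _ u1P u2P.
have [w23 E23] := crossed _ _ _ _ u2P u3P.
have [w31 E31] := crossed _ _ _ _ u3P u1P.
have cyc j : l H3 * w12 j + l H1 * w23 j + l H2 * w31 j = 0.
  move: j; apply: ind.
  transitivity (l H3 *: (\sum_j w12 j *: Theta j) + l H1 *: (\sum_j w23 j *: Theta j) +
                l H2 *: (\sum_j w31 j *: Theta j)).
    rewrite !scaler_sumr -!big_split; apply: eq_bigr => j _ /=.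
    by rewrite !scalerDl !scalerA.
  rewrite -E12 -E23 -E31.
  by apply/rowP => i; rewrite !mxE; ring.
have wP j : exists qr : S * S, w12 j = l H2 * qr.1 - l H1 * qr.2.
  have [q [r]] := regular_forms H1A H2A H3A neq nsub (cyc j).
  by exists (q, r).
have [qr qrE] := fin_all_exists wP.
have [t1 t1E] : exists t1, t1 = \sum_j (qr j).1 *: Theta j by eexists.
have [t2 t2E] : exists t2, t2 = \sum_j (qr j).2 *: Theta j by eexists.
have E : l H2 *: u1 - l H1 *: u2 = l H2 *: t1 - l H1 *: t2.
  rewrite E12 t1E t2E !scaler_sumr -sumrB; apply: eq_bigr => j _.
  by rewrite qrE scalerBl !scalerA.
have [v1 v1D] : exists v1, v1 = u1 - t1 by eexists.
have [v2 v2D] : exists v2, v2 = u2 - t2 by eexists.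
have v12 : l H2 *: v1 = l H1 *: v2.
  apply/rowP => i; move/rowP/(_ i): E; rewrite v1D v2D !mxE => Ei.
  by rewrite !mulrBr -[l H2 * u1 0 i](subrK (l H1 * u2 0 i)) Ei; ring.
have etaP i : exists h, v1 0 i = l H1 * h.
  have [x [tau [_ tauP _]]] := lf_reduction (form_of_neq0 A_arr H1A).
  have /(congr1 tau) : l H2 * v1 0 i = l H1 * v2 0 i.
    by have /rowP/(_ i) := v12; rewrite !mxE.
  rewrite !rmorphM /= (proj2 (tauP (l H1))); last by exists 1; rewrite mul1r.
  rewrite mul0r => /eqP; rewrite mulf_eq0 => /orP[/eqP/tauP|/eqP/tauP[h ->]].
    by case/(form_indep H1A H2A neq).
  by exists h; rewrite mulrC.
have [h hE] := fin_all_exists etaP.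
pose eta : 'rV[S]_n := \row_i h i.
have v1E : v1 = l H1 *: eta by apply/rowP => i; rewrite hE !mxE.
have l1 : l H1 != 0 by rewrite lf_eq0 (form_of_neq0 A_arr).
have v2E : v2 = l H2 *: eta.
  apply/rowP => i; apply: (mulfI l1).
  by have /rowP/(_ i) := v12; rewrite v1E !mxE => <-; rewrite mulrCA.
have ThA j H : H \in A -> exists q, ev (form_of H) (Theta j) = q * l H ^+ m H.
  by case: Th_basis => ThA _ _; apply: ThA.
have evTh (p : 'I_k -> S) H : H \in A ->
    exists q, ev (form_of H) (\sum_j p j *: Theta j) = q * l H ^+ m H.
  by move: H; apply: log_field_sum => j H; apply: ThA.
exists eta => H HA.
have final G v u p : G \in A -> G != H -> v = l G *: eta ->
    (forall H, H \in A -> exists q, ev (form_of H) u - l G * s H = q * l H ^+ m H) ->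
    v = u - \sum_j p j *: Theta j ->
    exists q, ev (form_of H) eta - s H = q * l H ^+ m H.
  move=> GA GH vE uP vE'; apply: (@lf_pow_cancel _ _ _ _ (l G)).
  - exact: (form_of_neq0 A_arr HA).
  - by apply: (form_indep HA GA); rewrite eq_sym.
  have [q qE] := uP H HA; have [r rE] := evTh p H HA.
  exists (q - r); rewrite mulrBr -evZ -vE vE' evB rE.
  by rewrite mulrBl -qE addrAC.
have [H1H|neq1] := eqVneq H1 H.
  have neq2 : H2 != H by rewrite -H1H eq_sym.
  rewrite t2E in v2D.
  exact: (final H2 v2 u2 (fun j => (qr j).2) H2A neq2 v2E u2P v2D).
rewrite t1E in v1D.
exact: (final H1 v1 u1 (fun j => (qr j).1) H1A neq1 v1E u1P v1D).
Qed.

(** Induction on the sum of the three exponents, lowering one of them at a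
    time. *)
Lemma solvable_regular_pow H1 H2 H3 i1 i2 i3 s :
    H1 \in A -> H2 \in A -> H3 \in A -> H1 != H2 -> ~~ (H1 :&: H2 <= H3)%VS ->
    solvable (fun H => l H1 ^+ i1 * s H) -> solvable (fun H => l H2 ^+ i2 * s H) ->
    solvable (fun H => l H3 ^+ i3 * s H) ->
  solvable s.
Proof.
move=> H1A H2A H3A neq nsub.
have [N] := ubnP (i1 + i2 + i3)%N; elim: N i1 i2 i3 s => // N IH i1 i2 i3 s.
have e0 s' : (solvable (fun H => 1 * s' H)) -> solvable s'.
  by apply: solvable_ext => H _; rewrite mul1r.
case: i1 => [|i1]; first by rewrite expr0 => _ /e0.
case: i2 => [|i2]; first by rewrite expr0 => _ _ /e0.
case: i3 => [|i3]; first by rewrite expr0 => _ _ _ /e0.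
move=> ltN s1 s2 s3.
have mulS G j g : solvable (fun H => l G ^+ j * s H) ->
    solvable (fun H => l G ^+ j * (g * s H)).
  by move/(solvable_scale g); apply: solvable_ext => H _; rewrite mulrCA.
have mulE G j : solvable (fun H => l G ^+ j.+1 * s H) ->
    solvable (fun H => l G ^+ j * (l G * s H)).
  by apply: solvable_ext => H _; rewrite exprSr mulrA.
apply: (solvable_regular H1A H2A H3A neq nsub).
- by apply: (IH i1 i2.+1 i3.+1); [lia|apply: mulE|apply: mulS|apply: mulS].
- by apply: (IH i1.+1 i2 i3.+1); [lia|apply: mulS|apply: mulE|apply: mulS].
by apply: (IH i1.+1 i2.+1 i3); [lia|apply: mulS|apply: mulS|apply: mulE].
Qed.

(** For a subset T of A let P T be the product of the powers of the forms
    outside T.  If T lies in some A_X, a solution near X multiplied by P T is a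
    solution for P T s.  Otherwise T contains three independent forms, and the
    problem for P T s becomes solvable after multiplication by a power of each of
    them, by induction on T.  The case T = A is the claim. *)
Lemma solvable_local s : (2 <= rank A)%N ->
    (forall X, X \in flats A 2 -> exists v, forall H, H \in localization A X ->
       exists q, ev (form_of H) v - s H = q * l H ^+ m H) ->
  solvable s.
Proof.
move=> rA loc.
pose P (T : {fset {vspace V}}) : S := \prod_(H <- A | H \notin T) l H ^+ m H.
suff main N (T : {fset {vspace V}}) : (#|` T| < N)%N -> T `<=` A ->
    solvable (fun H => P T * s H).
  apply: solvable_ext (main _ A (leqnn _) (fsubset_refl _)) => H _.
  by rewrite /P big_seq_cond big1 ?mul1r // => G /andP[->].
elim: N T => // N IH T cT TA; have TA' := fsubsetP TA.
have [[X Xf TX]|notloc] :=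
    classic (exists2 X, X \in flats A 2 & T `<=` localization A X).
  have [v vX] := loc X Xf; exists (P T *: v) => H HA; rewrite evZ -mulrBr.
  have [HT|HT] := boolP (H \in T).
    by have [q ->] := vX H (fsubsetP TX _ HT); exists (P T * q); rewrite mulrA.
  exists ((\prod_(G <- rem H A | G \notin T) l G ^+ m G) *
          (ev (form_of H) v - s H)).
  by rewrite /P (big_rem H) //= HT; ring.
have [H1 [H2 [H1T H2T neq]]] : exists H1 H2, [/\ H1 \in T, H2 \in T & H1 != H2].
  apply: NNPP => no2; apply: notloc.
  have [H HA TH] : exists2 H, H \in A & forall G, G \in T -> G = H.
    have [T0|[H HT]] := fset_0Vmem T.
      have [H HA] := rank_gt0_hyp (ltnW rA).
      by exists H => // G; rewrite T0 inE.
    exists H => [|G GT]; first exact: TA'.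
    by apply: NNPP => /eqP GH; apply: no2; exists G, H.
  have [H' H'A HH'] := rank_gt1_hyp rA HA.
  exists (H :&: H')%VS; first by apply: (flat2I A_arr); rewrite // eq_sym.
  by apply/fsubsetP => G /TH ->; rewrite in_loc HA capvSl.
have [H3 H3T nsub] : exists2 H3, H3 \in T & ~~ (H1 :&: H2 <= H3)%VS.
  apply: NNPP => no3; apply: notloc; exists (H1 :&: H2)%VS.
    by apply: (flat2I A_arr); rewrite // TA'.
  apply/fsubsetP => G GT; rewrite in_loc TA' //=; apply/negPn/negP => Gn.
  by apply: no3; exists G.
have step H : H \in T -> solvable (fun G => l H ^+ m H * (P T * s G)).
  move=> HT; have HA := TA' _ HT.
  apply: solvable_ext (IH (T `\ H) _ _) => [G _||].
  - rewrite mulrA; congr (_ * _); rewrite /P (big_rem H) //= [in RHS](big_rem H) //=.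
    rewrite HT !inE eqxx /=; congr (_ * _).
    rewrite mul1r big_seq_cond [RHS]big_seq_cond; apply: eq_bigl => L.
    rewrite (rem_filter _ (fset_uniq A)) mem_filter /= !inE.
    by case: (L == H).
  - by rewrite (cardfsD1 H) HT in cT.
  exact: fsubset_trans (fsubsetDl _ _) TA.
by apply: (solvable_regular_pow (TA' _ H1T) (TA' _ H2T) (TA' _ H3T) neq nsub);
  apply: step.
Qed.
End Basis.
End Lifting.

(** * The spaces R_2 and R_3 in terms of linear relations *)

Section Relations.
Variables (K : fieldType) (V : vectType K).
Implicit Types (A B : {fset {vspace V}}) (H X Y : {vspace V}).
Implicit Types (t : {vspace V} -> K) (u : {vspace V} -> {vspace V} -> K).

(** The coefficients t of a linear relation among the chosen forms of B. *)
Definition relation B t : Prop := \sum_(H <- B) t H *: form_of H = 0.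

(** A family of relations, one on each rank two localization of B: an element
    of the direct sum of the R_2(B_X). *)
Definition relations2 B u : Prop :=
  forall X, X \in flats B 2 -> relation (localization B X) (u X).

(** The value at H of the image of the family under pi_2. *)
Definition total B u H : K := \sum_(X <- flats B 2 | (X <= H)%VS) u X H.

Lemma lattice_full A : (fullv : {vspace V}) \in lattice A.
Proof.
apply/latticeP; exists fset0; first exact: fsub0set.
by rewrite /acenter big_nil.
Qed.

Lemma latticeS A B : B `<=` A -> lattice B `<=` lattice A.
Proof.
move=> BA; apply/fsubsetP => X /latticeP[C CB ->]; apply/latticeP.
by exists C => //; apply: fsubset_trans BA.
Qed.

Lemma acenter1 H : acenter [fset H] = H.
Proof.
apply/eqP; rewrite eqEsubv acenter_sub ?inE //.
by apply/sub_acenterP => G; rewrite inE => /eqP->.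
Qed.

Lemma hyp_lattice A H : H \in A -> H \in lattice A.
Proof.
by move=> HA; apply/latticeP; exists [fset H]; rewrite ?fsub1set // acenter1.
Qed.

Lemma flats0 A X : (X \in flats A 0) = (X == fullv).
Proof.
rewrite in_flats; apply/andP/eqP => [[_ /eqP X0]|->].
  by apply: codim_eq; rewrite ?subvf // X0 codim_full.
by rewrite lattice_full codim_full.
Qed.

Section Concrete.
Variables (A B : {fset {vspace V}}).
Hypothesis A_arr : arrangement A.
Hypothesis BA : B `<=` A.

Let B_arr : arrangement B.
Proof. by move=> H /(fsubsetP BA); apply: A_arr. Qed.

Lemma flats1 X : (X \in flats B 1) = (X \in B).
Proof.
rewrite in_flats; apply/andP/idP => [[/latticeP[C CB ->] /eqP c1]|XB]; last first.
  by rewrite hyp_lattice // (codim_hyp B_arr).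
have [C0|[H HC]] := fset_0Vmem C.
  move: c1; suff -> : acenter C = fullv by rewrite codim_full.
  by rewrite C0 /acenter big_nil.
have HB := fsubsetP CB _ HC.
rewrite (codim_eq (acenter_sub HC)) // c1; exact/esym/(codim_hyp B_arr).
Qed.

Lemma loc_full : localization B fullv = fset0.
Proof.
apply/fsetP => H; rewrite in_loc inE; apply/negP => /andP[HB /codimS].
by rewrite codim_full (codim_hyp B_arr HB).
Qed.

Lemma loc_hyp H : H \in B -> localization B H = [fset H].
Proof.
move=> HB; apply/fsetP => G; rewrite in_loc inE.
apply/andP/eqP => [[GB HG]|->]; last by rewrite subvv.
exact/esym/(hyp_sub_eq B_arr).
Qed.

(** The embedding in the ambient spaces: R_1(B) consists of families supported at
    the whole space V, R_2(B) of families supported at the hyperplanes of B with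
    multiples of the form at each, and R_3(B) of families of such families
    supported at the rank two flats. *)
Definition enc1 (g : linform V) : ambientR A 1 :=
  [ffun X : lattice A => if val X == fullv then g else 0].

Definition enc2 (C : {fset {vspace V}}) t : ambientR A 2 :=
  [ffun X : lattice A =>
     if val X \in C then enc1 (t (val X) *: form_of (val X)) else 0].

Definition enc3 u : ambientR A 3 :=
  [ffun X : lattice A =>
     if val X \in flats B 2 then enc2 (localization B (val X)) (u (val X)) else 0].

Let full : lattice A := [` lattice_full A].

(** The only flat of rank zero is V, with empty localization, so an element of
    R_1(B) is a functional on V; being in the kernel of pi_0 means that it vanishes
    on the centre of B. *)
Lemma inR1P (c : ambientR A 1) :
  inR B c <-> exists2 g : linform V, c = enc1 g & (acenter B <= lker g)%VS.
Proof.
have piE g : @piR K V A 0 B (enc1 g) = (g \o projv (acenter B))%VF.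
  rewrite /piR (bigD1 full) //= !ffunE /= eqxx big1 ?addr0 // => Z neq.
  rewrite ffunE; case: eqP => [ZE|_]; last by apply/lfunP => x; rewrite comp_lfunE !zero_lfunE.
  by case/eqP: neq; apply: val_inj.
have projP (g : linform V) : (g \o projv (acenter B))%VF = 0 <-> (acenter B <= lker g)%VS.
  split=> [/lfunP g0|/subvP sub].
    apply/subvP => x xB; rewrite memv_ker -[x](projv_id xB) -comp_lfunE g0.
    by rewrite zero_lfunE.
  apply/lfunP => x; rewrite comp_lfunE zero_lfunE.
  by apply/eqP; rewrite -memv_ker; apply: sub; apply: memv_proj.
split=> [[/= c1 c0]|[g -> gB]].
  have cE : c = enc1 (c full).
    apply/ffunP => Z; rewrite ffunE; have := c1 Z; rewrite flats0.
    by case: eqP => // ZE _; congr (c _); apply: val_inj.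
  exists (c full) => //; apply/projP.
  by rewrite -piE -cE.
split=> [Z|]; last by rewrite piE; apply/projP.
rewrite flats0 ffunE; case: eqP => // -> /=; rewrite loc_full /acenter big_nil.
suff -> : (fullv : {vspace V})^C%VS = 0%VS by rewrite sub0v.
by have := capv_compl (fullv : {vspace V}); rewrite capfv.
Qed.

End Concrete.

Section Concrete2.
Variables (A B : {fset {vspace V}}).
Hypothesis A_arr : arrangement A.
Hypothesis BA : B `<=` A.

Let B_arr : arrangement B.
Proof. by move=> H /(fsubsetP BA); apply: A_arr. Qed.

Local Notation enc1 := (enc1 A).
Local Notation enc2 := (enc2 A).

Let fullA : lattice A := [` lattice_full A].

Lemma enc1_eval g : (enc1 g) fullA = g.
Proof. by rewrite ffunE /= eqxx. Qed.

Lemma enc1D g g' : enc1 (g + g') = enc1 g + enc1 g'.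
Proof. by apply/ffunP => Z; rewrite !ffunE; case: ifP; rewrite ?addr0. Qed.

Lemma enc1_0 : enc1 (0 : linform V) = 0.
Proof. by apply/ffunP => Z; rewrite !ffunE; case: ifP. Qed.

Lemma enc1_eq0 g : (enc1 g = 0) <-> (g = 0).
Proof.
split=> [E|->]; last exact: enc1_0.
by rewrite -(enc1_eval g) E ffunE.
Qed.

Lemma sum_lattice (W : nmodType) (C : {fset {vspace V}}) (F : {vspace V} -> W) :
    C `<=` lattice A ->
  \sum_(Z : lattice A) (if val Z \in C then F (val Z) else 0) = \sum_(X <- C) F X.
Proof.
move=> CA; rewrite -(big_seq_fsetE _ (lattice A) xpredT (fun X => if X \in C then F X else 0)) /=.
rewrite -big_mkcond -big_filter; apply: perm_big; apply: uniq_perm.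
- by rewrite filter_uniq ?fset_uniq.
- exact: fset_uniq.
move=> X; rewrite mem_filter; case: (boolP (X \in C)) => //= XC.
exact: (fsubsetP CA).
Qed.

Lemma B_lattice : B `<=` lattice A.
Proof. by apply/fsubsetP => H /(fsubsetP BA); apply: hyp_lattice. Qed.

Lemma flats_lattice k : flats B k `<=` lattice A.
Proof.
apply/fsubsetP => X; rewrite in_flats => /andP[XB _].
exact: (fsubsetP (latticeS BA)).
Qed.

Lemma enc1_sum (I : Type) (r : seq I) (P : pred I) (F : I -> linform V) :
  \sum_(i <- r | P i) enc1 (F i) = enc1 (\sum_(i <- r | P i) F i).
Proof. by elim/big_rec2: _ => [|i g' g _ ->]; rewrite ?enc1_0 // enc1D. Qed.

(** The member at H of an element of R_2(B) vanishes on H, hence is a multiple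
    of the chosen form; lying in the kernel of pi_1 is the linear relation. *)
Lemma inR2P (c : ambientR A 2) :
  inR B c <-> exists2 t, c = enc2 B t & relation B t.
Proof.
have piE t : @piR K V A 1 B (enc2 B t) = enc1 (\sum_(H <- B) t H *: form_of H).
  rewrite /piR /=; under eq_bigr do rewrite ffunE.
  rewrite (sum_lattice (fun H => enc1 (t H *: form_of H)) B_lattice).
  exact: enc1_sum.
split=> [[c1 c0]|[t -> rel]]; last first.
  split; last by rewrite piE rel enc1_0.
  move=> Z; rewrite (flats1 A_arr BA) ffunE.
  have [ZB|_ //] := boolP (val Z \in B).
  have sub : localization B (val Z) `<=` A by apply: fsubset_trans (loc_sub _ _) BA.
  apply/(inR1P A_arr sub); exists (t (val Z) *: form_of (val Z)) => //.
  rewrite (loc_hyp A_arr BA) // acenter1; apply/subvP => x.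
  rewrite (mem_hyp B_arr) // memv_ker scale_lfunE => /eqP->.
  by rewrite scaler0.
have cH H : exists k : K, forall Z : lattice A, val Z = H -> H \in B ->
    c Z = enc1 (k *: form_of H).
  case: (boolP (H \in B)) => HB; last by exists 0.
  have HL := fsubsetP B_lattice _ HB.
  have := c1 [` HL]; rewrite (flats1 A_arr BA) HB.
  have sub : localization B H `<=` A by apply: fsubset_trans (loc_sub _ _) BA.
  case/(inR1P A_arr sub) => g gE; rewrite (loc_hyp A_arr BA) // acenter1.
  rewrite -{1}(form_ofK B_arr HB) => /lker_scale[k kE]; exists k => Z ZE _.
  by rewrite -kE -gE; congr (c _); apply: val_inj.
pose t H := epsilon (inhabits 0) (fun k : K => forall Z : lattice A, val Z = H ->
  H \in B -> c Z = enc1 (k *: form_of H)).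
have tE H := epsilon_spec (inhabits 0) _ (cH H); rewrite -/(t _) in tE.
have cE : c = enc2 B t.
  apply/ffunP => Z; rewrite ffunE; have := c1 Z; rewrite (flats1 A_arr BA).
  by case: ifP => // ZB _; apply: tE.
by exists t => //; move: c0; rewrite {1}cE piE enc1_eq0.
Qed.

Lemma enc2_eval C t H (HL : H \in lattice A) : 
  (enc2 C t) [` HL] fullA = if H \in C then t H *: form_of H else 0.
Proof.
rewrite ffunE /=; case: ifP => _; first exact: enc1_eval.
by rewrite ffunE.
Qed.

Lemma form_scale_eq0 H (k : K) : H \in B -> (k *: form_of H == 0) = (k == 0).
Proof. by move=> HB; rewrite scaler_eq0 (negPf (form_of_neq0 B_arr HB)) orbF. Qed.

Lemma enc2_inj C t t' : C `<=` B -> enc2 C t = enc2 C t' ->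
  forall H, H \in C -> t H = t' H.
Proof.
move=> CB E H HC; have HL := fsubsetP B_lattice _ (fsubsetP CB _ HC).
have := enc2_eval C t HL; rewrite E enc2_eval HC => /eqP.
rewrite -subr_eq0 -scalerBl form_scale_eq0 ?(fsubsetP CB) // subr_eq0.
by move/eqP.
Qed.

Lemma enc2_0 C t : (forall H, H \in C -> t H = 0) -> enc2 C t = 0.
Proof.
move=> t0; apply/ffunP => Z; rewrite !ffunE; case: ifP => // ZC.
by rewrite t0 // scale0r enc1_0.
Qed.

Lemma sum_enc2 u :
  \sum_(X <- flats B 2) enc2 (localization B X) (u X) = enc2 B (total B u).
Proof.
apply/ffunP => Z; rewrite sum_ffunE ffunE.
under eq_bigr do rewrite ffunE in_loc.
have [ZB|ZB] /= := boolP (val Z \in B); last by rewrite big1.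
by rewrite -big_mkcond /= enc1_sum /total scaler_suml.
Qed.

Lemma piR_enc3 u : @piR K V A 2 B (enc3 A B u) = enc2 B (total B u).
Proof.
rewrite /piR /= -sum_enc2; under eq_bigr do rewrite ffunE.
exact: (sum_lattice (fun X => enc2 (localization B X) (u X)) (flats_lattice 2)).
Qed.
End Concrete2.

Section Concrete3.
Variables (A B : {fset {vspace V}}).
Hypothesis A_arr : arrangement A.
Hypothesis BA : B `<=` A.

Let B_arr : arrangement B.
Proof. by move=> H /(fsubsetP BA); apply: A_arr. Qed.

Let locA X : localization B X `<=` A.
Proof. by apply: fsubset_trans (loc_sub _ _) BA. Qed.

Lemma direct_sumR2P (c : {ffun lattice A -> ambientR A 2}) :
  direct_sumR B (fun X => @inR K V A 2 (localization B X)) c <->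
  exists2 u, c = enc3 A B u & relations2 B u.
Proof.
split=> [cS|[u -> rel] Z]; last first.
  rewrite ffunE; have [ZB|_ //] := boolP (val Z \in flats B 2).
  by apply/(inR2P A_arr (locA _)); exists (u (val Z)) => //; apply: rel.
have cX X : exists t, forall Z : lattice A, val Z = X -> X \in flats B 2 ->
    c Z = enc2 A (localization B X) t /\ relation (localization B X) t.
  have [XB|XB] := boolP (X \in flats B 2); last by exists (fun=> 0).
  have XL := fsubsetP (flats_lattice BA 2) _ XB.
  have := cS [` XL]; rewrite XB => /(inR2P A_arr (locA _))[t tE rel].
  by exists t => Z ZE _; rewrite -tE; split=> //; congr (c _); apply: val_inj.
pose u X := epsilon (inhabits (fun=> 0)) (fun t => forall Z : lattice A,
  val Z = X -> X \in flats B 2 ->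
  c Z = enc2 A (localization B X) t /\ relation (localization B X) t).
have uE X := epsilon_spec (inhabits (fun=> 0)) _ (cX X); rewrite -/(u _) in uE.
exists u.
  apply/ffunP => Z; rewrite ffunE; have := cS Z; case: ifP => // ZB _.
  by have [] := uE _ Z erefl ZB.
move=> X XB; have XL := fsubsetP (flats_lattice BA 2) _ XB.
by have [] := uE _ [` XL] erefl XB.
Qed.

(** The right-hand side does not mention the ambient arrangement, which allows to
    pass from R_3 of a localization computed in itself to the same space computed
    inside A. *)
Lemma trivial3P :
  (forall v : ambientR A 3, inR B v -> v = 0) <->
  (forall u, relations2 B u -> (forall H, H \in B -> total B u H = 0) ->
    forall X H, X \in flats B 2 -> H \in localization B X -> u X H = 0).
Proof.
split=> [triv u rel tot X H XB HX|triv v [/direct_sumR2P[u -> rel] v0]].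
  have E : enc3 A B u = 0.
    apply: triv; split; first by apply/direct_sumR2P; exists u.
    by rewrite (piR_enc3 BA) enc2_0.
  have XL := fsubsetP (flats_lattice BA 2) _ XB.
  have /ffunP/(_ [` XL]) := E; rewrite !ffunE XB => E2.
  have E3 : enc2 A (localization B X) (u X) = enc2 A (localization B X) (fun=> 0).
    by rewrite E2 enc2_0.
  exact: (enc2_inj A_arr BA (loc_sub _ _) E3).
apply/ffunP => Z; rewrite !ffunE; case: ifP => // ZB.
apply: enc2_0 => H HZ; apply: triv => // G GB.
apply: (enc2_inj A_arr BA (fsubset_refl _) (t' := fun=> 0)) => //.
rewrite -(piR_enc3 BA) [RHS]enc2_0 //; exact: v0.
Qed.
End Concrete3.

Section TF2.
Variable A : {fset {vspace V}}.
Hypotheses (A_arr : arrangement A) (A_TF2 : TF2 A) (A_rank : (3 <= rank A)%N).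

Lemma loc_acenter : localization A (acenter A) = A.
Proof.
apply/fsetP => H; rewrite in_loc; case: (boolP (H \in A)) => //= HA.
exact: acenter_sub.
Qed.

Lemma TF2_formal : formal A 3.
Proof.
have [tf _] := A_TF2.
have := tf (acenter A) _ 3; rewrite loc_acenter; apply=> //.
by apply/latticeP; exists A.
Qed.

(** Surjectivity of pi_2. *)
Lemma TF2_generate t : relation A t -> exists2 u, relations2 A u &
  forall H, H \in A -> t H = total A u H.
Proof.
move=> rel; have sub := fsubset_refl A.
have inR2 : inR A (enc2 A A t) by apply/(inR2P A_arr sub); exists t.
have [c /(direct_sumR2P A_arr sub)[u -> rels] piE] := TF2_formal (isT : 2 <= 2 <= 3)%N inR2.
exists u => //; apply: (enc2_inj A_arr sub sub).
by rewrite -(piR_enc3 sub); apply: esym piE.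
Qed.

(** Injectivity of pi_2: its kernel R_3(A) is spanned by the R_3(A_X) for X of
    rank three, by 3-formality, and these vanish. *)
Lemma TF2_independent u : relations2 A u -> (forall H, H \in A -> total A u H = 0) ->
  forall X H, X \in flats A 2 -> H \in localization A X -> u X H = 0.
Proof.
have sub := fsubset_refl A.
apply: (proj1 (trivial3P A_arr sub)) => v vR.
have [c cS <-] := TF2_formal (isT : 2 <= 3 <= 3)%N vR.
rewrite /piR big1 // => Z _ /=; have := cS Z; case: ifP => // ZA cZ.
have [_ /(_ 3 isT _ ZA) triv] := A_TF2.
have arr : arrangement (localization A (val Z)).
  by move=> H; rewrite in_loc => /andP[/A_arr].
apply: (proj2 (trivial3P A_arr (loc_sub _ _))) cZ.
exact/(proj1 (trivial3P arr (fsubset_refl _)))/triv.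
Qed.
End TF2.
End Relations.

(** * Dual forms of the two conditions *)

Section Gluing.
Variables (K : fieldType) (V : vectType K) (A : {fset {vspace V}}).
Hypotheses (A_arr : arrangement A) (A_TF2 : TF2 A) (A_rank : (3 <= rank A)%N).
Implicit Types (X Y G H : {vspace V}) (x y : V) (c : {vspace V} -> K).

(** On the hyperplanes through X, the function c is the evaluation of the forms at
    one vector.  These are the functions orthogonal to the relations in A_X. *)
Definition linear_at c X : Prop :=
  exists x, forall H, H \in localization A X -> c H = form_of H x.

Lemma sum_loc (W : nmodType) (F : {vspace V} -> W) X :
  \sum_(H <- localization A X) F H = \sum_(H <- A | (X <= H)%VS) F H.
Proof.
rewrite -[RHS]big_filter; apply: perm_big; apply: uniq_perm.
- exact: fset_uniq.
- by rewrite filter_uniq ?fset_uniq.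
by move=> H; rewrite mem_filter in_loc andbC.
Qed.

Lemma exchange_loc (W : nmodType) (F : {vspace V} -> {vspace V} -> W)
    (s : seq {vspace V}) :
  \sum_(H <- A) \sum_(X <- s | (X <= H)%VS) F X H =
  \sum_(X <- s) \sum_(H <- localization A X) F X H.
Proof.
rewrite (exchange_big_dep xpredT) //=; apply: eq_bigr => X _.
by rewrite sum_loc.
Qed.

Definition ext0 (T : Type) (z : T) (B : {fset {vspace V}}) (t : B -> T) H : T :=
  if insub H is Some h then t h else z.

Lemma ext0E (T : Type) (z : T) (B : {fset {vspace V}}) (t : B -> T) (h : B) :
  ext0 z t (val h) = t h.
Proof. by rewrite /ext0 valK. Qed.

Lemma apply_relation (B : {fset {vspace V}}) (t : {vspace V} -> K) x :
  relation B t -> \sum_(H <- B) t H * form_of H x = 0.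
Proof.
move=> rel; transitivity ((\sum_(H <- B) t H *: form_of H) x : K).
  by rewrite sum_lfunE; apply: eq_bigr => H _; rewrite scale_lfunE.
by rewrite [\sum_(H <- B) _]rel zero_lfunE.
Qed.

Lemma relation_of_apply (B : {fset {vspace V}}) (t : {vspace V} -> K) :
  (forall x, \sum_(H <- B) t H * form_of H x = 0) -> relation B t.
Proof.
move=> t0; apply/lfunP => x; rewrite zero_lfunE -(t0 x) sum_lfunE.
by apply: eq_bigr => H _; rewrite scale_lfunE.
Qed.

(** By TF2_generate a relation on A is a sum of relations on the A_X; the function c
    is orthogonal to each of these, hence to all relations, hence linear. *)
Lemma TF2_glue c : (forall X, X \in flats A 2 -> linear_at c X) ->
  exists x, forall H, H \in A -> c H = form_of H x.
Proof.
move=> cl.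
have [||x xE] := fredholm (I := A) (f := fun h : A => form_of (val h))
    (c := fun h : A => c (val h)).
- by move=> h a u v; rewrite linearP.
- move=> t t0; pose t' := ext0 0 t.
  have relt : relation A t'.
    apply: relation_of_apply => x; apply: etrans (t0 x); rewrite big_seq_fsetE /=.
    by apply: eq_bigr => H _; rewrite /t' ext0E.
  have [u relu uE] := TF2_generate A_arr A_TF2 A_rank relt.
  have -> : \sum_h t h * c (val h) = \sum_(H <- A) t' H * c H.
    by rewrite [RHS]big_seq_fsetE /=; apply: eq_bigr => H _; rewrite /t' ext0E.
  rewrite big_seq; under eq_bigr => H HA do rewrite uE // /total mulr_suml.
  rewrite -big_seq exchange_loc big_seq big1 // => X XA.
  have [x xE] := cl X XA; rewrite big_seq.
  under eq_bigr => H HX do rewrite xE //.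
  by rewrite -big_seq; apply: apply_relation; apply: relu.
by exists x => H HA; rewrite (xE [` HA]).
Qed.

(** The unknowns are c and one vector for each rank two flat.  A relation among the
    equations is a family of relations on the A_Y with sum zero, hence zero by
    TF2_independent, so the system is solvable for every right-hand side. *)
Lemma TF2_bridge X H : X \in flats A 2 -> H \in localization A X ->
  exists c, (forall Y, Y \in flats A 2 -> Y != X -> linear_at c Y) /\
    linear_at (fun G => c G - (G == H)%:R) X.
Proof.
move=> XA HX.
pose W : vectType K := ({ffun A -> K^o} * {ffun flats A 2 -> V})%type.
pose f (i : flats A 2 * A) (w : W) : K :=
  if (val i.1 <= val i.2)%VS then w.1 i.2 - form_of (val i.2) (w.2 i.1) else 0.
pose r (i : flats A 2 * A) : K := ((val i.1 == X) && (val i.2 == H))%:R.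
have flin i a u v : f i (a *: u + v) = a * f i u + f i v.
  rewrite /f; case: ifP => _; last by rewrite mulr0 addr0.
  by rewrite /= !ffunE linearP /= /GRing.scale /=; ring.
have [t t0|[c x] E] := fredholm flin (c := r).
  pose u Y G := if (Y <= G)%VS then ext0 0 (fun Z => ext0 0 (fun L => t (Z, L)) G) Y else 0.
  have uE (Z : flats A 2) (L : A) : u (val Z) (val L) =
      if (val Z <= val L)%VS then t (Z, L) else 0.
    by rewrite /u !ext0E.
  have pairs w : \sum_(Z : flats A 2) \sum_(L : A) t (Z, L) * f (Z, L) w = 0.
    by rewrite pair_big /= -[RHS](t0 w); apply: eq_bigr => -[].
  have rel : relations2 A u.
    move=> Y YA; apply: relation_of_apply => x.
    pose w : W := (0, [ffun Z => if val Z == Y then - x else 0]).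
    apply: etrans (pairs w).
    rewrite [RHS](bigD1 [` YA]) //= [X in _ + X]big1 ?addr0; last first.
      move=> Z ZY; rewrite big1 // => L _; rewrite /f /= !ffunE.
      have -> : val Z == Y = false by apply: contraNF ZY => /eqP E; apply/eqP/val_inj.
      by rewrite linear0 subr0; case: ifP => _; rewrite mulr0.
    rewrite sum_loc big_mkcond big_seq_fsetE /=; apply: eq_bigr => L _.
    rewrite (uE [` YA]) /f /= !ffunE eqxx.
    case: (Y <= fsval L)%VS; rewrite ?mulr0 ?mul0r //.
    by rewrite linearN sub0r opprK.
  have tot G : G \in A -> total A u G = 0.
    move=> GA; pose w : W := ([ffun L => (val L == G)%:R], 0).
    apply: etrans (pairs w).
    rewrite [RHS]exchange_big /= [RHS](bigD1 [` GA]) //= [X in _ + X]big1 ?addr0; last first.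
      move=> L LG; rewrite big1 // => Z _; rewrite /f /= !ffunE.
      have -> : val L == G = false by apply: contraNF LG => /eqP E; apply/eqP/val_inj.
      by rewrite linear0 subr0; case: ifP => _; rewrite mulr0.
    rewrite /total big_mkcond big_seq_fsetE /=; apply: eq_bigr => Z _.
    rewrite (uE Z [` GA]) /f /= !ffunE eqxx linear0 subr0.
    by case: (fsval Z <= G)%VS; rewrite ?mulr0 ?mulr1.
  have HA : H \in A by move: HX; rewrite in_loc => /andP[].
  have XH : (X <= H)%VS by move: HX; rewrite in_loc => /andP[].
  rewrite (bigD1 ([` XA], [` HA])) //= big1 ?addr0 /r /= ?eqxx ?mulr1.
    have := TF2_independent A_arr A_TF2 A_rank rel tot XA HX.
    by rewrite (uE [` XA] [` HA]) XH.
  move=> [Z L] neq; case: eqP => //= ZX; last by rewrite mulr0.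
  case: eqP => //= LH; last by rewrite mulr0.
  by case/eqP: neq; congr (_, _); apply: val_inj.
exists (ext0 0 c); split=> [Y YA YX|].
  exists (x [` YA]) => G; rewrite in_loc => /andP[GA YG].
  have := E ([` YA], [` GA]); rewrite /f /r /= YG (negPf YX) /= => /eqP.
  by rewrite subr_eq0 => /eqP <-; apply: (ext0E 0 c [` GA]).
exists (x [` XA]) => G; rewrite in_loc => /andP[GA XG].
have := E ([` XA], [` GA]); rewrite /f /r /= XG eqxx /= => <-.
have -> : ext0 0 c G = c [` GA] := ext0E 0 c [` GA].
by rewrite opprB addrCA subrr addr0.
Qed.
End Gluing.

(** * Cofactors attached to a flag *)

Section Flags.
Variables (K : fieldType) (V : vectType K) (A : {fset {vspace V}}).
Local Notation n := (\dim (fullv : {vspace V})).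
Local Notation S := {mpoly K[n]}.
Local Notation l H := (lf (form_of H)).
Hypothesis A_arr : arrangement A.
Implicit Types (X Y G H : {vspace V}) (x y : V) (m : {vspace V} -> nat).

Lemma in_L2trip X : (X \in L2trip A) = (X \in flats A 2) && (3 <= #|` localization A X|)%N.
Proof. by rewrite !inE. Qed.

Lemma trip_flat X : X \in L2trip A -> X \in flats A 2.
Proof. by rewrite in_L2trip => /andP[]. Qed.

Lemma loc_mem X H : H \in localization A X -> H \in A.
Proof. by rewrite in_loc => /andP[]. Qed.

Lemma loc_le X H : H \in localization A X -> (X <= H)%VS.
Proof. by rewrite in_loc => /andP[]. Qed.

Lemma card_ge3_third (B : {fset {vspace V}}) H G : (3 <= #|` B|)%N ->
  exists L, [/\ L \in B, L != H & L != G].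
Proof.
move=> cB; have : B `\` [fset H; G] != fset0.
  apply: contraTneq cB => /eqP; rewrite fsetD_eq0 => /fsubset_leq_card.
  by have := cardfsU1 H [fset G]; rewrite cardfs1 => -> ; case: (_ \notin _); lia.
case/fset0Pn => L; rewrite in_fsetD in_fset2 negb_or => /andP[/andP[LH LG] LB].
by exists L.
Qed.

Lemma trip_third X H G : X \in L2trip A ->
  exists L, [/\ L \in localization A X, L != H & L != G].
Proof. by rewrite in_L2trip => /andP[_]; apply: card_ge3_third. Qed.

(** In a rank two localization every form is a combination of any two others,
    with both coefficients nonzero for a third hyperplane. *)
Lemma flat_comb X H G L : X \in flats A 2 -> H \in localization A X ->
    G \in localization A X -> L \in localization A X -> H != G ->
  exists p : K * K, [/\ form_of L = p.1 *: form_of H + p.2 *: form_of G,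
    L != G -> p.1 != 0 & L != H -> p.2 != 0].
Proof.
move=> XA HX GX LX neq.
have [|p [_ E p1 p2]] := form_comb A_arr (loc_mem HX) (loc_mem GX) (loc_mem LX) neq.
  by rewrite -(flat2_eq A_arr XA HX GX neq) loc_le.
by exists p.
Qed.

(** The function c of TF2_bridge times the power of the form of H is a locally
    solvable problem; a global solution v, compared with the local solutions,
    leaves a logarithmic field near each flat, whose cofactors f do not depend on
    the flat. *)
Lemma free_flag_cofactors m X H : TF2 A -> (3 <= rank A)%N -> free_multiplicity A m ->
    X \in flats A 2 -> H \in localization A X ->
  exists f : {vspace V} -> S,
    (forall Y, Y \in flats A 2 -> Y != X -> exists v, forall G,
       G \in localization A Y -> ev (form_of G) v = f G * l G ^+ m G) /\
    (exists v, forall G, G \in localization A X ->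
       ev (form_of G) v = (f G - (G == H)%:R) * l G ^+ m G).
Proof.
move=> A_TF2 A_rank [k [theta thB]] XA HX.
have [Theta ThB _] := module_log_basis A_arr thB.
have [c [cY cX]] := TF2_bridge A_arr A_TF2 A_rank XA HX.
pose s G : S := (c G)%:MP * l H ^+ m H.
have locY Y : linear_at A c Y -> exists x, forall G, G \in localization A Y ->
    s G = ev (form_of G) (l H ^+ m H *: cst x).
  move=> [x xE]; exists x => G GY; rewrite evZ ev_cst /s xE //.
  by rewrite mulrC.
have locX : exists x, forall G, G \in localization A X ->
    s G = ev (form_of G) (l H ^+ m H *: cst x) + (G == H)%:R * l G ^+ m G.
  have [x xE] := cX; exists x => G GX; rewrite evZ ev_cst -xE //.
  rewrite /s mpolyCB; case: eqP => [->|_] /=; last by rewrite mulr0n mpolyC0; ring.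
  by rewrite mulr1n mpolyC1; ring.
have [|v vE] := @solvable_local _ _ _ m A_arr _ _ ThB s (ltnW A_rank).
- move=> Y YA; have [YX|YX] := eqVneq Y X; last first.
    have [x xE] := locY Y (cY Y YA YX); exists (l H ^+ m H *: cst x) => G GY.
    by exists 0; rewrite -xE // subrr mul0r.
  have [x xE] := locX; exists (l H ^+ m H *: cst x) => G; rewrite YX => GX.
  by exists (- (G == H)%:R); rewrite xE //; ring.
pose q G := epsilon (inhabits 0) (fun q => ev (form_of G) v - s G = q * l G ^+ m G).
have qE G : G \in A -> ev (form_of G) v - s G = q G * l G ^+ m G.
  by move=> /vE; apply: epsilon_spec.
exists (fun G => - q G); split=> [Y YA YX|].
  have [x xE] := locY Y (cY Y YA YX); exists (l H ^+ m H *: cst x - v) => G GY.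
  by rewrite evB -xE // mulNr -qE ?opprB // (loc_mem GY).
have [x xE] := locX; exists (l H ^+ m H *: cst x - v) => G GX.
have -> : ev (form_of G) (l H ^+ m H *: cst x - v) =
    - (ev (form_of G) v - s G) - (G == H)%:R * l G ^+ m G.
  by rewrite evB xE //; ring.
by rewrite qE ?(loc_mem GX) //; ring.
Qed.

(** Some logarithmic field at X takes at H the value alpha_H^(m H) times a
    polynomial not vanishing at the origin.  For homogeneous fields this means
    that the degree is m H; it turns out to be equivalent to m H being an exponent
    of D(A_X, m_X), and needs no homogeneity to be tested. *)
Definition unit_value m X H : Prop := exists v (u : S),
  [/\ log_field (localization A X) m v, ev (form_of H) v = u * l H ^+ m H & mcoeff 0 u != 0].

Lemma at0_dvd a k (f : S) : (0 < k)%N -> (exists q, f = q * lf a ^+ k) -> mcoeff 0 f = 0.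
Proof.
by case: k => // k _ [q ->]; rewrite rmorphM rmorphXn /= lf_at0 expr0n mulr0.
Qed.

(** The determinant of the values of v and psi at H and G is
    alpha_H^(m H) alpha_G^(m G) (u u' - w w'), and is divisible by the power of a
    third form through X.  Hence u u' - w w' vanishes at the origin, and the
    constant term of w cannot vanish since those of u and u' do not. *)
Lemma unit_value_propagate m X H G v u w : X \in L2trip A -> multiplicity A m ->
    H \in localization A X -> G \in localization A X -> H != G ->
    log_field (localization A X) m v ->
    ev (form_of H) v = u * l H ^+ m H -> mcoeff 0 u != 0 -> unit_value m X G ->
    ev (form_of G) v = w * l G ^+ m G ->
  mcoeff 0 w != 0.
Proof.
move=> Xt mpos HX GX neq vLD vH u0 [psi [u' [psiLD psiG u'0]]] vG.
have [L [LX LH LG]] := trip_third H G Xt.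
have [p [LE /(_ LG) p1 _]] := flat_comb (trip_flat Xt) HX GX LX neq.
have [w' psiH] := psiLD H HX.
have [r vL] := vLD L LX; have [r' psiL] := psiLD L LX.
have det : p.1 *: (ev (form_of H) v * ev (form_of G) psi -
                   ev (form_of G) v * ev (form_of H) psi) =
    ev (form_of L) v * ev (form_of G) psi - ev (form_of G) v * ev (form_of L) psi.
  rewrite LE !ev_comb -!mul_mpolyC; ring.
have : exists q, l G ^+ m G * (l H ^+ m H * (u * u' - w * w')) = q * l L ^+ m L.
  exists ((p.1^-1)%:MP * (r * u' * l G ^+ m G - w * l G ^+ m G * r')).
  have pK : (p.1^-1)%:MP * p.1%:MP = 1 :> S by rewrite -mpolyCM mulVf ?mpolyC1.
  move: det; rewrite -mul_mpolyC vH vG psiG psiH vL psiL => det.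
  rewrite -[LHS]mul1r -pK.
  transitivity ((p.1^-1)%:MP * (r * l L ^+ m L * (u' * l G ^+ m G) -
                              w * l G ^+ m G * (r' * l L ^+ m L))).
    by rewrite -det; ring.
  by ring.
have indep G' : G' \in localization A X -> L != G' -> ~ exists q, l G' = q * l L.
  move=> G'X LG'.
  exact: (form_indep A_arr (loc_mem LX) (loc_mem G'X) LG').
have L0 := form_of_neq0 A_arr (loc_mem LX).
move/(lf_pow_coprime L0 (indep _ GX LG))/(lf_pow_coprime L0 (indep _ HX LH)).
move/(at0_dvd (mpos _ (loc_mem LX)))/eqP.
rewrite rmorphB !rmorphM /= subr_eq0 => /eqP E.
by have := mulf_neq0 u0 u'0; rewrite E mulf_eq0 negb_or => /andP[].
Qed.

(** Expanding the value at a third form L in terms of those at H and G gives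
    p1 (f_L - f_H) alpha_H = p2 (f_G - f_L) alpha_G, so each difference is divisible
    by a linear form. *)
Lemma cofactor_constant (f : {vspace V} -> S) X v : X \in L2trip A ->
    (forall G, G \in localization A X -> ev (form_of G) v = f G * l G) ->
  forall H G, H \in localization A X -> G \in localization A X ->
  mcoeff 0 (f H) = mcoeff 0 (f G).
Proof.
move=> Xt fE H G HX GX; have [-> //|neq] := eqVneq H G.
have [L [LX LH LG]] := trip_third H G Xt.
have [p [LE /(_ LG) p1 /(_ LH) p2]] := flat_comb (trip_flat Xt) HX GX LX neq.
have E : p.1 *: (f L - f H) * l H = p.2 *: (f G - f L) * l G.
  have := fE L LX; rewrite LE ev_comb (fE H HX) (fE G GX) lfD !lfZ.
  rewrite -!mul_mpolyC => /eqP; rewrite -subr_eq0 => /eqP E.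
  by apply/eqP; rewrite -subr_eq0 -oppr_eq0 -[X in _ == X]E; apply/eqP; ring.
have indep G1 G2 : G1 \in localization A X -> G2 \in localization A X -> G1 != G2 ->
    ~ exists q, l G2 = q * l G1.
  by move=> G1X G2X; apply: (form_indep A_arr (loc_mem G1X) (loc_mem G2X)).
have zero (k : K) (g : S) G1 G2 h : G1 \in localization A X -> G2 \in localization A X ->
    G1 != G2 -> k != 0 -> k *: g * l G2 = h * l G1 -> mcoeff 0 g = 0.
  move=> G1X G2X G12 k0 gE.
  have : exists q, l G2 ^+ 1 * (k *: g) = q * l G1 ^+ 1.
    by exists h; rewrite !expr1 mulrC.
  move/(lf_pow_coprime (form_of_neq0 A_arr (loc_mem G1X)) (indep _ _ G1X G2X G12)).
  by move/(at0_dvd (ltn0Sn 0))/eqP; rewrite linearZ /= mulf_eq0 (negPf k0) => /eqP.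
have neq' : G != H by rewrite eq_sym.
have := zero _ _ _ _ _ HX GX neq p2 (esym E).
have := zero _ _ _ _ _ GX HX neq' p1 E.
rewrite !rmorphB /= => /eqP; rewrite subr_eq0 => /eqP <- /eqP.
by rewrite subr_eq0 => /eqP ->.
Qed.

Definition constant_on (C : pred {vspace V}) X : Prop :=
  forall G H, G \in localization A X -> H \in localization A X -> C G -> C H.

(** Through such a flat pass only two hyperplanes, whose forms are independent. *)
Lemma flats_linear (c : {vspace V} -> K) X : X \in flats A 2 -> X \notin L2trip A ->
  linear_at A c X.
Proof.
move=> XA; rewrite in_L2trip XA /= -ltnNge => c2.
have [H [G [HX GX neq XE]]] := flat2P A_arr XA.
have [x [xH xG]] := dual_forms A_arr (loc_mem HX) (loc_mem GX) neq.
have [|y [yG yH]] := dual_forms A_arr (loc_mem GX) (loc_mem HX); first by rewrite eq_sym.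
exists (c H *: x + c G *: y) => L LX.
have {c2} : L \in [fset H; G].
  have sub : [fset H; G] `<=` localization A X.
    by apply/fsubsetP => M; rewrite in_fset2 => /orP[]/eqP->.
  suff -> : [fset H; G] = localization A X by [].
  by apply/eqP; rewrite eqEfcard sub cardfs2 neq.
have E (f : linform V) : f (c H *: x + c G *: y) = c H * f x + c G * f y :> K.
  by rewrite linearD /= !linearZ.
by rewrite in_fset2 => /orP[]/eqP->; rewrite E ?xH ?yH ?xG ?yG; ring.
Qed.

(** If C is a union of components of the incidence graph, cutting off any vector
    outside C is a locally linear operation, hence realised by another vector.
    This splits V into the centres of C and of its complement, so C is everything
    by irreducibility. *)
Lemma connected_hyperplanes (C : pred {vspace V}) G0 : TF2 A -> (3 <= rank A)%N ->
    irreducible_arrangement A ->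
    (forall X, X \in L2trip A -> constant_on C X) -> G0 \in A -> C G0 ->
  forall G, G \in A -> C G.
Proof.
move=> A_TF2 A_rank irr Ccst G0A CG0 G1 G1A; apply: contraT => CG1.
case: irr.
have glue x : exists x', forall G, G \in A -> form_of G x' = if C G then form_of G x else 0.
  have [|x' x'E] := TF2_glue A_arr A_TF2 A_rank (c := fun G => if C G then form_of G x else 0).
    move=> X XA; have [Xt|Xt] := boolP (X \in L2trip A); last exact: flats_linear.
    have [[H HX CH]|nC] := classic (exists2 H, H \in localization A X & C H).
      by exists x => G GX; rewrite (Ccst X Xt H G HX GX CH).
    exists 0 => G GX; rewrite linear0; case: ifP => // CG.
    by case: nC; exists G.
  by exists x' => G GA; rewrite x'E.
pose TC := acenter [fset G in A | C G]; pose TN := acenter [fset G in A | ~~ C G].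
exists TN, (TC :\: TN)%VS; split.
- split; last by rewrite capvC capv_diff.
  rewrite addvC addv_diff; apply/eqP; rewrite eqEsubv subvf.
  apply/subvP => x _; have [x' x'E] := glue x.
  rewrite -[x](subrK x') memv_add //.
    apply/mem_acenterP => G; rewrite !inE /= => /andP[GA CG].
    by rewrite (mem_hyp A_arr) // raddfB /= x'E // CG subrr.
  apply/mem_acenterP => G; rewrite !inE /= => /andP[GA CG].
  by rewrite (mem_hyp A_arr) // x'E // (negPf CG).
- move=> G GA; have [CG|CG] := boolP (C G); [right|left].
    by apply: subv_trans (diffvSl _ _) _; apply: acenter_sub; rewrite !inE GA.
  by apply: acenter_sub; rewrite !inE GA.
- by exists G1 => //; apply: acenter_sub; rewrite !inE G1A.
by exists G0 => //; apply: subv_trans (diffvSl _ _) _; apply: acenter_sub; rewrite !inE G0A.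
Qed.

(** Take m = 1.  The constant terms of the cofactors attached to the flag (X, H)
    agree along every flat other than X, and along X once one is subtracted at H.
    So B, the set where they agree with the value at H, is the component of H
    after removal of the edge (X, H). *)
Lemma bridge_side X H : TF2 A -> (3 <= rank A)%N -> free_arrangement A ->
    X \in L2trip A -> H \in localization A X ->
  exists B : {fset {vspace V}},
    [/\ B `<=` A, forall Y, Y \in L2trip A -> Y != X -> constant_on (fun G => G \in B) Y
      & forall G, G \in localization A X -> (G \in B) = (G == H)].
Proof.
move=> A_TF2 A_rank A_free Xt HX.
have [f [fY [v vE]]] := free_flag_cofactors A_TF2 A_rank A_free (trip_flat Xt) HX.
exists [fset G in A | mcoeff 0 (f G) == mcoeff 0 (f H)]; split.
- by apply/fsubsetP => G; rewrite !inE => /andP[].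
  move=> Y Yt YX G L GY LY; have [w wE] := fY Y (trip_flat Yt) YX.
  rewrite !inE /= (loc_mem LY) => /andP[_ /eqP <-] /=; apply/eqP.
  by apply: (cofactor_constant (v := w) Yt _ LY GY) => N NY; rewrite wE // expr1.
move=> G GX; rewrite !inE (loc_mem GX) /=.
have := cofactor_constant (f := fun G => f G - (G == H)%:R) Xt _ GX HX.
move=> /(_ v); rewrite !rmorphB /= !rmorph_nat eqxx => E.
have {}E := E (fun L LX => etrans (vE L LX) (congr1 _ (expr1 _))).
apply/eqP/eqP => [fG|-> //].
move: E; rewrite fG; case: eqP => // _ /eqP.
by rewrite subr0 -subr_eq0 opprB addrCA subrr addr0 oner_eq0.
Qed.
End Flags.

(** * Multiarrangements of rank two are free *)

Section Binary.
Variables (K : fieldType) (V : vectType K).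
Local Notation n := (\dim (fullv : {vspace V})).
Local Notation S := {mpoly K[n]}.
Variables (a1 a2 : linform V) (x1 x2 : V).
Hypotheses (a1x1 : a1 x1 = 1) (a1x2 : a1 x2 = 0) (a2x1 : a2 x1 = 0) (a2x2 : a2 x2 = 1).
Implicit Types (c : K * K) (f g h p q : S) (w : S * S).

(** Binary forms of degree d in a1 and a2, as polynomials in all variables. *)
Fixpoint biform d f : Prop :=
  if d is d'.+1 then exists g h, [/\ biform d' g, biform d' h & f = lf a1 * g + lf a2 * h]
  else exists k : K, f = k%:MP.

Lemma biform0 d : biform d 0.
Proof.
elim: d => [|d IH]; first by exists 0; rewrite mpolyC0.
by exists 0, 0; split=> //; rewrite !mulr0 addr0.
Qed.

Lemma biformD d f g : biform d f -> biform d g -> biform d (f + g).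
Proof.
elim: d f g => [|d IH] f g; first by move=> [k ->] [l ->]; exists (k + l); rewrite mpolyCD.
move=> [f1 [f2 [F1 F2 ->]]] [g1 [g2 [G1 G2 ->]]]; exists (f1 + g1), (f2 + g2).
by split; [exact: IH|exact: IH|ring].
Qed.

Lemma biformZ d (k : K) f : biform d f -> biform d (k *: f).
Proof.
elim: d f => [|d IH] f; first by move=> [l ->]; exists (k * l); rewrite mpolyCM mul_mpolyC.
move=> [g [h [G H ->]]]; exists (k *: g), (k *: h).
by split; [exact: IH|exact: IH|rewrite scalerDr !scalerAr].
Qed.

Definition pencil_form c : linform V := c.1 *: a1 + c.2 *: a2.

Lemma lf_pencil_form c : lf (pencil_form c) = c.1 *: lf a1 + c.2 *: lf a2.
Proof. by rewrite lfD !lfZ. Qed.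

Lemma biform_mul c d f : biform d f -> biform d.+1 (lf (pencil_form c) * f).
Proof.
move=> bf; exists (c.1 *: f), (c.2 *: f).
by split; [exact: biformZ|exact: biformZ|rewrite lf_pencil_form -!mul_mpolyC; ring].
Qed.

Lemma biform_exp c d e f : biform d f -> biform (e + d) (lf (pencil_form c) ^+ e * f).
Proof.
by elim: e => [|e IH] bf; rewrite ?mul1r // exprS -mulrA; apply/biform_mul/IH.
Qed.

Lemma homogC (k : K) : (k%:MP : S) \is 0.-homog.
Proof. by rewrite -[k%:MP]mulr1 mul_mpolyC; apply: rpredZ; apply: dhomog1. Qed.

Lemma biform_homog d f : biform d f -> f \is d.-homog.
Proof.
elim: d f => [|d IH] f; first by move=> [k ->]; apply: homogC.
move=> [g [h [/IH G /IH H ->]]]; rewrite -add1n.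
by apply: rpredD; apply: dhomogM => //; apply: lf_homog.
Qed.

Lemma pencil_form_x1 c : pencil_form c x1 = c.1.
Proof. by rewrite add_lfunE !scale_lfunE a1x1 a2x1 scaler0 addr0 /GRing.scale /= mulr1. Qed.

Lemma pencil_form_x2 c : pencil_form c x2 = c.2.
Proof. by rewrite add_lfunE !scale_lfunE a1x2 a2x2 scaler0 add0r /GRing.scale /= mulr1. Qed.

Lemma pencil_form_eq0 c : (pencil_form c == 0) = (c == 0).
Proof.
apply/eqP/eqP => [E|->]; last by rewrite /pencil_form !scale0r addr0.
by rewrite [c]surjective_pairing -pencil_form_x1 -pencil_form_x2 E !zero_lfunE.
Qed.

(** Modulo a form c of the pencil the binary forms become polynomials in one
    variable, so a binary form reduces to a multiple of a power of any
    complementary form c'. *)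
Lemma biform_mod c : c != 0 -> exists c',
  (~ exists q, lf (pencil_form c') = q * lf (pencil_form c)) /\
  forall d f, biform d f -> exists (k : K) g,
    f = k *: lf (pencil_form c') ^+ d + lf (pencil_form c) * g /\
    (if d is d'.+1 then biform d' g else g = 0).
Proof.
move=> c0.
have [c' [s [t [det [E1 E2]]]]] : exists c' s t, c.1 * c'.2 - c.2 * c'.1 != 0 /\
    (lf a1 = s.1 *: lf (pencil_form c') + t.1 *: lf (pencil_form c) /\
     lf a2 = s.2 *: lf (pencil_form c') + t.2 *: lf (pencil_form c)).
  have [c2|c2] := eqVneq c.2 0.
    have c1 : c.1 != 0.
      by apply: contraNneq c0 => c1; rewrite [c]surjective_pairing c1 c2.
    exists (0, 1), (0, 1), (c.1^-1, 0); rewrite !lf_pencil_form c2 /=; split.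
      by rewrite mulr1 mul0r subr0.
    by rewrite !scale0r !scale1r !addr0 !add0r scalerA mulVf // scale1r.
  exists (1, 0), (1, - (c.1 / c.2)), (0, c.2^-1); rewrite !lf_pencil_form /=; split.
    by rewrite mulr0 mulr1 sub0r oppr_eq0.
  rewrite !scale0r !scale1r !addr0; split=> //.
  rewrite scalerDr !scalerA mulVf // scale1r addrA -scalerDl.
  by rewrite [c.2^-1 * _]mulrC addNr scale0r add0r.
have lc0 : pencil_form c != 0 by rewrite pencil_form_eq0.
exists c'; split.
  case/(lf_dvd_lf lc0) => k kE; case/eqP: det.
  rewrite -(pencil_form_x1 c') -(pencil_form_x2 c') kE !scale_lfunE.
  rewrite pencil_form_x1 pencil_form_x2 /GRing.scale /=.
  by ring.
elim=> [|d IH] f; first by move=> [k ->]; exists k, 0; rewrite mulr0 addr0 expr0 -mul_mpolyC mulr1.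
move=> [g [h [G H fE]]]; have [k [g' [gE G']]] := IH g G; have [l [h' [hE H']]] := IH h H.
exists (s.1 * k + s.2 * l), (t.1 *: g + t.2 *: h +
  lf (pencil_form c') * (s.1 *: g' + s.2 *: h')); split.
  rewrite fE E1 E2 {1}gE {1}hE exprS -!mul_mpolyC mpolyCD !mpolyCM.
  rewrite [in RHS]gE [in RHS]hE -!mul_mpolyC; ring.
apply: biformD; first by apply: biformD; apply: biformZ.
case: d G' H' {IH G H gE hE} => [-> ->|d G' H'].
  by rewrite !scaler0 addr0 mulr0; apply: biform0.
by apply: biform_mul; apply: biformD; apply: biformZ.
Qed.

Definition pair_ev c w : S := c.1 *: w.1 + c.2 *: w.2.

Definition pair_comb p q (b1 b2 : S * S) : S * S :=
  (p * b1.1 + q * b2.1, p * b1.2 + q * b2.2).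

Lemma pair_ev_comb c p q b1 b2 :
  pair_ev c (pair_comb p q b1 b2) = p * pair_ev c b1 + q * pair_ev c b2.
Proof. by rewrite /pair_ev /pair_comb /= -!mul_mpolyC; ring. Qed.

Definition biform2 d w : Prop := biform d w.1 /\ biform d w.2.

Lemma pair_ev_biform c d w : biform2 d w -> biform d (pair_ev c w).
Proof. by move=> [b1 b2]; apply: biformD; apply: biformZ. Qed.

Definition pair_basis (M : S * S -> Prop) (b1 b2 : S * S) : Prop :=
  [/\ forall w, M w <-> exists p q, w = pair_comb p q b1 b2
    & forall p q, pair_comb p q b1 b2 = (0, 0) -> p = 0 /\ q = 0].

Lemma pair_basisC M b1 b2 : pair_basis M b1 b2 -> pair_basis M b2 b1.
Proof.
have E p q : pair_comb p q b1 b2 = pair_comb q p b2 b1.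
  by rewrite /pair_comb addrC [X in (_, X)]addrC.
move=> [gen ind]; split=> [w|p q]; last by rewrite -E => /ind[].
by split=> [/gen[p [q ->]]|[p [q ->]]]; [exists q, p|apply/gen; exists q, p].
Qed.

(** The submodule where one more power of c divides the value at c. *)
Definition sharpen (M : S * S -> Prop) c j w : Prop :=
  M w /\ exists q, pair_ev c w = q * lf (pencil_form c) ^+ j.+1.

(** If c does not divide q1 and divides q2 - h q1, an element p b1 + q b2 lies in
    the submodule exactly when c divides p + q h, because c is prime. *)
Lemma sharpen_basis M c j b1 b2 q1 q2 h : c != 0 -> pair_basis M b1 b2 ->
    pair_ev c b1 = q1 * lf (pencil_form c) ^+ j -> pair_ev c b2 = q2 * lf (pencil_form c) ^+ j ->
    ~ (exists q, q1 = q * lf (pencil_form c)) -> (exists q, q2 - h * q1 = q * lf (pencil_form c)) ->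
  pair_basis (sharpen M c j) (lf (pencil_form c) * b1.1, lf (pencil_form c) * b1.2)
    (b2.1 - h * b1.1, b2.2 - h * b1.2).
Proof.
move=> c0 [gen ind] b1E b2E q1n [r rE].
have q2r : q2 = r * lf (pencil_form c) + h * q1 by rewrite -rE subrK.
have lc0 : pencil_form c != 0 by rewrite pencil_form_eq0.
have lfc0 : lf (pencil_form c) != 0 by rewrite lf_eq0.
set B1 := (_, _); set B2 := (_, _).
have comb p q : pair_comb p q B1 B2 = pair_comb (p * lf (pencil_form c) - q * h) q b1 b2.
  by rewrite /pair_comb /=; congr (_, _); ring.
split=> [w|p q]; last first.
  rewrite comb => /ind[E q0]; split=> //; move/eqP: E.
  by rewrite q0 mul0r subr0 mulf_eq0 (negPf lfc0) orbF => /eqP.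
split=> [[/gen[p [q ->]] [t]]|[p [q ->]]].
  rewrite pair_ev_comb b1E b2E => E.
  have : exists u, q1 * (p + q * h) = u * lf (pencil_form c) ^+ 1.
    exists (t - q * r); apply: (@mulIf _ (lf (pencil_form c) ^+ j)); first exact: expf_neq0.
    transitivity (t * lf (pencil_form c) ^+ j.+1 -
                  q * r * lf (pencil_form c) * lf (pencil_form c) ^+ j).
      by rewrite -E q2r; ring.
    by rewrite expr1 exprS; ring.
  move/(lf_pow_cancel lc0 q1n) => [u uE]; exists u, q.
  by rewrite comb -[u * _]/(u * lf (pencil_form c) ^+ 1) -uE addrK.
split; first by apply/gen; rewrite comb; exists (p * lf (pencil_form c) - q * h), q.
exists (p * q1 + q * r); rewrite comb pair_ev_comb b1E b2E exprS.
by rewrite q2r; ring.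
Qed.

Lemma biform_div c d j f q : c != 0 -> biform d f -> f = q * lf (pencil_form c) ^+ j ->
  q = 0 \/ (j <= d)%N /\ biform (d - j) q.
Proof.
move=> c0; have [c' [c'n red]] := biform_mod c0.
have lc0 : pencil_form c != 0 by rewrite pencil_form_eq0.
elim: j d f => [|j IH] d f; first by rewrite subn0 mulr1 => bf <-; right.
move=> bf fE; have [k [g [gE G]]] := red d f bf.
have k0 : k = 0.
  apply/eqP; apply: contraT => kn0.
  have : exists u, lf (pencil_form c') ^+ d * k%:MP = u * lf (pencil_form c) ^+ 1.
    exists (q * lf (pencil_form c) ^+ j - g); rewrite mulrC mul_mpolyC expr1 mulrBl.
    by rewrite -mulrA -exprSr -fE gE; ring.
  move/(lf_pow_coprime lc0 c'n)/(at0_dvd (ltn0Sn 0)).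
  by rewrite mcoeffC eqxx mulr1 => k0; rewrite k0 eqxx in kn0.
have gE' : g = q * lf (pencil_form c) ^+ j.
  apply: (@mulfI _ (lf (pencil_form c))); first by rewrite lf_eq0.
  by move: gE; rewrite k0 scale0r add0r => <-; rewrite fE exprS mulrCA.
case: d G {bf gE} => [g0|d G]; last first.
  by have [->|[jd bq]] := IH d g G gE'; [left|right].
left; apply/eqP; move/eqP: gE'; rewrite g0 eq_sym mulf_eq0 expf_eq0 lf_eq0 (negPf lc0).
by rewrite andbF orbF.
Qed.

(** Only an upper bound on d1 + d2 is recorded: it comes directly from the
    construction, where each imposed power raises one degree by at most one. *)
Definition graded_basis (M : S * S -> Prop) N : Prop := exists b1 b2 d1 d2,
  [/\ pair_basis M b1 b2, biform2 d1 b1, biform2 d2 b2 & (d1 + d2 <= N)%N].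

Lemma biform2_scale c d w : biform2 d w ->
  biform2 d.+1 (lf (pencil_form c) * w.1, lf (pencil_form c) * w.2).
Proof. by move=> [w1 w2]; split; apply: biform_mul. Qed.

(** Modulo c the two leading cofactors are multiples of powers of one form, so the
    one of smaller degree divides the other, and one of the two degrees goes up by
    one. *)
Lemma sharpen_graded M c j N : c != 0 -> graded_basis M N ->
    (forall w, M w -> exists q, pair_ev c w = q * lf (pencil_form c) ^+ j) ->
  graded_basis (sharpen M c j) N.+1.
Proof.
move=> c0 [b1 [b2 [d1 [d2 [Mb B1 B2 dN]]]]] Mc.
have [c' [c'n red]] := biform_mod c0.
have lc0 : pencil_form c != 0 by rewrite pencil_form_eq0.
have [gen _] := Mb.
have [q1 q1E] : exists q, pair_ev c b1 = q * lf (pencil_form c) ^+ j.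
  apply/Mc/gen; exists 1, 0; rewrite /pair_comb !mul1r !mul0r !addr0.
  exact: surjective_pairing.
have [q2 q2E] : exists q, pair_ev c b2 = q * lf (pencil_form c) ^+ j.
  apply/Mc/gen; exists 0, 1; rewrite /pair_comb !mul1r !mul0r !add0r.
  exact: surjective_pairing.
have resid d q f : f = q * lf (pencil_form c) ^+ j -> biform d f ->
    exists (k : K) e, [/\ exists r, q - k *: lf (pencil_form c') ^+ e = r * lf (pencil_form c),
       k != 0 -> ~ (exists r, q = r * lf (pencil_form c)) & k != 0 -> (e + j = d)%N].
  move=> fE bf; have [->|[jd bq]] := biform_div c0 bf fE.
    by exists 0, 0%N; split; rewrite ?eqxx //; exists 0; rewrite scale0r subr0 mul0r.
  have [k [g [qE _]]] := red _ _ bq; exists k, (d - j)%N; split.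
  - by exists g; rewrite {1}qE addrAC subrr add0r mulrC.
  - move=> k0 [r rE].
    have : exists u, lf (pencil_form c') ^+ (d - j) * k%:MP = u * lf (pencil_form c) ^+ 1.
      exists (r - g); rewrite mulrC mul_mpolyC expr1 mulrBl -rE {1}qE; ring.
    move/(lf_pow_coprime lc0 c'n)/(at0_dvd (ltn0Sn 0)).
    by rewrite mcoeffC eqxx mulr1 => kz; rewrite kz eqxx in k0.
  by move=> _; rewrite subnK.
have [k1 [e1 [r1 n1 D1]]] := resid _ _ _ q1E (pair_ev_biform c B1).
have [k2 [e2 [r2 n2 D2]]] := resid _ _ _ q2E (pair_ev_biform c B2).
(* when the leading residue of b1 divides that of b2 *)
have reduce (b b' : S * S) q q' k k' d d' e e' : pair_basis M b b' ->
    biform2 d b -> biform2 d' b' -> pair_ev c b = q * lf (pencil_form c) ^+ j ->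
    pair_ev c b' = q' * lf (pencil_form c) ^+ j -> (d + d' <= N)%N ->
    (exists r, q - k *: lf (pencil_form c') ^+ e = r * lf (pencil_form c)) ->
    (exists r, q' - k' *: lf (pencil_form c') ^+ e' = r * lf (pencil_form c)) ->
    ~ (exists r, q = r * lf (pencil_form c)) -> k != 0 -> (e + j = d)%N ->
    k' = 0 \/ (e <= e')%N /\ (e' + j = d')%N ->
    graded_basis (sharpen M c j) N.+1.
  move=> Mb' bB b'B qE q'E dN' [r rE] [r' r'E] qn k0 eE ke.
  pose h : S := (k' / k) *: lf (pencil_form c') ^+ (e' - e).
  have hq : exists u, q' - h * q = u * lf (pencil_form c).
    exists (r' - h * r); rewrite mulrBl -mulrA -rE -r'E.
    case: ke => [k'0|[ee _]]; rewrite /h; first by rewrite k'0 mul0r !scale0r; ring.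
    have -> : lf (pencil_form c') ^+ e' =
        lf (pencil_form c') ^+ (e' - e) * lf (pencil_form c') ^+ e.
      by rewrite -exprD subnK.
    have kk : (k' / k)%:MP * k%:MP = k'%:MP :> S by rewrite -mpolyCM divfK.
    by rewrite -!mul_mpolyC -kk; ring.
  exists (lf (pencil_form c) * b.1, lf (pencil_form c) * b.2),
    (b'.1 - h * b.1, b'.2 - h * b.2), d.+1, d'.
  split=> //; first exact: (sharpen_basis c0 Mb' qE q'E qn hq).
    exact: biform2_scale.
  have hb f : biform d f -> biform d' (- (h * f)).
    move=> bf; rewrite -scaleN1r; apply: biformZ.
    case: ke => [k'0|[ee eE']]; first by rewrite /h k'0 mul0r scale0r mul0r; apply: biform0.
    rewrite /h -scalerAl; apply: biformZ.
    have -> : d' = (e' - e + d)%N by lia.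
    exact: biform_exp.
  by case: bB b'B => [? ?] [? ?]; split; apply: biformD => //; apply: hb.
have [k10|k10] := eqVneq k1 0.
  have [k20|k20] := eqVneq k2 0.
    exists b1, b2, d1, d2; split=> //; last exact: leqW.
    split; last by case: Mb.
    move=> w; split=> [[/gen]//|wE]; split; first exact/gen.
    case: wE => p [q ->]; rewrite pair_ev_comb q1E q2E.
    case: r1 r2 => [u1 +] [u2]; rewrite k10 k20 !scale0r !subr0 => -> ->.
    by exists (p * u1 + q * u2); rewrite exprS; ring.
  apply: (reduce b2 b1 q2 q1 k2 k1 d2 d1 e2 e1) => //; [exact: pair_basisC|lia|..].
  - exact: n2.
  - exact: D2.
  by left.
have [k20|k20] := eqVneq k2 0.
  apply: (reduce b1 b2 q1 q2 k1 k2 d1 d2 e1 e2) => //; [exact: n1|exact: D1|by left].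
have [e12|e21] := leqP e1 e2.
  apply: (reduce b1 b2 q1 q2 k1 k2 d1 d2 e1 e2) => //; [exact: n1|exact: D1|].
  by right; rewrite D2.
apply: (reduce b2 b1 q2 q1 k2 k1 d2 d1 e2 e1) => //; [exact: pair_basisC|lia|..].
- exact: n2.
- exact: D2.
by right; rewrite D1 // ltnW.
Qed.

Definition pencil_module (s : seq ((K * K) * nat)) w : Prop :=
  forall i, i \in s -> exists q, pair_ev i.1 w = q * lf (pencil_form i.1) ^+ i.2.

Lemma graded_basis_ext M M' N : (forall w, M w <-> M' w) ->
  graded_basis M N -> graded_basis M' N.
Proof.
move=> MM [b1 [b2 [d1 [d2 [[gen ind] B1 B2 dN]]]]]; exists b1, b2, d1, d2; split=> //.
by split=> // w; rewrite -MM.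
Qed.

(** Rank two multiarrangements are free: impose the forms one power at a time. *)
Lemma pencil_graded s : (forall i, i \in s -> i.1 != 0) ->
  graded_basis (pencil_module s) (\sum_(i <- s) i.2).
Proof.
elim: s => [|[c j] s IH] s0.
  exists (1, 0), (0, 1), 0%N, 0%N; rewrite big_nil; split=> //.
  - split=> [w|p q].
      split=> // _; exists w.1, w.2; rewrite /pair_comb /= !mulr0 !mulr1 add0r addr0.
      exact: surjective_pairing.
    by rewrite /pair_comb /= !mulr0 !mulr1 add0r addr0 => -[].
  - by split; [exists 1; rewrite mpolyC1|exact: biform0].
  by split; [exact: biform0|exists 1; rewrite mpolyC1].
have c0 : c != 0 by apply: (s0 (c, j)); rewrite mem_head.
have {}IH : graded_basis (pencil_module s) (\sum_(i <- s) i.2).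
  by apply: IH => i is_; apply: s0; rewrite inE is_ orbT.
rewrite big_cons /=; elim: j {s0} => [|j IHj].
  rewrite add0n; apply: graded_basis_ext IH => w; split=> [sw i|sw i is_].
    rewrite inE => /orP[/eqP->|]; last exact: sw.
    by exists (pair_ev c w); rewrite mulr1.
  by apply: sw; rewrite inE is_ orbT.
rewrite addSn; apply: graded_basis_ext (sharpen_graded (j := j) c0 IHj _).
  move=> w; split=> [[sw cw] i|sw].
    rewrite inE => /orP[/eqP->//|is_]; apply: sw.
    by rewrite inE is_ orbT.
  have [q qE] := sw (c, j.+1) (mem_head _ _).
  split=> [i|]; last by exists q.
  rewrite inE => /orP[/eqP->/=|is_]; last by apply: sw; rewrite inE is_ orbT.
  by exists (q * lf (pencil_form c)); rewrite qE /= exprS mulrA.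
by move=> w; move/(_ (c, j) (mem_head _ _)).
Qed.
End Binary.

(** * Homogeneous polynomials *)

Section Homogeneous.
Variables (K : fieldType) (n : nat).
Local Notation S := {mpoly K[n]}.
Implicit Types (p q f : S) (d e i : nat).

Lemma homog_at0 d f : f \is d.-homog -> (0 < d)%N -> mcoeff 0 f = 0.
Proof.
move=> /dhomogP fd d0; apply: memN_msupp_eq0; apply: contraL d0 => /fd.
by rewrite /= mdeg0 => <-.
Qed.

Lemma pihomog_mul e i p q : p \is e.-homog ->
  pihomog mdeg i (p * q) = p * (if (e <= i)%N then pihomog mdeg (i - e) q else 0).
Proof.
move=> pe; rewrite [in LHS](pihomog_partitionE (leqnn (mmeasure mdeg q))).
rewrite mulr_sumr raddf_sum /=.
have E d : pihomog mdeg i (p * pihomog mdeg d q) =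
    if (e + d == i)%N then p * pihomog mdeg d q else 0.
  have hom : p * pihomog mdeg d q \is (e + d).-homog by apply/dhomogM/pihomogP.
  case: eqP => [<-|/eqP neq]; first exact: pihomog_dE.
  exact: pihomog_ne0 neq hom.
under eq_bigr do rewrite E.
case: leqP => ei; last first.
  by rewrite mulr0 big1 // => d _; case: eqP => // ?; exfalso; lia.
rewrite [in RHS](pihomog_partitionE (leqnn (mmeasure mdeg q))).
rewrite raddf_sum mulr_sumr; apply: eq_bigr => d _ /=.
case: eqP => [<-|ne]; first by rewrite addKn pihomog_id.
by rewrite (pihomog_ne0 _ (pihomogP _ _ _)) ?mulr0 //; apply/eqP; lia.
Qed.

Lemma pihomog0E q : pihomog mdeg 0 q = (mcoeff 0 q)%:MP.
Proof.
apply/mpolyP => m; rewrite mcoeffC.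
have [->|m0] := eqVneq m 0%MM; last first.
  rewrite mulr0; apply: memN_msupp_eq0; apply: contra m0.
  by move/(dhomogP _ _ _ (pihomogP mdeg 0 q)) => /= /eqP; rewrite mdeg_eq0.
rewrite mulr1 [in RHS](pihomog_partitionE (leqnSn (mmeasure mdeg q))).
rewrite big_ord_recl raddfD [X in _ = _ + X]raddf_sum [X in _ = _ + X]big1 ?addr0 // => i _.
exact: homog_at0 (pihomogP _ _ _) _.
Qed.

Lemma homog_unit_deg d e p q : p \is e.-homog -> p != 0 -> p * q \is d.-homog ->
  mcoeff 0 q != 0 -> d = e.
Proof.
move=> pe p0 pqd q0; apply/eqP; apply: contraNT q0 => de.
have := pihomog_mul e q pe; rewrite (pihomog_ne0 de pqd) leqnn subnn pihomog0E.
by move/esym/eqP; rewrite mulf_eq0 (negPf p0) mpolyC_eq0.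
Qed.

Lemma homog_deg_le d e p q : p \is e.-homog -> p * q \is d.-homog -> p * q != 0 ->
  (e <= d)%N.
Proof.
move=> pe pqd; apply: contraR => ed.
by rewrite -[p * q](pihomog_dE pqd) (pihomog_mul d q pe) (negPf ed) mulr0.
Qed.

Lemma homog_const e p q : p \is e.-homog -> p != 0 -> p * q \is e.-homog ->
  q = (mcoeff 0 q)%:MP.
Proof.
move=> pe p0 pqe; apply: (mulfI p0).
by rewrite -{1}[p * q](pihomog_dE pqe) (pihomog_mul e q pe) leqnn subnn pihomog0E.
Qed.

Lemma homog_prod (I : eqType) (s : seq I) (f : I -> S) (k : I -> nat) :
  (forall x : I, x \in s -> f x \is (k x).-homog) ->
  \prod_(x <- s) f x \is (\sum_(x <- s) k x).-homog.
Proof.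
elim: s => [|x s IH] fk; first by rewrite !big_nil; apply: dhomog1.
rewrite !big_cons; apply: dhomogM; first by apply: fk; rewrite mem_head.
by apply: IH => y ys; apply: fk; rewrite inE ys orbT.
Qed.

Lemma homog_exp f d : f \is 1.-homog -> f ^+ d \is d.-homog.
Proof.
move=> f1; elim: d => [|d IH]; first exact: dhomog1.
by rewrite exprS -add1n; apply: dhomogM.
Qed.
End Homogeneous.

(** * Exponents in rank two *)

Section Exponents.
Variables (K : fieldType) (V : vectType K) (A : {fset {vspace V}}).
Local Notation n := (\dim (fullv : {vspace V})).
Local Notation S := {mpoly K[n]}.
Local Notation l H := (lf (form_of H)).
Hypothesis A_arr : arrangement A.
Implicit Types (X Y G H : {vspace V}) (x y : V) (m : {vspace V} -> nat).

Definition homog_field d (v : 'rV[S]_n) : Prop :=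
  forall a : linform V, ev a v \is d.-homog.

Lemma arr_loc X : arrangement (localization A X).
Proof. by move=> H /loc_mem; apply: A_arr. Qed.

Lemma sum2 (F : 'I_2 -> S) : \sum_i F i = F 0 + F 1.
Proof. by rewrite big_ord_recl big_ord1; congr (F _ + F _); apply: val_inj. Qed.

(** The forms through X are combinations of two of them, so a field matters only
    through its two values there, and the module of pairs of values is that of
    pencil_graded. *)
Lemma rank2_basis m X : X \in flats A 2 ->
  exists (Theta : 'I_2 -> 'rV[S]_n) (dg : 'I_2 -> nat),
  [/\ basis_mod_center (localization A X) m Theta, forall i, homog_field (dg i) (Theta i)
    & (dg 0%R + dg 1%R <= \sum_(L <- localization A X) m L)%N].
Proof.
move=> XA; have [H [G [HX GX neq XE]]] := flat2P A_arr XA.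
have [x1 [Hx1 Gx1]] := dual_forms A_arr (loc_mem HX) (loc_mem GX) neq.
have [|x2 [Gx2 Hx2]] := dual_forms A_arr (loc_mem GX) (loc_mem HX); first by rewrite eq_sym.
pose c L := epsilon (inhabits (0, 0)) (fun p : K * K =>
  form_of L = p.1 *: form_of H + p.2 *: form_of G).
have cE L : L \in localization A X ->
    form_of L = (c L).1 *: form_of H + (c L).2 *: form_of G.
  move=> LX; apply: (epsilon_spec (inhabits (0, 0)) (fun p : K * K =>
    form_of L = p.1 *: form_of H + p.2 *: form_of G)).
  by have [p [E _ _]] := flat_comb A_arr XA HX GX LX neq; exists p.
pose s := [seq (c L, m L) | L <- localization A X].
have s0 i : i \in s -> i.1 != 0.
  case/mapP => L LX -> /=; apply: contraNneq (form_of_neq0 A_arr (loc_mem LX)) => c0.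
  by rewrite cE // c0 /= !scale0r addr0.
have [b1 [b2 [d1 [d2 [[gen ind] B1 B2 dN]]]]] := pencil_graded Hx1 Hx2 Gx1 Gx2 s0.
pose vec (w : S * S) : 'rV[S]_n := w.1 *: cst x1 + w.2 *: cst x2.
have evvec a w : ev a (vec w) = a x1 *: w.1 + a x2 *: w.2.
  by rewrite evD !evZ !ev_cst -!mul_mpolyC ![_ * _%:MP]mulrC.
have evL L v : L \in localization A X ->
    ev (form_of L) v = pair_ev (c L) (ev (form_of H) v, ev (form_of G) v).
  by move=> LX; rewrite {1}cE // ev_comb.
have evLvec L w : L \in localization A X -> ev (form_of L) (vec w) = pair_ev (c L) w.
  move=> LX; rewrite evL // !evvec Hx1 Hx2 Gx1 Gx2 !scale1r !scale0r addr0 add0r.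
  by rewrite -surjective_pairing.
have LDP v : log_field (localization A X) m v <->
    pencil_module (form_of H) (form_of G) s (ev (form_of H) v, ev (form_of G) v).
  split=> [vLD i /mapP[L LX ->] /=|vs L LX].
    by have [q qE] := vLD L LX; exists q; rewrite -evL // qE cE.
  have [|q /= qE] := vs (c L, m L); first by apply/mapP; exists L.
  by exists q; rewrite evL // qE [in RHS]cE.
have vecb w : (ev (form_of H) (vec w), ev (form_of G) (vec w)) = w.
  rewrite !evvec Hx1 Hx2 Gx1 Gx2 !scale1r !scale0r addr0 add0r.
  by rewrite -surjective_pairing.
have homv d w : biform2 (form_of H) (form_of G) d w -> homog_field d (vec w).
  move=> [w1 w2] a; rewrite evvec.
  by apply: rpredD; apply: rpredZ; apply: biform_homog; eassumption.
exists (fun i => if i == 0 then vec b1 else vec b2), (fun i => if i == 0 then d1 else d2).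
split; last first.
- by apply: leq_trans dN _; rewrite big_map.
- by move=> i; case: ifP => _; apply: homv.
split=> [i|v /LDP/gen[p [q pqE]]|p p0].
- apply/LDP; case: ifP => _; rewrite vecb; apply/gen.
    exists 1, 0; rewrite /pair_comb !mul1r !mul0r !addr0; exact: surjective_pairing.
  exists 0, 1; rewrite /pair_comb !mul1r !mul0r !add0r; exact: surjective_pairing.
- exists (fun i => if i == 0 then p else q) => L LX.
  by rewrite sum2 /= !evLvec // evL // pqE pair_ev_comb.
have [p00 p10] : p 0 = 0 /\ p 1 = 0.
  apply: ind; have := p0 H HX; have := p0 G GX; rewrite !sum2 /= !evvec.
  rewrite Hx1 Hx2 Gx1 Gx2 !scale1r !scale0r !addr0 !add0r => E2 E1.
  by rewrite /pair_comb E1 E2.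
move=> i; have [->|i0] := eqVneq i 0; first by [].
suff -> : i = 1 by []; apply: val_inj; case: i i0 => [[|[]]] //=.
Qed.

Lemma form_homog H : l H \is 1.-homog.
Proof. exact: lf_homog. Qed.

Lemma form_pow_neq0 H d : H \in A -> l H ^+ d != 0.
Proof. by move=> HA; apply: expf_neq0; rewrite lf_eq0 (form_of_neq0 A_arr). Qed.

(** Let v be the element of degree d of a homogeneous basis, with coordinates p_j
    on the Theta_j.  If all p_j vanished at the origin, so would the coordinates
    along the constant fields, since v has positive degree; but v belongs to a
    basis.  If p_j does not vanish there and Theta_j had a degree other than d, the
    component of v in that degree would be zero and give a relation in which the
    coefficient of Theta_j is nonzero. *)
Lemma exponent_degree (B : {fset {vspace V}}) m k (Theta : 'I_k -> 'rV[S]_n) dg d :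
    arrangement B -> basis_mod_center B m Theta -> (forall i, homog_field (dg i) (Theta i)) ->
    is_exponent B m d -> (0 < d)%N ->
  exists i, dg i = d.
Proof.
move=> Barr Tb Th [N [theta [deg [thb thdeg [i0 degi0]]]]] d0.
have [theta' [th'A th'gen th'ind] thE] := module_log_basis Barr thb.
have [TA Tgen Tind] := Tb.
have homth a : ev a (theta' i0) \is d.-homog.
  by rewrite -der_lf -thE -degi0; apply: thdeg.
have [CA Cgen Cind] := basis_mod_center_complete Barr Tb.
have [c cE] := Cgen (theta' i0) (th'A i0).
pose p j := c (lshift _ j).
have evp H : H \in B -> ev (form_of H) (theta' i0) =
    \sum_j p j * ev (form_of H) (Theta j).
  move=> HB; rewrite cE complete_basis_sum evD !ev_sum [X in _ + X]big1 ?addr0 //.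
  move=> r _; rewrite ev_cst.
  have /mem_acenterP/(_ H HB) : tnth (vbasis (acenter B)) r \in acenter B.
    by apply: vbasis_mem; apply: mem_tnth.
  by rewrite (mem_hyp Barr) // => /eqP ->; rewrite mulr0.
have [j pj0] : exists j, mcoeff 0 (p j) != 0.
  apply: NNPP => np.
  have {}np j : mcoeff 0 (p j) = 0.
    by apply/eqP; apply: contraT => pj; case: np; exists j.
  have cst0 r : mcoeff 0 (c (rshift _ r)) = 0.
    pose T := acenter B.
    pose g : linform V := (linfun (coord (vbasis T) r : V -> K^o) \o projv T)%VF.
    have gE x : g x = coord (vbasis T) r (projv T x) by rewrite comp_lfunE lfunE.
    have tT r' : tnth (vbasis T) r' \in T by apply: vbasis_mem; apply: mem_tnth.
    have := homog_at0 (homth g) d0.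
    rewrite cE complete_basis_sum evD !ev_sum raddfD !raddf_sum /=.
    rewrite big1 => [|j _]; last by rewrite rmorphM /= np mul0r.
    rewrite add0r (bigD1 r) //= big1 ?addr0 => [|r' rr'].
      rewrite rmorphM /= ev_cst gE projv_id // (tnth_nth 0) coord_free ?free_vbasis //.
      by rewrite eqxx mpolyC1 rmorph1 mulr1.
    rewrite rmorphM /= ev_cst gE projv_id // (tnth_nth 0) coord_free ?free_vbasis //.
    by rewrite (negPf rr') mpolyC0 mcoeff0 mulr0.
  have all0 i : mcoeff 0 (c i) = 0.
    by rewrite -[i]splitK; case: (split i) => r /=; [apply: np|apply: cst0].
  have [r rE] := fin_all_exists (fun i => th'gen _ (CA i)).
  pose q k := \sum_i c i * r i k - (k == i0)%:R.
  have q0 : q i0 = 0.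
    apply: th'ind; rewrite /q; under eq_bigr do rewrite scalerBl scaler_suml.
    rewrite sumrB [X in _ - X](bigD1 i0) //= eqxx scale1r [X in _ - (_ + X)]big1 ?addr0.
      apply/eqP; rewrite subr_eq0 {1}cE exchange_big /=; apply/eqP/eq_bigr => i _.
      by rewrite rE scaler_sumr; apply: eq_bigr => k' _; rewrite scalerA.
    by move=> k' /negPf ->; rewrite scale0r.
  have := congr1 (mcoeff 0) q0; rewrite /q eqxx raddfB raddf_sum /= big1.
    by rewrite sub0r rmorph1 raddf0 => /eqP; rewrite oppr_eq0 oner_eq0.
  by move=> i _; rewrite rmorphM /= all0 mul0r.
exists j; apply/eqP; apply: contraNT pj0 => neq.
pose r i := if (dg i <= dg j)%N then pihomog mdeg (dg j - dg i) (p i) else 0.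
have : r j = 0.
  apply: Tind => H HB; have := congr1 (pihomog mdeg (dg j)) (evp H HB).
  rewrite (pihomog_ne0 _ (homth _)) 1?eq_sym // raddf_sum /= => E.
  apply: etrans (esym E); apply: eq_bigr => i _.
  by rewrite [p i * _]mulrC (pihomog_mul _ _ (Th i _)) mulrC.
by rewrite /r leqnn subnn pihomog0E => /eqP; rewrite mpolyC_eq0.
Qed.

Lemma exists_log_field_neq0 m X H : X \in flats A 2 -> H \in localization A X ->
  exists2 v, log_field (localization A X) m v & ev (form_of H) v != 0.
Proof.
move=> XA HX; have HA := loc_mem HX.
have [x Hx] := exists_dual (form_of_neq0 A_arr HA).
exists ((\prod_(L <- localization A X) l L ^+ m L) *: cst x).
  move=> L LX; rewrite evZ ev_cst (big_rem L) //=.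
  by exists (\prod_(y <- rem L (localization A X)) l y ^+ m y * (form_of L x)%:MP); ring.
rewrite evZ ev_cst Hx mpolyC1 mulr1 prodf_seq_neq0.
by apply/allP => L LX; apply: (form_pow_neq0 _ (loc_mem LX)).
Qed.

(** In rank two the degrees of the basis add up to at most the total multiplicity.
    If the element of degree m H is killed by the form of H, it is divisible by the
    powers of all other forms, which leaves degree at most m H to the other
    element; that one is not killed, hence has degree exactly m H. *)
Lemma exponent_unit_value m X H : X \in flats A 2 -> multiplicity A m ->
    H \in localization A X -> is_exponent (localization A X) m (m H) ->
  exists2 v, log_field (localization A X) m v & ev (form_of H) v = l H ^+ m H.
Proof.
move=> XA mpos HX Hexp; have HA := loc_mem HX.
have [Theta [dg [Tb Th dgN]]] := rank2_basis m XA.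
have [j dgj] := exponent_degree (@arr_loc X) Tb Th Hexp (mpos _ HA).
have [TA Tgen Tind] := Tb.
have unit_case i : dg i = m H -> ev (form_of H) (Theta i) != 0 ->
    exists2 v, log_field (localization A X) m v & ev (form_of H) v = l H ^+ m H.
  move=> dgi evn0; have [q qE] := TA i H HX.
  have := Th i (form_of H); rewrite dgi qE mulrC => hom.
  have qc := homog_const (homog_exp (m H) (form_homog H)) (form_pow_neq0 _ HA) hom.
  have q0 : mcoeff 0 q != 0.
    by apply: contraNneq evn0 => q0; rewrite qE qc q0 mpolyC0 mul0r.
  exists ((mcoeff 0 q)^-1%:MP *: Theta i); first exact: log_fieldZ.
  by rewrite evZ qE {2}qc mulrA -mpolyCM mulVf // mpolyC1 mul1r.
have [ev0|] := eqVneq (ev (form_of H) (Theta j)) 0; last exact: unit_case.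
pose j' : 'I_2 := if j == 0 then 1 else 0.
have sumj F : \sum_i F i = F j + F j' :> S.
  rewrite sum2 /j'; case: eqP => [-> //|j0]; suff -> : j = 1 by rewrite addrC.
  by apply: val_inj; case: j j0 {dgj ev0 j'} => [[|[]]] //= i0 []; apply: val_inj.
have dgjj : (dg j + dg j' <= \sum_(L <- localization A X) m L)%N.
  rewrite /j'; case: eqP dgN => [-> //|j0]; suff -> : j = 1 by rewrite addnC.
  by apply: val_inj; case: j j0 {dgj ev0 j' sumj} => [[|[]]] //= i0 []; apply: val_inj.
have evj' : ev (form_of H) (Theta j') != 0.
  have [v vLD] := exists_log_field_neq0 m XA HX; apply: contra => /eqP ev0'.
  have [p pE] := Tgen v vLD.
  by rewrite pE // sumj ev0 ev0' !mulr0 addr0.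
have [G [GX GH]] : exists G, G \in localization A X /\ G != H.
  have [H1 [H2 [H1X H2X neq _]]] := flat2P A_arr XA.
  have [E|] := eqVneq H1 H; last by exists H1.
  by exists H2; split=> //; rewrite -E eq_sym.
have evL L : L \in localization A X -> exists2 c : K, ev (form_of L) (Theta j) =
    c *: ev (form_of G) (Theta j) & L != H -> c != 0.
  move=> LX; have neq : H != G by rewrite eq_sym.
  have [p [E _ p2]] := flat_comb A_arr XA HX GX LX neq.
  by exists p.2 => //; rewrite E ev_comb ev0 scaler0 add0r.
have evG0 : ev (form_of G) (Theta j) != 0.
  apply/eqP => evG0.
  have /(_ j)/eqP : forall i, ((i == j)%:R : S) = 0.
    apply: Tind => L LX; rewrite sumj eqxx mul1r; have [c -> _] := evL L LX.
    rewrite evG0 scaler0 add0r /j'; case: (eqVneq j 0) => [->|j0]; first by rewrite mul0r.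
    by rewrite eq_sym (negPf j0) mul0r.
  by rewrite eqxx oner_eq0.
have uloc := fset_uniq (localization A X).
have dvd : exists q, ev (form_of G) (Theta j) =
    q * \prod_(L <- rem H (localization A X)) l L ^+ m L.
  apply: (@lf_prod_dvd _ _ _ _ (fun L => form_of L) m); first exact: rem_uniq.
  - by move=> L /mem_rem/loc_mem; apply: form_of_neq0.
  - move=> L L' /mem_rem/loc_mem LA /mem_rem/loc_mem L'A; exact: (form_indep A_arr LA L'A).
  move=> L; rewrite mem_rem_uniq // => /andP[LH LX].
  have [c cE /(_ LH) c0] := evL L LX; have [q qE] := TA j L LX.
  exists (c^-1 *: q); rewrite -scalerAl -qE cE scalerA mulVf // scale1r.
  by [].
have dgj_ge : (\sum_(L <- rem H (localization A X)) m L <= dg j)%N.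
  have [q qE] := dvd.
  apply: (@homog_deg_le _ _ _ _ (\prod_(L <- rem H (localization A X)) l L ^+ m L) q).
  - by apply: homog_prod => L _; apply/homog_exp/form_homog.
  - by rewrite mulrC -qE; apply: Th.
  by rewrite mulrC -qE.
have dgj'_ge : (m H <= dg j')%N.
  have [q qE] := TA j' H HX.
  apply: (@homog_deg_le _ _ _ _ (l H ^+ m H) q).
  - exact/homog_exp/form_homog.
  - by rewrite mulrC -qE; apply: Th.
  by rewrite mulrC -qE.
apply: (unit_case j') => //.
move: dgjj dgj_ge dgj'_ge; rewrite (big_rem H) //= dgj.
by move: (\sum_(L <- rem H _) m L)%N (dg j') (m H) => R d e; lia.
Qed.

(** Expanding psi in the homogeneous basis, the cofactor of some basis element at H
    does not vanish at the origin, so that element has degree m H. *)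
Lemma unit_value_exponent m X H : X \in flats A 2 ->
  H \in localization A X -> unit_value A m X H -> is_exponent (localization A X) m (m H).
Proof.
move=> XA HX [psi [u [psiLD psiH u0]]]; have HA := loc_mem HX.
have [Theta [dg [Tb Th _]]] := rank2_basis m XA.
have [TA Tgen Tind] := Tb; have [p pE] := Tgen psi psiLD.
have [q qE] := fin_all_exists (fun i => TA i H HX).
have uE : u = \sum_i p i * q i.
  apply: (mulIf (form_pow_neq0 (m H) HA)); rewrite -psiH pE // mulr_suml.
  by apply: eq_bigr => i _; rewrite qE mulrA.
have [j qj0] : exists j, mcoeff 0 (q j) != 0.
  apply: NNPP => nq; case/eqP: u0; rewrite uE raddf_sum /= big1 // => i _.
  rewrite rmorphM /= (_ : mcoeff 0 (q i) = 0) ?mulr0 //.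
  by apply/eqP; apply: contraT => qi; case: nq; exists i.
have dgj : dg j = m H.
  apply: (homog_unit_deg (homog_exp (m H) (form_homog H)) (form_pow_neq0 _ HA) _ qj0).
  by rewrite mulrC -qE; apply: Th.
exists (2 + \dim (acenter (localization A X)))%N,
  (fun i => der (complete_basis Theta i)),
  (fun i => if split i is inl i' then dg i' else 0%N); split.
- exact/log_basis_module/basis_mod_center_complete/Tb/arr_loc/arr_loc.
- move=> i a; rewrite -/(lf a) der_lf /complete_basis; case: (split i) => [i'|r].
    exact: Th.
  by rewrite ev_cst; apply: homogC.
exists (lshift _ j); by rewrite (unsplitK (inl j)).
Qed.
End Exponents.

(** * Adding a rank two flat along one hyperplane *)

Section Addition.
Variables (K : fieldType) (V : vectType K) (A : {fset {vspace V}}).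
Local Notation n := (\dim (fullv : {vspace V})).
Local Notation S := {mpoly K[n]}.
Local Notation l H := (lf (form_of H)).
Hypothesis A_arr : arrangement A.
Variable m : {vspace V} -> nat.
Implicit Types (X Y G H L : {vspace V}) (x y : V).

Definition free_mod_center (B : {fset {vspace V}}) : Prop :=
  exists k (Theta : 'I_k -> 'rV[S]_n), basis_mod_center B m Theta.

Lemma free_mod_center_free B : arrangement B -> free_mod_center B -> free_multiplicity B m.
Proof.
move=> Barr [k [Theta Tb]].
exists (k + \dim (acenter B))%N, (fun i => der (complete_basis Theta i)).
exact/log_basis_module/basis_mod_center_complete/Tb.
Qed.

Lemma flat_ev_eq0 X H G L v : X \in flats A 2 -> H \in localization A X ->
    G \in localization A X -> L \in localization A X -> H != G ->
    ev (form_of H) v = 0 -> ev (form_of G) v = 0 -> ev (form_of L) v = 0.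
Proof.
move=> XA HX GX LX neq vH vG; have [p [-> _ _]] := flat_comb A_arr XA HX GX LX neq.
by rewrite ev_comb vH vG !scaler0 addr0.
Qed.

(** A field Theta on B takes at H a value g alpha_H^(m H); adding a multiple of
    the direction xi, invisible on B, makes it agree with g psi at X.  What remains
    is the kernel of the restriction to B, consisting of the multiples of xi by the
    product of the powers of the forms through X other than H. *)
Lemma free_mod_center_add_flat B X H xi psi : B `<=` A -> X \in flats A 2 ->
    H \in localization A X ->
    (forall G, G \in localization A X -> (G \in B) = (G == H)) ->
    (forall G, G \in B -> form_of G xi = 0) ->
    (exists2 G, G \in localization A X & form_of G xi != 0) ->
    log_field (localization A X) m psi -> ev (form_of H) psi = l H ^+ m H ->
  free_mod_center B -> free_mod_center (B `|` localization A X).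
Proof.
move=> BA XA HX BX xiB [G GX xiG] psiLD psiH [k [Theta [TB Tgen Tind]]].
have HB : H \in B by rewrite BX.
have neq : H != G by apply: contraNneq xiG => <-; rewrite xiB.
have BAin L : L \in B -> L \in A by move/(fsubsetP BA).
set d := form_of G xi in xiG.
have dK : (d^-1)%:MP * d%:MP = 1 :> S by rewrite -mpolyCM mulVf ?mpolyC1.
pose P := \prod_(L <- rem H (localization A X)) l L ^+ m L.
have uloc := fset_uniq (localization A X).
have P0 : P != 0.
  rewrite prodf_seq_neq0; apply/allP => L /mem_rem/loc_mem LA.
  exact: (form_pow_neq0 A_arr _ LA).
have [g gE] := fin_all_exists (fun j => TB j H HB).
pose h j := (d^-1)%:MP * (g j * ev (form_of G) psi - ev (form_of G) (Theta j)).
pose Th j := Theta j + h j *: cst xi.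
have ThB j L : L \in B -> ev (form_of L) (Th j) = ev (form_of L) (Theta j).
  by move=> LB; rewrite evD evZ ev_cst xiB // mpolyC0 mulr0 addr0.
have ThX j L : L \in localization A X -> ev (form_of L) (Th j) = g j * ev (form_of L) psi.
  move=> LX; apply/eqP; rewrite -subr_eq0 -evZ -evB; apply/eqP.
  apply: (flat_ev_eq0 XA HX GX LX neq).
    by rewrite evB evZ ThB // gE psiH subrr.
  rewrite evB evD !evZ ev_cst -/d /h.
  transitivity ((d^-1%:MP * d%:MP - 1) *
    (g j * ev (form_of G) psi - ev (form_of G) (Theta j))); first by ring.
  by rewrite dK subrr mul0r.
pose last := P *: cst xi.
have lastB L : L \in B -> ev (form_of L) last = 0.
  by move=> LB; rewrite evZ ev_cst xiB // mpolyC0 mulr0.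
pose Theta' (i : 'I_k.+1) := if unlift ord0 i is Some j then Th j else last.
have sum' (p : 'I_k.+1 -> S) L : \sum_i p i * ev (form_of L) (Theta' i) =
    p ord0 * ev (form_of L) last + \sum_j p (lift ord0 j) * ev (form_of L) (Th j).
  rewrite big_ord_recl /Theta' unlift_none; congr (_ + _).
  by apply: eq_bigr => j _; rewrite liftK.
have lastLD : log_field (B `|` localization A X) m last.
  move=> L; rewrite inE; have [LB _|LB /= LX] := boolP (L \in B).
    by exists 0; rewrite lastB // mul0r.
  have LH : L != H by rewrite -BX.
  have LR : L \in rem H (localization A X) by rewrite mem_rem_uniq // inE LH.
  rewrite evZ ev_cst /P (big_rem L) //=.
  by exists (\prod_(y <- rem L (rem H (localization A X))) l y ^+ m y * (form_of L xi)%:MP); ring.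
have ThLD j : log_field (B `|` localization A X) m (Th j).
  move=> L; rewrite inE; have [LB _|LB /= LX] := boolP (L \in B).
    by rewrite ThB //; apply: TB.
  have [q qE] := psiLD L LX; exists (g j * q).
  by rewrite ThX // qE mulrA.
exists k.+1, Theta'; split=> [i|v vLD|p p0].
- by rewrite /Theta'; case: unlift.
- have [|p pE] := Tgen v; first by apply: log_fieldS vLD; apply: fsubsetUl.
  pose u := v - \sum_j p j *: Th j.
  have uB L : L \in B -> ev (form_of L) u = 0.
    move=> LB; rewrite evB ev_sum pE // -sumrB big1 // => j _.
    by rewrite ThB // subrr.
  have uLD : log_field (B `|` localization A X) m u.
    rewrite /u -scaleN1r; apply: log_fieldD => //; apply: log_fieldZ.
    exact: log_field_sum.
  have [r rE] : exists r, ev (form_of G) u = r * P.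
    apply: (@lf_prod_dvd _ _ _ _ (fun L => form_of L) m); first exact: rem_uniq.
    - by move=> L /mem_rem/loc_mem; apply: form_of_neq0.
    - move=> L L' /mem_rem/loc_mem LA /mem_rem/loc_mem L'A.
      exact: (form_indep A_arr LA L'A).
    move=> L; rewrite mem_rem_uniq // => /andP[LH LX].
    have [c [E _ /(_ LH) c0]] := flat_comb A_arr XA HX GX LX neq.
    have [|q] := uLD L; first by rewrite inE LX orbT.
    rewrite {1}E ev_comb uB // scaler0 add0r => qE.
    by exists (c.2^-1 *: q); rewrite -scalerAl -qE scalerA mulVf // scale1r.
  exists (fun i => if unlift ord0 i is Some j then p j else (d^-1)%:MP * r) => L.
  rewrite sum' unlift_none => LC.
  have -> : \sum_j (if unlift ord0 (lift ord0 j) is Some j0 then p j0 else d^-1%:MP * r) *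
      ev (form_of L) (Th j) = ev (form_of L) v - ev (form_of L) u.
    rewrite evB ev_sum opprB addrCA subrr addr0.
    by apply: eq_bigr => j _; rewrite liftK.
  apply/eqP; rewrite addrC -subr_eq0 opprD addrA opprB addrCA subrr addr0.
  rewrite -evZ -evB; apply/eqP.
  case: (boolP (L \in B)) LC => [LB _|LB].
    by rewrite evB evZ uB // lastB // mulr0 subrr.
  rewrite inE (negPf LB) /= => LX; apply: (flat_ev_eq0 XA HX GX LX neq).
    by rewrite evB evZ uB // lastB // mulr0 subrr.
  rewrite evB !evZ rE ev_cst -/d.
  transitivity (r * P * (1 - d^-1%:MP * d%:MP)); first by ring.
  by rewrite dK subrr mulr0.
have pl j : p (lift ord0 j) = 0.
  apply: (Tind (fun j => p (lift ord0 j))) => L LB.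
  have := p0 L; rewrite inE LB sum' lastB // mulr0 add0r => /(_ isT) E.
  by apply: etrans E; apply: eq_bigr => i _; rewrite ThB.
have pz : p ord0 = 0.
  have := p0 G; rewrite inE GX orbT sum' big1 => [/(_ isT)/eqP|j _]; last by rewrite pl mul0r.
  rewrite addr0 evZ ev_cst !mulf_eq0 (negPf P0) mpolyC_eq0 (negPf xiG) !orbF.
  by move/eqP.
move=> i; case: (unliftP ord0 i) => [j|] -> //.
Qed.

(** The rank grows by one at each step, which provides a vector xi in the centre of
    F i and outside that of the next step. *)
Lemma free_of_order (X : nat -> {vspace V}) (F : nat -> {fset {vspace V}})
    (H : nat -> {vspace V}) : (3 <= rank A)%N -> multiplicity A m ->
    (forall i, (1 <= i <= (rank A).-1)%N -> X i \in flats A 2) ->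
    F (rank A) = A -> (forall i, (1 <= i <= rank A)%N -> rank (F i) = i) ->
    F 2 = localization A (X 1%N) ->
    (forall i, (3 <= i <= rank A)%N -> F i = F i.-1 `|` localization A (X i.-1)) ->
    (forall i, (1 <= i <= (rank A).-1)%N ->
       H i \in A /\ localization A (X i) `&` F i = [fset H i]) ->
    (forall i, (2 <= i <= (rank A).-1)%N ->
       is_exponent (localization A (X i)) m (m (H i))) ->
  free_multiplicity A m.
Proof.
move=> rA mpos XA FA Fr F2 FS FH Fexp.
have FsubA i : (2 <= i <= rank A)%N -> F i `<=` A.
  case/andP; elim: i => // i IH; rewrite leq_eqVlt => /orP[/eqP <- _|i2 ir].
    by rewrite F2 loc_sub.
  by rewrite FS ?i2 //= fsubUset loc_sub andbT IH // ltnW.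
suff main i : (2 <= i <= rank A)%N -> free_mod_center (F i).
  by apply: free_mod_center_free => //; rewrite -FA; apply: main; lia.
case/andP; elim: i => // i IH; rewrite leq_eqVlt => /orP[/eqP <- _|i2 ir].
  have [|Theta [dg [Tb _ _]]] := rank2_basis A_arr m (X := X 1%N).
    by apply: XA; lia.
  by rewrite F2; exists 2%N, Theta.
rewrite FS ?i2 //=.
have ib : (1 <= i <= (rank A).-1)%N by lia.
have [HiA locF] := FH i ib.
have locP G : (G \in localization A (X i)) && (G \in F i) = (G == H i).
  by have := congr1 (fun B => G \in B) locF; rewrite /= in_fsetI in_fset1.
have /andP[HiX HiF] : (H i \in localization A (X i)) && (H i \in F i).
  by rewrite locP.
have [xi xiF xiN] : exists2 xi, xi \in acenter (F i) & xi \notin acenter (F i.+1).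
  apply: NNPP => nx; have : (acenter (F i) <= acenter (F i.+1))%VS.
    apply/subvP => x xF; apply/negPn/negP => xN; apply: nx; by exists x.
  by move/codimS; rewrite -/(rank _) -/(rank (F i)) !Fr; lia.
have FiA : F i `<=` A by apply: FsubA; lia.
have [psi psiLD psiH] : exists2 v, log_field (localization A (X i)) m v &
    ev (form_of (H i)) v = l (H i) ^+ m (H i).
  by apply: (exponent_unit_value A_arr (XA i ib) mpos HiX); apply: Fexp; lia.
apply: (free_mod_center_add_flat FiA (XA i ib) HiX _ _ _ psiLD psiH).
- by move=> G GX; rewrite -locP GX.
- move=> G GF; apply/eqP; rewrite -(mem_hyp A_arr) ?(fsubsetP FiA) //.
  by have /mem_acenterP := xiF; apply.
- apply: NNPP => nG; case/negP: xiN; apply/mem_acenterP => G.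
  rewrite FS ?i2 //= inE => /orP[GF|GX].
    by have /mem_acenterP := xiF; apply.
  rewrite (mem_hyp A_arr) ?(loc_mem GX) //.
  by apply: contraT => Gxi; case: nG; exists G.
by apply: IH => //; apply: ltnW.
Qed.
End Addition.

(** * Systems of points and lines that form a tree *)

Lemma fproper_intro (T : choiceType) (B C : {fset T}) :
  (forall x, x \in B -> x \in C) -> (exists2 x, x \in C & x \notin B) -> B `<` C.
Proof.
move=> BC [x xC xB]; rewrite fproperE; apply/andP; split; first exact/fsubsetP.
by apply: contra xB => /fsubsetP/(_ x xC).
Qed.

Section TreeLikeLines.
Variables (T : choiceType) (A L : {fset T}) (loc : T -> {fset T}).
Implicit Types (C : T -> Prop) (X Y G H : T).

(** The elements of A are called points and those of L lines, loc X being the set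
    of points on X.  Connected components of the incidence graph are encoded by the
    predicates that do not separate the points of any line. *)
Definition uniform C X : Prop := forall G H, G \in loc X -> H \in loc X -> C G -> C H.

Variable side : T -> T -> {fset T}.
Hypothesis loc_sub : forall X, loc X `<=` A.
Hypothesis loc_third : forall X G H, X \in L ->
  exists K, [/\ K \in loc X, K != G & K != H].
Hypothesis connected : forall C, (forall X, X \in L -> uniform C X) ->
  forall G, G \in A -> C G -> forall H, H \in A -> C H.
Hypothesis side_sub : forall X H, side X H `<=` A.
(** The bridge property: side X H is the component of H once the edge (X, H) is
    removed. *)
Hypothesis side_uniform : forall X H, X \in L -> H \in loc X ->
  forall Y, Y \in L -> Y != X -> uniform (fun G => G \in side X H) Y.
Hypothesis side_self : forall X H, X \in L -> H \in loc X ->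
  forall G, G \in loc X -> (G \in side X H) = (G == H).

Lemma locA X G : G \in loc X -> G \in A.
Proof. exact: (fsubsetP (loc_sub X)). Qed.

Lemma uniform_empty C : (forall X, X \in L -> uniform C X) ->
  forall H, H \in A -> ~ C H -> forall G, G \in A -> ~ C G.
Proof. by move=> uC H HA nH G GA CG; apply: nH; apply: connected CG H HA. Qed.

Lemma loc_point X : X \in L -> exists G, G \in loc X.
Proof.
by move=> XL; have [K [KX _ _]] := loc_third X X XL; exists K.
Qed.

Lemma loc_other X H : X \in L -> exists2 G, G \in loc X & G != H.
Proof. by move=> XL; have [G [GX GH _]] := loc_third H H XL; exists G. Qed.

(** The line X0 is seen from X in the direction of H, so that in the orientation
    away from the root X0 the edge between X and H points to X. *)
Definition toward X0 X H : bool := (X0 != X) && (loc X0 `<=` side X H).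

Lemma towardP X0 X H : toward X0 X H ->
  X0 <> X /\ forall G, G \in loc X0 -> G \in side X H.
Proof. by case/andP => /eqP ? /fsubsetP. Qed.

Lemma toward_intro X0 X H G : X0 \in L -> X \in L -> H \in loc X -> X0 != X ->
  G \in loc X0 -> G \in side X H -> toward X0 X H.
Proof.
move=> X0L XL HX neq GX0 Gs; rewrite /toward neq; apply/fsubsetP => K KX0.
exact: (side_uniform XL HX X0L neq GX0 KX0 Gs).
Qed.

Lemma not_toward X0 X H : X0 \in L -> X \in L -> H \in loc X -> ~~ toward X0 X H ->
  X0 = X \/ forall G, G \in loc X0 -> G \notin side X H.
Proof.
move=> X0L XL HX nt; have [->|neq] := eqVneq X0 X; [by left|right].
by move=> G GX0; apply: contra nt => Gs; apply: toward_intro Gs.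
Qed.

(** The intersection of the two sides does not separate the points of any line and
    avoids H, hence is empty. *)
Lemma toward_uniq X0 X H H' : X0 \in L -> X \in L -> H \in loc X -> H' \in loc X ->
  toward X0 X H -> toward X0 X H' -> H = H'.
Proof.
move=> X0L XL HX H'X /towardP[_ sH] /towardP[_ sH']; apply/eqP/negPn/negP => neq.
have [G GX0] := loc_point X0L.
pose C G := G \in side X H /\ G \in side X H'.
apply: (@uniform_empty C _ H (locA HX) _ G (locA GX0)).
- move=> Y YL G1 G2 G1Y G2Y [C1 C2]; have [E|YX] := eqVneq Y X.
    rewrite E in G1Y; move: C1 C2; rewrite !side_self // => /eqP-> /eqP E'.
    by case/eqP: neq.
  by split; [apply: (side_uniform XL HX YL YX G1Y)|apply: (side_uniform XL H'X YL YX G1Y)].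
- by case=> _; rewrite side_self // (negPf neq).
by split; [apply: sH|apply: sH'].
Qed.

(** Otherwise X0 lies in the complement of both sides; that complement separates no
    line and avoids H. *)
Lemma toward_one X0 X X' H : X0 \in L -> X \in L -> X' \in L ->
  H \in loc X -> H \in loc X' -> X != X' -> ~~ toward X0 X H -> toward X0 X' H.
Proof.
move=> X0L XL X'L HX HX' neq nt.
have neq' : X' != X by rewrite eq_sym.
case: (not_toward X0L XL HX nt) => [->|sX].
  by apply: (toward_intro XL X'L HX' neq HX); rewrite side_self.
apply: contraT => nt'; case: (not_toward X0L X'L HX' nt') => [E|sX'].
  by have := sX H; rewrite E => /(_ HX'); rewrite side_self // eqxx.
have [G GX0] := loc_point X0L.
pose C G := G \notin side X H /\ G \notin side X' H.
case: (@uniform_empty C _ H (locA HX) _ G (locA GX0)) => //.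
- have half Z Z' G1 G2 : Z \in L -> Z' \in L -> H \in loc Z -> H \in loc Z' -> Z != Z' ->
      G1 \in loc Z -> G2 \in loc Z -> G1 \notin side Z' H -> False.
    move=> ZL Z'L HZ HZ' ZZ' G1Z G2Z /negP; apply.
    by apply: (side_uniform Z'L HZ' ZL ZZ' HZ G1Z); rewrite side_self.
  move=> Y YL G1 G2 G1Y G2Y [C1 C2].
  have [E|YX] := eqVneq Y X.
    by rewrite E in G1Y G2Y; case: (half X X' G1 G2).
  have [E|YX'] := eqVneq Y X'.
    by rewrite E in G1Y G2Y; case: (half X' X G1 G2).
  split; [apply: contra C1|apply: contra C2].
    exact: (side_uniform XL HX YL YX G2Y G1Y).
  exact: (side_uniform X'L HX' YL YX' G2Y G1Y).
- by case; rewrite side_self // eqxx.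
by split; [apply: sX|apply: sX'].
Qed.

(** The sides at the points of X cover everything. *)
Lemma toward_exists X0 X : X0 \in L -> X \in L -> X0 != X ->
  exists2 H, H \in loc X & toward X0 X H.
Proof.
move=> X0L XL neq; apply: NNPP => nH.
have [G GX0] := loc_point X0L; have [H HX] := loc_point XL.
pose C G := exists2 K, K \in loc X & G \in side X K.
have [] : C G.
  apply: (@connected C _ H (locA HX) _ G (locA GX0)).
    move=> Y YL G1 G2 G1Y G2Y [K KX Ks]; have [E|YX] := eqVneq Y X.
      by rewrite E in G2Y; exists G2 => //; rewrite side_self.
    by exists K => //; apply: (side_uniform XL KX YL YX G1Y).
  by exists H => //; rewrite side_self.
move=> K KX Gs; apply: nH; exists K => //.
exact: toward_intro GX0 Gs.
Qed.

(** If all lines through H saw X0 in the direction of H, the points other than H on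
    all the corresponding sides would form a union of components. *)
Lemma not_toward_exists X0 H : X0 \in L -> H \in A ->
  exists X, [/\ X \in L, H \in loc X & ~~ toward X0 X H].
Proof.
move=> X0L HA; apply: NNPP => nX.
have tow X : X \in L -> H \in loc X -> toward X0 X H.
  by move=> XL HX; apply: contraT => nt; case: nX; exists X.
have [G GX0 GH] := loc_other H X0L.
pose C G := G <> H /\ forall X, X \in L -> H \in loc X -> G \in side X H.
apply: (@uniform_empty C _ H HA _ G (locA GX0)).
- move=> Y YL G1 G2 G1Y G2Y [G1H C1].
  have [HY|HY] := boolP (H \in loc Y).
    by have := C1 Y YL HY; rewrite side_self // => /eqP.
  split=> [E|X XL HX]; first by rewrite -E G2Y in HY.
  have YX : Y != X by apply: contraNneq HY => ->.
  by apply: (side_uniform XL HX YL YX G1Y G2Y); apply: C1.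
- by case.
split=> [|X XL HX]; first exact/eqP.
by have [_] := towardP (tow X XL HX); apply.
Qed.

Section Root.
Variable good : T -> T -> Prop.
(** From a bad flag (X1, H1) one gets a set Z of points containing H1 that
    spreads, away from X1, along the good flags and only along these. *)
Hypothesis spread : forall X1 H1, X1 \in L -> H1 \in loc X1 -> ~ good X1 H1 ->
  exists Z : T -> Prop, Z H1 /\ forall Y G, Y \in L -> Y != X1 -> G \in loc Y -> Z G ->
    good Y G /\ forall G', G' \in loc Y -> good Y G' -> Z G'.

(** Two bad flags facing each other: walk from H1 towards X.  As long as the flags
    entering the lines of the walk are good the set Z spreads along it; at a bad one
    we get another pair facing each other with a smaller side, and induction
    applies.  If the walk reaches X, it does so through H, so that H lies in Z and
    (X, H) is good. *)
Lemma no_facing_bad X H : X \in L -> H \in loc X -> ~ good X H ->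
  forall X1 H1, X1 \in L -> H1 \in loc X1 -> ~ good X1 H1 ->
  toward X X1 H1 -> toward X1 X H -> False.
Proof.
move=> XL HX badX X1 H1.
have [N] := ubnP #|` side X1 H1|.
elim: N X1 H1 => // N IHN X1 H1 cN X1L H1X1 bad1 tX tX1.
have [Z [ZH1 Zspread]] := spread X1L H1X1 bad1.
have [/eqP XX1 sX] := towardP tX; have [/eqP X1X sX1] := towardP tX1.
have [P PX] := loc_point XL; have [Q QX1] := loc_point X1L.
(* the walk has reached G in Z and continues along the line Y, on the side of X *)
have walk M Y G : (#|` A| - #|` side Y G| < M)%N -> Y \in L -> G \in loc Y ->
    Y != X1 -> Z G -> (forall K, K \in loc X1 -> K \in side Y G) ->
    ~~ toward X Y G -> False.
  elim: M Y G => // M IHM Y G cM YL GY YX1 ZG sY ntY.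
  have X1Y : X1 != Y by rewrite eq_sym.
  have tX1Y : toward X1 Y G by apply: (toward_intro _ _ _ _ QX1) => //; apply: sY.
  case: (not_toward XL YL GY ntY) => [E|dX].
    subst Y; have E := toward_uniq X1L XL GY HX tX1Y tX1; subst G.
    by have [] := Zspread X H XL XX1 HX ZG.
  have XY : X != Y.
    by apply/eqP => E; have := dX G; rewrite E => /(_ GY); rewrite side_self // eqxx.
  have YX : Y != X by rewrite eq_sym.
  have [G' G'Y tG'] := toward_exists XL YL XY.
  have [_ sG'] := towardP tG'.
  have GG' : G' != G by apply: contraNneq (dX P PX) => <-; apply: sG'.
  have dX1 K : K \in loc X1 -> K \notin side Y G'.
    move=> KX1; apply/negP => Ks; have := toward_intro X1L YL G'Y X1Y KX1 Ks.
    by move/(toward_uniq X1L YL G'Y GY)/(_ tX1Y)/eqP; rewrite (negPf GG').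
  have YsX K : K \in loc Y -> K \in side X H.
    move=> KY; apply: contraT => Kn.
    have dY K' : K' \in loc Y -> K' \notin side X H.
      by move=> K'Y; apply: contra Kn; apply: (side_uniform XL HX YL YX K'Y KY).
    pose C K := K \in side X H /\ K \in side Y G.
    case: (@uniform_empty C _ P (locA PX) _ Q (locA QX1)).
    - move=> W WL G1 G2 G1W G2W [C1 C2].
      have [E|WX] := eqVneq W X; first by rewrite E in G1W; have := dX _ G1W; rewrite C2.
      have [E|WY] := eqVneq W Y; first by rewrite E in G1W; have := dY _ G1W; rewrite C1.
      by split; [apply: (side_uniform XL HX WL WX G1W)|apply: (side_uniform YL GY WL WY G1W)].
    - by case=> _; apply/negP/dX.
    by split; [apply: sX1|apply: sY].
  have YsX1 K : K \in loc Y -> K \in side X1 H1.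
    move=> KY; apply: contraT => Kn.
    have dY K' : K' \in loc Y -> K' \notin side X1 H1.
      by move=> K'Y; apply: contra Kn; apply: (side_uniform X1L H1X1 YL YX1 K'Y KY).
    pose C K := K \in side X1 H1 /\ K \in side Y G'.
    case: (@uniform_empty C _ G (locA GY) _ P (locA PX)).
    - move=> W WL G1 G2 G1W G2W [C1 C2].
      have [E|WX1] := eqVneq W X1; first by rewrite E in G1W; have := dX1 _ G1W; rewrite C2.
      have [E|WY] := eqVneq W Y; first by rewrite E in G1W; have := dY _ G1W; rewrite C1.
      split; first exact: (side_uniform X1L H1X1 WL WX1 G1W).
      exact: (side_uniform YL G'Y WL WY G1W).
    - by case=> + _; apply/negP/dY.
    by split; [apply: sX|apply: sG'].
  have subG' : side Y G' `<` side X1 H1.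
    apply: fproper_intro => [K Ks|]; last first.
      exists G; first exact: YsX1.
      by rewrite side_self // eq_sym.
    apply: contraT => Kn; pose C K := K \in side Y G' /\ K \notin side X1 H1.
    case: (@uniform_empty C _ G (locA GY) _ K (fsubsetP (side_sub _ _) _ Ks)) => //.
    - move=> W WL G1 G2 G1W G2W [C1 C2].
      have [E|WX1] := eqVneq W X1; first by rewrite E in G1W; have := dX1 _ G1W; rewrite C1.
      have [E|WY] := eqVneq W Y; first by rewrite E in G1W; rewrite YsX1 in C2.
      split; first exact: (side_uniform YL G'Y WL WY G1W).
      by apply: contra C2; apply: (side_uniform X1L H1X1 WL WX1 G2W).
    by case=> _; rewrite YsX1.
  have goodG' : good Y G'.
    apply: NNPP => bad; apply: (IHN Y G') => //.
      by apply: leq_trans (fproper_ltn_card subG') _; rewrite -ltnS.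
    by rewrite /toward YX; apply/fsubsetP.
  have ZG' : Z G' by have [_] := Zspread Y G YL YX1 GY ZG; apply.
  have [Y' [Y'L G'Y' ntY']] := not_toward_exists XL (locA G'Y).
  have Y'Y : Y' != Y by apply: contraNneq ntY' => ->.
  have YY' : Y != Y' by rewrite eq_sym.
  have YsY' K : K \in loc Y -> K \in side Y' G'.
    by move=> KY; apply: (side_uniform Y'L G'Y' YL YY' G'Y KY); rewrite side_self.
  have dY' K : K \in loc Y' -> K \notin side Y G.
    move=> KY'; apply/negP => Ks; have := side_uniform YL GY Y'L Y'Y KY' G'Y' Ks.
    by rewrite side_self // (negPf GG').
  have subGG' : side Y G `<` side Y' G'.
    apply: fproper_intro => [K Ks|]; last first.
      by exists G'; rewrite ?dY' // side_self.
    apply: contraT => Kn; pose C K := K \in side Y G /\ K \notin side Y' G'.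
    case: (@uniform_empty C _ G' (locA G'Y) _ K (fsubsetP (side_sub _ _) _ Ks)) => //.
    - move=> W WL G1 G2 G1W G2W [C1 C2].
      have [E|WY] := eqVneq W Y; first by rewrite E in G1W; rewrite YsY' in C2.
      have [E|WY'] := eqVneq W Y'; first by rewrite E in G1W; have := dY' _ G1W; rewrite C1.
      split; first exact: (side_uniform YL GY WL WY G1W).
      by apply: contra C2; apply: (side_uniform Y'L G'Y' WL WY' G2W).
    by case=> _; rewrite side_self // eqxx.
  have sX1Y' K : K \in loc X1 -> K \in side Y' G'.
    by move=> KX1; apply: (fsubsetP (fproper_sub subGG')); apply: sY.
  apply: (IHM Y' G') => //.
    move: cM (fproper_ltn_card subGG') (fsubset_leq_card (side_sub Y' G')).
    by move: #|` A| #|` side Y G| #|` side Y' G'|; clear; lia.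
  apply/eqP => E; have [K KX1 KG'] := loc_other G' X1L.
  have G'X1 : G' \in loc X1 by rewrite -E.
  by have := sX1Y' K KX1; rewrite E (side_self X1L G'X1 KX1) (negPf KG').
have [Y [YL H1Y ntY]] := not_toward_exists XL (locA H1X1).
have YX1 : Y != X1 by apply: contraNneq ntY => ->.
apply: (walk _ Y H1 (ltnSn _)) => // K KX1.
have X1Y : X1 != Y by rewrite eq_sym.
by apply: (side_uniform YL H1Y X1L X1Y H1X1 KX1); rewrite side_self.
Qed.

(** Take for root the line of a bad flag with the largest side: a bad flag seen in
    the wrong direction from it would either face it or have a larger side. *)
Lemma exists_root X0 : X0 \in L -> exists2 R, R \in L &
  forall X H, X \in L -> H \in loc X -> toward R X H -> good X H.
Proof.
move=> X0L.
suff main N X1 H1 : (#|` A| - #|` side X1 H1| < N)%N -> X1 \in L -> H1 \in loc X1 ->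
    ~ good X1 H1 -> exists2 R, R \in L &
    forall X H, X \in L -> H \in loc X -> toward R X H -> good X H.
  have [[X1 [H1 [X1L H1X1 bad]]]|none] :=
    classic (exists X1 H1, [/\ X1 \in L, H1 \in loc X1 & ~ good X1 H1]).
    exact: main (ltnSn _) X1L H1X1 bad.
  exists X0 => // X H XL HX _; apply: NNPP => bad; apply: none.
  by exists X, H.
elim: N X1 H1 => // N IH X1 H1 cN X1L H1X1 bad1.
have [[X [H [XL HX tX1 bad]]]|none] :=
    classic (exists X H, [/\ X \in L, H \in loc X, toward X1 X H & ~ good X H]); last first.
  exists X1 => // X H XL HX tX1; apply: NNPP => bad; apply: none.
  by exists X, H.
have [/eqP X1X sX1] := towardP tX1; have XX1 : X != X1 by rewrite eq_sym.
have [tX|ntX] := boolP (toward X X1 H1).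
  by case: (no_facing_bad XL HX bad X1L H1X1 bad1).
case: (not_toward XL X1L H1X1 ntX) => [E|dX]; first by rewrite E eqxx in XX1.
apply: (IH X H) => //; have sub : side X1 H1 `<` side X H.
  apply: fproper_intro => [K Ks|]; last first.
    have [G GX1 GH1] := loc_other H1 X1L; exists G; first exact: sX1.
    by rewrite side_self.
  apply: contraT => Kn; pose C K := K \in side X1 H1 /\ K \notin side X H.
  case: (@uniform_empty C _ H (locA HX) _ K (fsubsetP (side_sub _ _) _ Ks)) => //.
  - move=> W WL G1 G2 G1W G2W [C1 C2].
    have [E|WX1] := eqVneq W X1; first by rewrite E in G1W; rewrite sX1 in C2.
    have [E|WX] := eqVneq W X; first by rewrite E in G1W; have := dX _ G1W; rewrite C1.
    split; first exact: (side_uniform X1L H1X1 WL WX1 G1W).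
    by apply: contra C2; apply: (side_uniform XL HX WL WX G2W).
  by case=> _; rewrite side_self // eqxx.
move: cN (fproper_ltn_card sub) (fsubset_leq_card (side_sub X H)).
by move: #|` A| #|` side X1 H1| #|` side X H|; clear; lia.
Qed.
End Root.

Section Growth.
Variables (X0 : T) (enters : T -> T -> Prop).
Hypothesis X0L : X0 \in L.
Hypothesis enters_uniq : forall X H H', enters X H -> enters X H' -> H = H'.
Hypothesis enters_one : forall X X' H, X \in L -> X' \in L -> H \in loc X ->
  H \in loc X' -> X != X' -> ~ enters X H -> enters X' H.
Hypothesis enters_root : forall H, ~ enters X0 H.

Definition covered (s : seq T) H : Prop := exists2 Y, Y \in s & H \in loc Y.

(** Orderings that start at the root and add at each step a line entered through
    a point already covered. *)
Inductive grown : seq T -> Prop :=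
| grown1 : grown [:: X0]
| grownS s X H : grown s -> X \in L -> X \notin s -> H \in loc X -> covered s H ->
    enters X H -> grown (rcons s X).

Lemma covered_rcons s X G : covered (rcons s X) G <-> covered s G \/ G \in loc X.
Proof.
split=> [[Y]|[[Y Ys GY]|GX]].
- by rewrite mem_rcons inE => /orP[/eqP->|Ys GY]; [right|left; exists Y].
- by exists Y; rewrite // mem_rcons inE Ys orbT.
by exists X; rewrite // mem_rcons mem_head.
Qed.

Lemma grown_sub s X : grown s -> X \in s -> X \in L.
Proof.
elim=> [|s' Y H _ IH YL _ _ _ _]; first by rewrite inE => /eqP->.
by rewrite mem_rcons inE => /orP[/eqP->|/IH].
Qed.

Lemma grown_uniq s : grown s -> uniq s.
Proof. by elim=> [//|s' Y H _ us _ Ys _ _ _]; rewrite rcons_uniq Ys. Qed.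

Lemma grown_root s : grown s -> X0 \in s.
Proof. by elim=> [|s' Y H _ IH _ _ _ _ _]; rewrite ?mem_head // mem_rcons inE IH orbT. Qed.

(** The union of the lines of s is connected. *)
Lemma grown_connected s C : grown s -> (forall Y, Y \in s -> uniform C Y) ->
  forall G H, covered s G -> covered s H -> C G -> C H.
Proof.
elim=> [|s' Y K _ IH YL _ KY Ks' _] uC.
  by move=> G H [Y + GY] [Y' +  HY']; rewrite !inE => /eqP E /eqP E'; subst;
    apply: (uC X0); rewrite // mem_head.
have uC' Z : Z \in s' -> uniform C Z by move=> Zs; apply: uC; rewrite mem_rcons inE Zs orbT.
have uY : uniform C Y by apply: uC; rewrite mem_rcons mem_head.
have toK G : covered (rcons s' Y) G -> (C G -> C K) /\ (C K -> C G).
  case/covered_rcons => [Gs|GY]; first by split; apply: IH.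
  by split; apply: uY.
by move=> G H /toK[GK _] /toK[_ KH] /GK/KH.
Qed.

(** A second common point would be joined to H inside s, although (X, H) is a
    bridge. *)
Lemma grown_attach s X H : grown s -> X \in L -> X \notin s -> H \in loc X -> covered s H ->
  forall G, G \in loc X -> covered s G <-> G = H.
Proof.
move=> gs XL Xs HX Hs G GX; split=> [cG|-> //].
apply/eqP; rewrite -(side_self XL HX GX).
apply: (@grown_connected s (fun K => K \in side X H) gs _ H G Hs cG); last by rewrite side_self.
move=> Y Ys; apply: (side_uniform XL HX) (grown_sub gs Ys) _.
by apply: contraNneq Xs => <-.
Qed.

(** The first line of s through H is not entered through H: it is entered through a
    point covered before. *)
Lemma grown_first s H : grown s -> covered s H ->
  exists Y, [/\ Y \in s, H \in loc Y & ~ enters Y H].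
Proof.
elim=> [|s' Y K gs IH YL Ys' KY Ks' eK].
  by case=> Y; rewrite inE => /eqP-> HX0; exists X0; rewrite mem_head.
move=> cH; have [/IH[Z [Zs HZ nZ]]|ncH] := classic (covered s' H).
  by exists Z; rewrite mem_rcons inE Zs orbT.
case/covered_rcons: cH => // HY; exists Y; rewrite mem_rcons mem_head; split=> // eH.
by apply: ncH; rewrite (enters_uniq eH eK).
Qed.

(** By connectedness some new line X meets a covered point H; the first line
    through H already enters H, so X does not. *)
Lemma grown_extend s X1 : grown s -> X1 \in L -> X1 \notin s ->
  exists X H, [/\ X \in L, X \notin s, H \in loc X, covered s H & enters X H].
Proof.
move=> gs X1L X1s.
have [X [H [XL Xs HX cH]]] : exists X H, [/\ X \in L, X \notin s, H \in loc X & covered s H].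
  apply: NNPP => none; have [G GX0] := loc_point X0L; have [G1 G1X1] := loc_point X1L.
  case: (none); exists X1, G1; split=> //.
  apply: (@connected (covered s) _ G (locA GX0) _ G1 (locA G1X1)).
    move=> Y YL G2 G3 G2Y G3Y cG2; have [Ys|Ys] := boolP (Y \in s).
      by exists Y.
    by case: none; exists Y, G2.
  by exists X0 => //; apply: grown_root.
have [Y [Ys HY nY]] := grown_first gs cH.
exists X, H; split=> //; apply: (enters_one (grown_sub gs Ys) XL HY HX _ nY).
by apply: contraNneq Xs => <-.
Qed.

Lemma grown_full : exists2 s, grown s & s =i L.
Proof.
suff main N s : grown s -> (#|` L| - size s < N)%N -> exists2 s', grown s' & s' =i L.
  exact: main grown1 (ltnSn _).
elim: N s => // N IH s gs cN.
have [[X XL Xs]|full] := classic (exists2 X, X \in L & X \notin s).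
  have [Y [H [YL Ys HY cH eH]]] := grown_extend gs XL Xs.
  have gr := grownS gs YL Ys HY cH eH; apply: (IH _ gr).
  have : (size (rcons s Y) <= #|` L|)%N.
    apply: uniq_leq_size (grown_uniq gr) _ => Z; exact: grown_sub.
  by rewrite size_rcons; lia.
exists s => // X; apply/idP/idP => [|XL]; first exact: grown_sub.
by apply: contraT => Xs; case: full; exists X.
Qed.

Lemma grown_take s i : grown s -> (0 < i <= size s)%N -> grown (take i s).
Proof.
move=> gs; elim: gs i => [|s' X H gs IH XL Xs HX cH eH] i.
  by case: i => [|[|i]] //= _; apply: grown1.
rewrite size_rcons => /andP[i0]; rewrite leq_eqVlt => /orP[/eqP ->|lt].
  by rewrite take_oversize ?size_rcons //; apply: grownS eH.
rewrite -cats1 takel_cat //; exact/IH/andP.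
Qed.

Lemma grown_nth s i : grown s -> (0 < i < size s)%N ->
  exists H, [/\ H \in loc (nth X0 s i), enters (nth X0 s i) H
    & forall G, G \in loc (nth X0 s i) -> covered (take i s) G <-> G = H].
Proof.
move=> gs; elim: gs i => [|s' X H gs IH XL Xs HX cH eH] i; first by case: i => [|[]].
rewrite size_rcons ltnS => /andP[i0]; rewrite leq_eqVlt => /orP[/eqP E|lt].
  rewrite nth_rcons E ltnn eqxx -cats1 take_size_cat //; exists H; split=> //.
  exact: grown_attach.
rewrite nth_rcons lt -cats1 takel_cat; last exact: ltnW.
by apply: IH; rewrite i0.
Qed.
End Growth.
End TreeLikeLines.

(** * The supersolvable filtration *)

Section Main.
Variables (K : fieldType) (V : vectType K) (A : {fset {vspace V}}).
Hypotheses (A_arr : arrangement A) (A_irr : irreducible_arrangement A)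
  (A_free : free_arrangement A) (A_TF2 : TF2 A) (A_rank : (3 <= rank A)%N).
Implicit Types (X Y G H : {vspace V}) (m : {vspace V} -> nat).
Local Notation L := (L2trip A).
Local Notation loc := (localization A).

Lemma connected_prop (C : {vspace V} -> Prop) :
  (forall X, X \in L -> uniform loc C X) ->
  forall G, G \in A -> C G -> forall H, H \in A -> C H.
Proof.
move=> uC G GA CG H HA.
pose c : pred {vspace V} := fun K => if excluded_middle_informative (C K) then true else false.
have cP K' : c K' <-> C K' by rewrite /c; case: excluded_middle_informative.
apply/cP; apply: (connected_hyperplanes A_arr A_TF2 A_rank A_irr (C := c) (G0 := G)) => //.
  by move=> X XL G1 G2 G1X G2X /cP C1; apply/cP; exact: (uC X XL G1 G2 G1X G2X C1).
exact/cP.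
Qed.

(** The component of H after removal of the edge (X, H). *)
Definition side X H : {fset {vspace V}} :=
  if (X \in L) && (H \in loc X) then epsilon (inhabits fset0)
    (fun B => [/\ B `<=` A,
       forall Y, Y \in L -> Y != X -> constant_on A (fun G => G \in B) Y
     & forall G, G \in loc X -> (G \in B) = (G == H)])
  else fset0.

Lemma side_spec X H : X \in L -> H \in loc X ->
  [/\ side X H `<=` A,
     forall Y, Y \in L -> Y != X -> constant_on A (fun G => G \in side X H) Y
   & forall G, G \in loc X -> (G \in side X H) = (G == H)].
Proof.
move=> XL HX; rewrite /side XL HX /=.
have ex := bridge_side A_arr A_TF2 A_rank A_free XL HX.
exact: (epsilon_spec (inhabits fset0) _ ex).
Qed.

Lemma side_subA X H : side X H `<=` A.
Proof.
have [/andP[XL HX]|nf] := boolP ((X \in L) && (H \in loc X)).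
  by have [] := side_spec XL HX.
by rewrite /side (negPf nf) fsub0set.
Qed.

Lemma side_unif X H : X \in L -> H \in loc X ->
  forall Y, Y \in L -> Y != X -> uniform loc (fun G => G \in side X H) Y.
Proof. by move=> XL HX Y YL YX; have [_ /(_ Y YL YX)] := side_spec XL HX. Qed.

Lemma side_at X H : X \in L -> H \in loc X ->
  forall G, G \in loc X -> (G \in side X H) = (G == H).
Proof. by move=> XL HX; have [] := side_spec XL HX. Qed.

Lemma acenter_loc X : X \in flats A 2 -> acenter (loc X) = X.
Proof.
move=> XA; have [H [G [HX GX _ XE]]] := flat2P A_arr XA.
apply/eqP; rewrite eqEsubv; apply/andP; split.
  by rewrite {2}XE subv_cap !acenter_sub.
by apply/sub_acenterP => M; apply: loc_le.
Qed.

Lemma rank_loc X : X \in flats A 2 -> rank (loc X) = 2%N.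
Proof.
by move=> XA; rewrite /rank acenter_loc //; move: XA; rewrite in_flats => /andP[_ /eqP].
Qed.

(** Weighting a vector of H by the indicator of the X-side of the bridge (X, H) is
    locally linear: near X this changes only the value at H, which is zero. *)
Lemma cut_vector X H : X \in L -> H \in loc X -> exists x,
  (forall G, G \in A -> G \in side X H -> form_of G x = 0) /\
  (exists2 G, G \in loc X & form_of G x != 0).
Proof.
move=> XL HX; have [G [GX GH _]] := trip_third H H XL.
have [z [zG zH]] := dual_forms A_arr (loc_mem GX) (loc_mem HX) GH.
pose c M := if M \in side X H then 0 else form_of M z.
have [|x xE] := TF2_glue A_arr A_TF2 A_rank (c := c).
  move=> Y YA; have [YL|YL] := boolP (Y \in L); last exact: flats_linear.
  have [->|YX] := eqVneq Y X.
    exists z => M MX; rewrite /c side_at //; case: eqP => // ->.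
    by rewrite zH.
  have [[M MY Ms]|no] := classic (exists2 M, M \in loc Y & M \in side X H).
    by exists 0 => M' M'Y; rewrite /c (side_unif XL HX YL YX MY M'Y Ms) linear0.
  exists z => M MY; rewrite /c; case: ifP => // Ms.
  by case: no; exists M.
exists x; split=> [M MA Ms|]; first by rewrite -xE // /c Ms.
by exists G => //; rewrite -xE ?(loc_mem GX) // /c side_at // (negPf GH) zG oner_eq0.
Qed.

Lemma rank_add_flat (B : {fset {vspace V}}) X H x : B `<=` A -> X \in flats A 2 ->
    H \in loc X -> H \in B -> (forall G, G \in B -> form_of G x = 0) ->
    (exists2 G, G \in loc X & form_of G x != 0) ->
  rank (B `|` loc X) = (rank B).+1.
Proof.
move=> BA XA HX HB xB [G GX xG].
have neq : H != G by apply: contraNneq xG => <-; rewrite xB.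
apply/eqP; rewrite eqn_leq; apply/andP; split.
  apply: leq_trans (codimS _) (codim_capS (acenter B) (form_of G)).
  apply/sub_acenterP => M; rewrite inE => /orP[MB|MX].
    by apply: subv_trans (capvSl _ _) _; apply: acenter_sub.
  apply: subv_trans (loc_le MX); rewrite (flat2_eq A_arr XA HX GX neq).
  by rewrite (form_ofK A_arr (loc_mem GX)) capvS // acenter_sub.
rewrite ltn_neqAle codimS ?acenterS ?fsubsetUl // andbT.
apply: contra xG => /eqP E.
have sub : (acenter (B `|` loc X) <= acenter B)%VS by rewrite acenterS ?fsubsetUl.
have xin : x \in acenter (B `|` loc X).
  rewrite (codim_eq sub (esym E)); apply/mem_acenterP => M MB.
  by rewrite (mem_hyp A_arr) ?(fsubsetP BA) // xB.
have /mem_acenterP/(_ G) := xin; rewrite inE GX orbT (mem_hyp A_arr) ?(loc_mem GX) //.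
exact.
Qed.

Lemma L_nonempty : exists X, X \in L.
Proof.
have [H HA] := rank_gt0_hyp (ltnW (ltnW A_rank)).
have [G GA GH] := rank_gt1_hyp A_arr (ltnW A_rank) HA.
apply: NNPP => no; case/eqP: GH.
apply: (connected_prop (C := fun G => G = H) _ HA) => // X XL.
by case: no; exists X.
Qed.

Lemma on_line H : H \in A -> exists2 X, X \in L & H \in loc X.
Proof.
move=> HA; have [X0 X0L] := L_nonempty.
have [G [GX0 _ _]] := trip_third H H X0L.
apply: (connected_prop (C := fun G => exists2 X, X \in L & G \in loc X) _ (loc_mem GX0)) => //.
  by move=> X XL G1 G2 _ G2X _; exists X.
by exists X0.
Qed.

Definition union_of (s : seq {vspace V}) : {fset {vspace V}} :=
  [fset G in A | has (fun X => G \in loc X) s].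

Lemma union_ofP s G : reflect (covered loc s G) (G \in union_of s).
Proof.
rewrite !inE /=; apply: (iffP andP) => [[_ /hasP[X Xs GX]]|[X Xs GX]]; first by exists X.
by split; [exact: loc_mem GX|apply/hasP; exists X].
Qed.

Lemma union_of_sub s : union_of s `<=` A.
Proof. by apply/fsubsetP => G /union_ofP[X _ /loc_mem]. Qed.

Lemma union_of_rcons s X : union_of (rcons s X) = union_of s `|` loc X.
Proof.
apply/fsetP => G; rewrite inE; apply/union_ofP/orP.
  by case/covered_rcons => [/union_ofP|]; [left|right].
by move=> h; apply/covered_rcons; case: h => [/union_ofP|]; [left|right].
Qed.

Lemma union_of1 X : union_of [:: X] = loc X.
Proof.
apply/fsetP => G; apply/union_ofP/idP => [[Y]|GX]; first by rewrite inE => /eqP->.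
by exists X; rewrite ?mem_head.
Qed.

Section Ordering.
Variables (X0 : {vspace V}) (enters : {vspace V} -> {vspace V} -> Prop) (m : {vspace V} -> nat).
Hypothesis X0L : X0 \in L.
Hypothesis enters_uniq : forall X H H', enters X H -> enters X H' -> H = H'.
Hypothesis enters_one : forall X X' H, X \in L -> X' \in L -> H \in loc X ->
  H \in loc X' -> X != X' -> ~ enters X H -> enters X' H.
Hypothesis enters_root : forall H, ~ enters X0 H.
Hypothesis enters_exp : forall X H, X \in L -> H \in loc X -> enters X H ->
  is_exponent (loc X) m (m H).

Lemma rank_grown s : grown L loc X0 enters s -> rank (union_of s) = (size s).+1.
Proof.
elim=> [|s' X H gs IH XL Xs HX cH _]; first by rewrite union_of1; exact: (rank_loc (trip_flat X0L)).
rewrite union_of_rcons size_rcons -IH.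
have [x [x0 xX]] := cut_vector XL HX.
apply: (rank_add_flat (union_of_sub s') (trip_flat XL) HX _ (x := x)) => //.
  exact/union_ofP.
move=> G /union_ofP cG; apply: x0; first by case: cG => Y _ /loc_mem.
apply: (grown_connected (C := fun G => G \in side X H) gs _ cH cG).
  move=> Y Ys; apply: side_unif => //; first exact: (grown_sub X0L gs Ys).
  by apply: contraNneq Xs => <-.
by rewrite side_at.
Qed.

(** The flats are listed as they are reached from the root; the shared hyperplane
    is the one through which the flat is entered. *)
Lemma order_of_orientation : exists (X : nat -> {vspace V}) (F : nat -> {fset {vspace V}})
             (H : nat -> {vspace V}),
        [/\ perm_eq [seq X i | i <- iota 1 (rank A).-1] (L2trip A),
            supersolvable_filtration A F,
            F 2 = localization A (X 1%N) /\
            (forall i, (3 <= i <= rank A)%N ->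
               F i = F i.-1 `|` localization A (X i.-1)),
            forall i, (1 <= i <= (rank A).-1)%N ->
              H i \in A /\ localization A (X i) `&` F i = [fset H i]
          & forall i, (2 <= i <= (rank A).-1)%N ->
              is_exponent (localization A (X i)) m (m (H i))].
Proof.
have third X G H (XL : X \in L) := trip_third G H XL.
have [s gs sL] := grown_full (loc_sub A) third connected_prop X0L enters_uniq enters_one enters_root.
have us := grown_uniq gs.
have UA : union_of s = A.
  apply/eqP; rewrite eqEfsubset union_of_sub; apply/fsubsetP => G /on_line[X XL GX].
  by apply/union_ofP; exists X; rewrite ?sL.
have [N sN] : exists N, size s = N by exists (size s).
have rA : rank A = N.+1 by rewrite -sN -{1}UA rank_grown.
have [H1 [H1X0 _ _]] := third X0 X0 X0 X0L.
have nth0 : nth X0 s 0 = X0.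
  elim: gs => //= s' X H gs' IH _ _ _ _ _; rewrite nth_rcons.
  by case: (s') (grown_root gs') IH.
(* the flats are numbered from 1, and the first step of the filtration is an
   arbitrary hyperplane through the root *)
pose X i := nth X0 s i.-1.
pose F i := if (i <= 1)%N then [fset H1] else union_of (take i.-1 s).
have step i : (2 <= i <= N)%N -> exists H, [/\ H \in loc (X i), enters (X i) H
    & forall G, G \in loc (X i) -> covered loc (take i.-1 s) G <-> G = H].
  move=> ib; apply: (grown_nth side_unif side_at X0L gs).
  by rewrite sN; lia.
pose Hh i := if (i <= 1)%N then H1 else epsilon (inhabits H1) (fun H =>
  [/\ H \in loc (X i), enters (X i) H
    & forall G, G \in loc (X i) -> covered loc (take i.-1 s) G <-> G = H]).
have HhP i : (2 <= i <= N)%N -> [/\ Hh i \in loc (X i), enters (X i) (Hh i)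
    & forall G, G \in loc (X i) -> covered loc (take i.-1 s) G <-> G = Hh i].
  move=> ib; rewrite /Hh; case: leqP => [|_]; first by lia.
  exact: (epsilon_spec (inhabits H1) _ (step i ib)).
have XL i : (1 <= i <= N)%N -> X i \in L.
  by case/andP=> i0 ib; rewrite -sL; apply: mem_nth; rewrite sN prednK.
have F2 : F 2 = loc (X 1%N).
  rewrite /F /X /= nth0 -union_of1; congr union_of.
  by case: (s) nth0 (grown_root gs) => //= a s' ->; rewrite take0.
have FS i : (3 <= i <= N + 1)%N -> F i = F i.-1 `|` loc (X i.-1).
  move=> ib; rewrite /F; case: i ib => [|[|[|i]]] //= ib.
  by rewrite -union_of_rcons /X /= -take_nth // sN; lia.
have F1 : F 1 = [fset H1] by [].
have FSub i : (1 <= i < rank A)%N -> F i `<=` F i.+1.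
  rewrite rA; case: i => [|[|i]] //= ib; last by rewrite [F i.+3]FS ?fsubsetUl //=; lia.
  by rewrite F2 F1 fsub1set /X nth0.
have locF i : (1 <= i <= (rank A).-1)%N -> Hh i \in A /\ loc (X i) `&` F i = [fset Hh i].
  rewrite rA /= => ib; have [i1|i2] := leqP i 1.
    have -> : i = 1%N by lia.
    rewrite F1 /Hh /X /= nth0; split; first exact: loc_mem H1X0.
    by apply/fsetP => G; rewrite in_fsetI !in_fset1; case: eqP => [->|_]; rewrite ?andbF // H1X0.
  have [|HX eX cX] := HhP i; first by lia.
  split; first exact: loc_mem HX.
  apply/fsetP => G; rewrite in_fsetI in_fset1 /F leqNgt i2 /=.
  apply/andP/eqP => [[GX /union_ofP]|->]; first by move/(cX G GX).
  by split=> //; apply/union_ofP; apply/(cX _ HX).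
exists X, F, Hh; split=> //.
- apply: uniq_perm; rewrite ?fset_uniq //.
    rewrite map_inj_in_uniq ?iota_uniq // => i j; rewrite !mem_iota rA /= => ib jb.
    by move/eqP; rewrite nth_uniq // ?sN; [move/eqP|..]; lia.
  move=> Y; rewrite -sL rA /=; apply/mapP/idP => [[i]|Ys].
    by rewrite mem_iota => ib ->; apply: mem_nth; rewrite sN; lia.
  exists (index Y s).+1; last by rewrite /X /= nth_index.
  by rewrite mem_iota add1n /= ltnS -sN index_mem.
- split=> // [|i|i].
  + by rewrite rA /F /= -sN take_size; case: (s) UA (grown_root gs).
  + rewrite rA; case: i => [|[|i]] //= ib.
      by rewrite F1 /rank acenter1 (codim_hyp A_arr (loc_mem H1X0)).
    rewrite /F /= rank_grown ?size_takel // ?sN; first by lia.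
    by apply: grown_take => //; rewrite sN; lia.
  case: i => [|[|[|i]]] ib H H' HF H'F neq; [by []|by []| |].
    rewrite [F _]F1; exists H1; rewrite ?inE //.
    move: HF H'F; rewrite F2 /X nth0 => HX H'X.
    by rewrite -(flat2_eq A_arr (trip_flat X0L) HX H'X neq) (loc_le H1X0).
  have ib' : (3 <= i.+3 <= N + 1)%N by lia.
  move: HF H'F; rewrite FS // !in_fsetU.
  case/orP=> [HF _|HX]; first by exists H; rewrite ?capvSl.
  case/orP=> [H'F|H'X]; first by exists H'; rewrite ?capvSr.
  have ib2 : (1 <= i.+2 <= (rank A).-1)%N by lia.
  have [HhA HhE] := locF i.+2 ib2.
  have : Hh i.+2 \in loc (X i.+2) `&` F i.+2 by rewrite HhE inE.
  rewrite in_fsetI => /andP[HhX HhF]; exists (Hh i.+2) => //.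
  have XA : X i.+2 \in flats A 2 by apply/trip_flat/XL; lia.
  by rewrite -(flat2_eq A_arr XA HX H'X neq) (loc_le HhX).
- by split=> // i; rewrite rA => ib; apply: FS; rewrite addn1.
move=> i; rewrite rA /= => ib; have [HX eX _] := HhP i ib.
by apply: enters_exp => //; apply: XL; lia.
Qed.
End Ordering.
End Main.

(** * The reduced incidence graph *)

Section Graph.
Variables (K : fieldType) (V : vectType K) (A : {fset {vspace V}}).
Hypotheses (A_arr : arrangement A) (A_irr : irreducible_arrangement A)
  (A_free : free_arrangement A) (A_TF2 : TF2 A) (A_rank : (3 <= rank A)%N).
Implicit Types (X Y G H : {vspace V}) (m : {vspace V} -> nat).
Local Notation L := (L2trip A).
Local Notation loc := (localization A).
Local Notation toward := (toward loc (side A)).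

Let third X G H (XL : X \in L) := trip_third G H XL.
Let conn := connected_prop A_arr A_irr A_TF2 A_rank.
Let sideA := side_subA A_arr A_free A_TF2 A_rank.
Let sideU := side_unif A_arr A_free A_TF2 A_rank.
Let sideE := side_at A_arr A_free A_TF2 A_rank.

(** The spreading set is the set of hyperplanes whose cofactor, in the family
    attached to a bad flag, does not vanish at the origin.  At the bad flag itself
    the cofactor minus one vanishes there, so the cofactor does not. *)
Lemma root_of_free m : multiplicity A m -> free_multiplicity A m ->
  exists2 R, R \in L & forall X H, X \in L -> H \in loc X -> toward R X H ->
    is_exponent (loc X) m (m H).
Proof.
move=> mpos m_free; have [X0 X0L] := L_nonempty A_arr A_irr A_TF2 A_rank.
have spread X1 H1 : X1 \in L -> H1 \in loc X1 -> ~ unit_value A m X1 H1 ->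
  exists Z : {vspace V} -> Prop, Z H1 /\ forall Y G, Y \in L -> Y != X1 ->
    G \in loc Y -> Z G ->
    unit_value A m Y G /\ forall G', G' \in loc Y -> unit_value A m Y G' -> Z G'.
  move=> X1L H1X1 bad.
  have [f [fY [v vE]]] := free_flag_cofactors A_arr A_TF2 A_rank m_free (trip_flat X1L) H1X1.
  exists (fun G => mcoeff 0 (f G) != 0); split.
    apply/eqP => f0; apply: bad; exists v, (f H1 - 1); split.
    - by move=> G GX; exists (f G - (G == H1)%:R); apply: vE.
    - by rewrite vE // eqxx.
    by rewrite rmorphB rmorph1 /= f0 sub0r oppr_eq0 oner_eq0.
  move=> Y G YL YX1 GY fG; have [w wE] := fY Y (trip_flat YL) YX1.
  have wLD : log_field (loc Y) m w by move=> G' G'Y; exists (f G'); apply: wE.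
  split; first by exists w, (f G); split=> //; apply: wE.
  move=> G' G'Y gG'; have [<- //|neq] := eqVneq G G'.
  exact: (unit_value_propagate A_arr YL mpos GY G'Y neq wLD (wE G GY) fG gG' (wE G' G'Y)).
have [R RL Rgood] := exists_root (loc_sub A) third conn sideA sideU sideE spread X0L.
exists R => // X H XL HX tR.
exact: (unit_value_exponent A_arr (trip_flat XL) HX (Rgood X H XL HX tR)).
Qed.

Local Notation vertex := (reduced_vertex A).
Local Notation edge := (@reduced_edge K V A).

Definition line_vertex X (XL : X \in L) : vertex :=
  exist (fun v => reduced_vertex_pred v) (inl [` XL]) isT.

(** A hyperplane on two lines has valence at least two and survives in the reduced
    graph. *)
Lemma hyp_vertex H X X' : X \in L -> X' \in L -> H \in loc X -> H \in loc X' -> X != X' ->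
  exists v : vertex, exists HA : H \in A, val v = inr [` HA].
Proof.
move=> XL X'L HX HX' neq; have HA := loc_mem HX.
suff red : @reduced_vertex_pred K V A (inr [` HA]).
  by exists (exist (fun v => reduced_vertex_pred v) _ red), HA.
apply/eqP => /eqP/cards1P[u uE].
have : inl [` XL] \in [set u : incidence_vertex A | incidence_edge u (inr [` HA])].
  by rewrite inE /= (loc_le HX).
have : inl [` X'L] \in [set u : incidence_vertex A | incidence_edge u (inr [` HA])].
  by rewrite inE /= (loc_le HX').
rewrite uE !inE => /eqP <- /eqP[E]; case/eqP: neq; exact: E.
Qed.

Lemma edge_sym u v : edge u v = edge v u.
Proof. by rewrite /reduced_edge; case: (val u) (val v) => [?|?] [?|?]. Qed.

(** Destructs the nested subtypes once and for all. *)
Variant vertex_spec (v : vertex) : Prop :=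
| LineVertex X (XL : X \in L) of val v = inl [` XL]
| HypVertex H (HA : H \in A) of val v = inr [` HA].

Lemma vertexP v : vertex_spec v.
Proof.
case E: (val v) => [[X XL]|[H HA]]; first by apply: (@LineVertex _ X XL).
exact: (@HypVertex _ H HA).
Qed.

Lemma val_line_inj (u v : vertex) X (XL XL' : X \in L) :
  val u = inl [` XL] -> val v = inl [` XL'] -> u = v.
Proof. by move=> uE vE; apply: val_inj; rewrite uE vE; congr inl; apply: val_inj. Qed.

Lemma val_hyp_inj (u v : vertex) H (HA HA' : H \in A) :
  val u = inr [` HA] -> val v = inr [` HA'] -> u = v.
Proof. by move=> uE vE; apply: val_inj; rewrite uE vE; congr inr; apply: val_inj. Qed.

Lemma edgeLH (u v : vertex) X (XL : X \in L) H (HA : H \in A) :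
  val u = inl [` XL] -> val v = inr [` HA] -> edge u v = (H \in loc X).
Proof. by move=> uE vE; rewrite /reduced_edge uE vE in_loc HA. Qed.

Lemma edgeHL (u v : vertex) X (XL : X \in L) H (HA : H \in A) :
  val u = inl [` XL] -> val v = inr [` HA] -> edge v u = (H \in loc X).
Proof. by rewrite edge_sym; apply: edgeLH. Qed.

Lemma edgeLL (u v : vertex) X (XL : X \in L) Y (YL : Y \in L) :
  val u = inl [` XL] -> val v = inl [` YL] -> edge u v = false.
Proof. by move=> uE vE; rewrite /reduced_edge uE vE. Qed.

Lemma edgeHH (u v : vertex) G (GA : G \in A) H (HA : H \in A) :
  val u = inr [` GA] -> val v = inr [` HA] -> edge u v = false.
Proof. by move=> uE vE; rewrite /reduced_edge uE vE. Qed.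

(** The points G reached from x, directly or through a line, form a union of
    components. *)
Lemma reduced_connected x y : connect edge x y.
Proof.
pose C G := exists2 v : vertex, connect edge x v &
  match val v with inl X => G \in loc (val X) | inr H => val H = G end.
have toL X (XL : X \in L) G : G \in loc X -> C G -> connect edge x (line_vertex XL).
  move=> GX [v xv]; case: (vertexP v) => [Y YL E|H HA E]; rewrite E /=; last first.
    move=> HG; apply: connect_trans xv (connect1 _).
    by rewrite (edgeHL (u := line_vertex XL) (XL := XL) erefl E) // HG.
  move=> GY; have [YX|YX] := eqVneq Y X.
    by subst Y; rewrite (val_line_inj (v := v) (u := line_vertex XL) (XL := XL) erefl E).
  have [g [GA gE]] := hyp_vertex YL XL GY GX YX.
  apply: connect_trans xv (connect_trans (connect1 (y := g) _) (connect1 _)).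
    by rewrite (edgeLH E gE).
  by rewrite (edgeHL (u := line_vertex XL) (XL := XL) erefl gE).
have Cu X : X \in L -> uniform loc C X.
  by move=> XL G1 G2 G1X G2X CG1; exists (line_vertex XL); rewrite ?(toL X XL G1).
have [G0 G0A CG0] : exists2 G, G \in A & C G.
  case: (vertexP x) => [X XL E|H HA E].
    have [G [GX _ _]] := third X X XL; exists G; first exact: loc_mem GX.
    by exists x; rewrite ?E.
  by exists H => //; exists x; rewrite ?E.
have CA := conn Cu G0A CG0.
case: (vertexP y) => [X XL E|H HA E].
  have [G [GX _ _]] := third X X XL.
  rewrite (val_line_inj (u := y) (v := line_vertex XL) (XL' := XL) E) //.
  exact: toL GX (CA G (loc_mem GX)).
have [v xv] := CA H HA; case: (vertexP v) => [X XL E'|G GA E']; rewrite E' /=.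
  by move=> HX; apply: connect_trans xv (connect1 _); rewrite (edgeLH E' E).
by move=> GH; subst G; rewrite -(val_hyp_inj E' E).
Qed.

(** Along a path avoiding X one stays on the same side of the bridge (X, H). *)
Lemma path_side X (XL : X \in L) H (h : vertex) q : H \in loc X ->
    let phi (v : vertex) := match val v with
      | inl Y => exists2 G, G \in loc (val Y) & G \in side A X H
      | inr G => val G \in side A X H end in
  path edge h q -> line_vertex XL \notin h :: q -> phi h -> phi (last h q).
Proof.
move=> HX phi; elim: q h => //= w q IH h /andP[hw wq].
rewrite !inE negb_or => /andP[hX]; rewrite negb_or => /andP[wX Xq] ph.
apply: IH => //; first by rewrite inE negb_or wX.
case: (vertexP h) (vertexP w) => [Y YL hE|G GA hE] [Z ZL wE|G' G'A wE].
- by rewrite (edgeLL hE wE) in hw.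
- move: hw ph; rewrite (edgeLH hE wE) /phi hE wE /= => G'Y [M MY Ms].
  have YX : Y != X.
    apply: contraNneq hX => E; subst Y.
    by rewrite (val_line_inj (v := h) (u := line_vertex XL) (XL := XL) erefl hE).
  exact: (sideU XL HX YL YX MY G'Y Ms).
- by move: hw ph; rewrite (edgeHL wE hE) /phi hE wE /= => GZ Gs; exists G.
by rewrite (edgeHH hE wE) in hw.
Qed.

(** A cycle through X leaves X by some H and comes back, avoiding X, through another
    hyperplane, which would then lie on the side of H. *)
Lemma reduced_acyclic (c : seq vertex) : (2 < size c)%N -> ~ ucycle edge c.
Proof.
have from_line X (XL : X \in L) (x : vertex) p : val x = inl [` XL] ->
    (2 < size (x :: p))%N -> ~ ucycle edge (x :: p).
  move=> xE; have {xE}-> : x = line_vertex XL by apply: val_line_inj xE _; last reflexivity.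
  case: p => [//|h [//|w q]] _ /andP[/= /andP[Xh /andP[hw]]].
  rewrite rcons_path => /andP[wq zX] /andP[Xn /andP[hn _]].
  case: (vertexP h) => [Y YL hE|H HA hE].
    by rewrite (edgeLL (u := line_vertex XL) (XL := XL) erefl hE) in Xh.
  have HX : H \in loc X by rewrite (edgeLH (u := line_vertex XL) (XL := XL) erefl hE) in Xh.
  have := @path_side X XL H h (w :: q) HX; rewrite /= hw wq => /(_ isT Xn).
  rewrite hE /= sideE // eqxx => /(_ isT).
  case: (vertexP (last w q)) => [Y YL zE|G GA zE].
    by rewrite (edgeLL (v := line_vertex XL) (YL := XL) zE erefl) in zX.
  rewrite zE /=; have GX : G \in loc X.
    by rewrite (edgeHL (u := line_vertex XL) (XL := XL) erefl zE) in zX.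
  rewrite sideE // => /eqP E; subst G.
  by move: hn; rewrite (val_hyp_inj hE zE) mem_last.
case: c => [//|x p] sz; case: (vertexP x) => [X XL xE|H HA xE].
  exact: from_line xE sz.
case: p sz => [//|y p] sz cyc; case: (vertexP y) => [X XL yE|G GA yE].
  apply: (from_line X XL y (rcons p x) yE); first by rewrite /= size_rcons.
  have -> : y :: rcons p x = rot 1 [:: x, y & p] by rewrite /rot /= cats1.
  by rewrite /ucycle rot_cycle rot_uniq.
by case/andP: cyc => /= /andP[+ _] _; rewrite (edgeHH xE yE).
Qed.

Lemma reduced_tree : is_tree edge.
Proof.
split; [|exact: reduced_connected|exact: reduced_acyclic].
have [X XL] := L_nonempty A_arr A_irr A_TF2 A_rank.
by apply/card_gt0P; exists (line_vertex XL).
Qed.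

Definition directed_from R : rel vertex := fun u v =>
  match val u, val v with
  | inl X, inr H => (val H \in loc (val X)) && ~~ toward R (val X) (val H)
  | inr H, inl X => (val H \in loc (val X)) && toward R (val X) (val H)
  | _, _ => false
  end.

Lemma orientation_of_root m R : R \in L ->
    (forall X H, X \in L -> H \in loc X -> toward R X H -> is_exponent (loc X) m (m H)) ->
  exists o : rel vertex,
    [/\ orientation edge o,
        forall u u' v, o u v -> o u' v -> u = u',
        exists X : L, forall v, no_incoming o v <-> val v = inl X
      & forall u v (H : A) (X : L),
          o u v -> val u = inr H -> val v = inl X ->
          is_exponent (loc (val X)) m (m (val H))].
Proof.
move=> RL Rexp; exists (directed_from R); split.
- move=> u v; rewrite /directed_from.
  case: (vertexP u) (vertexP v) => [X XL uE|G GA uE] [Y YL vE|H HA vE].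
  + by rewrite (edgeLL uE vE) uE vE.
  + rewrite (edgeLH uE vE) uE vE /=; case: (H \in loc X) => //=.
    by case: toward.
  + rewrite (edgeHL vE uE) uE vE /=; case: (G \in loc Y) => //=.
    by case: toward.
  by rewrite (edgeHH uE vE) uE vE.
- move=> u u' v; rewrite /directed_from.
  case: (vertexP v) => [Y YL vE|H HA vE]; rewrite vE;
    case: (vertexP u) => [X XL uE|G GA uE]; rewrite uE //=;
    case: (vertexP u') => [X' X'L u'E|G' G'A u'E]; rewrite u'E //=.
    move=> /andP[GY tG] /andP[G'Y tG'].
    have E := toward_uniq (loc_sub A) third conn sideU sideE RL YL GY G'Y tG tG'.
    by subst G'; apply: val_hyp_inj uE u'E.
  move=> /andP[HX nt] /andP[HX' nt'].
  have [E|neq] := eqVneq X X'; first by subst X'; apply: val_line_inj uE u'E.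
  by rewrite (toward_one (loc_sub A) third conn sideU sideE RL XL X'L HX HX' neq nt) in nt'.
- exists [` RL] => v; split=> [nv|vE u]; last first.
    rewrite /directed_from vE; case: (val u) => // H /=.
    by rewrite /toward eqxx andbF.
  case: (vertexP v) => [X XL vE|H HA vE].
    have [RX|RX] := eqVneq R X; first by subst X; rewrite vE; congr inl; apply: val_inj.
    have [H HX tH] := toward_exists (loc_sub A) third conn sideU sideE RL XL RX.
    have [X' [X'L HX' nt]] := not_toward_exists (loc_sub A) third conn sideU sideE RL (loc_mem HX).
    have neq : X != X' by apply: contraNneq nt => <-.
    have [h [HA hE]] := hyp_vertex XL X'L HX HX' neq.
    by have := nv h; rewrite /directed_from hE vE /= HX tH.
  have [X [XL HX nt]] := not_toward_exists (loc_sub A) third conn sideU sideE RL HA.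
  by have := nv (line_vertex XL); rewrite /directed_from vE /= HX nt.
move=> u v H X; rewrite /directed_from => + uE vE.
by rewrite uE vE => /andP[HX tH]; apply: Rexp => //; apply: valP.
Qed.

Lemma order_of_reduced_orientation m (o : rel vertex) :
    orientation edge o -> (forall u u' v, o u v -> o u' v -> u = u') ->
    (exists X : L, forall v, no_incoming o v <-> val v = inl X) ->
    (forall u v (H : A) (X : L), o u v -> val u = inr H -> val v = inl X ->
       is_exponent (loc (val X)) m (m (val H))) ->
  exists (X : nat -> {vspace V}) (F : nat -> {fset {vspace V}}) (H : nat -> {vspace V}),
    [/\ perm_eq [seq X i | i <- iota 1 (rank A).-1] L,
        supersolvable_filtration A F,
        F 2 = loc (X 1%N) /\
        (forall i, (3 <= i <= rank A)%N -> F i = F i.-1 `|` loc (X i.-1)),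
        forall i, (1 <= i <= (rank A).-1)%N ->
          H i \in A /\ loc (X i) `&` F i = [fset H i]
      & forall i, (2 <= i <= (rank A).-1)%N -> is_exponent (loc (X i)) m (m (H i))].
Proof.
move=> orient one [[R RL] root] oexp.
pose enters X H := exists u v (XL : X \in L) (HA : H \in A),
  [/\ val u = inr [` HA], val v = inl [` XL] & o u v].
apply: (@order_of_orientation K V A A_arr A_irr A_free A_TF2 A_rank R enters m RL).
- move=> X H H' [u [v [XL [HA [uE vE ouv]]]]] [u' [v' [XL' [HA' [u'E v'E ouv']]]]].
  have vv : v = v' by apply: val_line_inj vE v'E.
  have uu : u = u' by apply: one ouv _; rewrite vv.
  by move: u'E; rewrite -uu uE => -[].
- move=> X X' H XL X'L HX HX' neq nX.
  have [h [HA hE]] := hyp_vertex XL X'L HX HX' neq.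
  have into Y (YL : Y \in L) : H \in loc Y -> ~ enters Y H -> o (line_vertex YL) h.
    move=> HY nY; have [e1 _] := orient (line_vertex YL) h.
    move: e1; rewrite (edgeLH (u := line_vertex YL) (XL := YL) erefl hE) HY.
    case/esym/orP => // ohY; case: nY.
    by exists h, (line_vertex YL), YL, HA.
  apply: NNPP => nX'; case/eqP: neq.
  by have := one _ _ _ (into X XL HX nX) (into X' X'L HX' nX') => /(congr1 val)/=[].
- move=> H [u [v [XL [HA [uE vE ouv]]]]].
  have /root/(_ u) : val v = inl [` RL] by rewrite vE; congr inl; apply: val_inj.
  by rewrite ouv.
move=> X H XL HX [u [v [XL' [HA [uE vE ouv]]]]].
exact: (oexp u v [` HA] [` XL'] ouv uE vE).
Qed.
End Graph.

Theorem theorem6p6 (K : fieldType) (V : vectType K) (A : {fset {vspace V}})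
    (m : {vspace V} -> nat)
    (A_arr : arrangement A)
    (A_irr : irreducible_arrangement A)
    (A_free : free_arrangement A)
    (A_TF2 : TF2 A)
    (A_rank : (3 <= rank A)%N)
    (m_mult : multiplicity A m) :
  [/\ supersolvable A,
      is_tree (@reduced_edge K V A),
      free_multiplicity A m <->
      exists o : rel (reduced_vertex A),
        [/\ orientation (@reduced_edge K V A) o,
            forall u u' v, o u v -> o u' v -> u = u',
            exists X : L2trip A, forall v, no_incoming o v <-> val v = inl X
          & forall u v (H : A) (X : L2trip A),
              o u v -> val u = inr H -> val v = inl X ->
              is_exponent (localization A (val X)) m (m (val H))]
    & free_multiplicity A m <->
      exists (X : nat -> {vspace V}) (F : nat -> {fset {vspace V}})
             (H : nat -> {vspace V}),
        [/\ perm_eq [seq X i | i <- iota 1 (rank A).-1] (L2trip A),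
            supersolvable_filtration A F,
            F 2 = localization A (X 1%N) /\
            (forall i, (3 <= i <= rank A)%N ->
               F i = F i.-1 `|` localization A (X i.-1)),
            forall i, (1 <= i <= (rank A).-1)%N ->
              H i \in A /\ localization A (X i) `&` F i = [fset H i]
          & forall i, (2 <= i <= (rank A).-1)%N ->
              is_exponent (localization A (X i)) m (m (H i))]].
Proof.
have orient m' (mpos : multiplicity A m') (m_free : free_multiplicity A m') :=
  let: ex_intro2 R RL Rexp := root_of_free A_arr A_irr A_free A_TF2 A_rank mpos m_free in
  orientation_of_root A_arr A_irr A_free A_TF2 A_rank RL Rexp.
have order m' o h1 h2 h3 h4 :=
  @order_of_reduced_orientation K V A A_arr A_irr A_free A_TF2 A_rank m' o h1 h2 h3 h4.
have order_is_free X F H :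
    perm_eq [seq X i | i <- iota 1 (rank A).-1] (L2trip A) ->
    supersolvable_filtration A F ->
    F 2 = localization A (X 1%N) /\
      (forall i, (3 <= i <= rank A)%N -> F i = F i.-1 `|` localization A (X i.-1)) ->
    (forall i, (1 <= i <= (rank A).-1)%N ->
      H i \in A /\ localization A (X i) `&` F i = [fset H i]) ->
    (forall i, (2 <= i <= (rank A).-1)%N ->
      is_exponent (localization A (X i)) m (m (H i))) -> free_multiplicity A m.
  move=> /perm_mem Xperm [FA _ Fr _] [F2 FS] FH Fexp.
  apply: (free_of_order A_arr A_rank m_mult _ FA Fr F2 FS FH Fexp) => i ib.
  apply: trip_flat; rewrite -Xperm; apply/mapP; exists i => //.
  by rewrite mem_iota; lia.
split.
- have [|o [h1 h2 h3 h4]] := orient (fun=> 1%N) _ A_free; first by [].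
  by have [X [F [H [_ Fss _ _ _]]]] := order _ o h1 h2 h3 h4; exists F.
- exact: reduced_tree.
- split=> [/(orient m m_mult)//|[o [h1 h2 h3 h4]]].
  have [X [F [H [c1 c2 c3 c4 c5]]]] := order _ o h1 h2 h3 h4.
  exact: order_is_free c1 c2 c3 c4 c5.
split=> [/(orient m m_mult)[o [h1 h2 h3 h4]]|[X [F [H [c1 c2 c3 c4 c5]]]]].
  exact: order h1 h2 h3 h4.
exact: order_is_free c1 c2 c3 c4 c5.
Qed.
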